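(* Consider the product space $\mathbb{R}^n$ endowed with the product Gaussian measure $\mu^{\otimes n}$, where $\mu$ is the standard Gaussian measure on $\mathbb{R}$. For any Borel-measurable set $A\subset\mathbb{R}^n$, we have: (1) if $\mu^{\otimes n}(A)=t$, then $$\sum_{i=1}^n\frac{I_i^{\mathcal G}(A)}{\sqrt{-\log I_i^{\mathcal G}(A)}}\ge c_1\,t(1-t);$$ (2) if $A$ is monotone and $\sum_{i=1}^n I_i^{\mathcal G}(A)\sqrt{-\log I_i^{\mathcal G}(A)}=s$, then (for every $\epsilon>0$) there exists a set $B\subset\mathbb{R}^n$ such that $1_B$ is determined by at most $\exp(c_2 s/\epsilon)$ coordinates and $\mu^{\otimes n}(A\bigtriangleup B)\le\epsilon$, where $c_1$ and $c_2$ are universal (positive) constants.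
   Context: Geometric influence: for a probability measure $\nu$ on $\mathbb{R}$ and a Borel-measurable $S\subseteq\mathbb{R}$, the lower Minkowski content is $\nu^+(S)=\liminf_{r\downarrow 0}\frac{\nu(S+[-r,r])-\nu(S)}{r}$ (Minkowski sum). For $A\subseteq\mathbb{R}^n$, $x\in\mathbb{R}^n$ and $1\le i\le n$, let $A_i^x=\{y\in\mathbb{R}:(x_1,\dots,x_{i-1},y,x_{i+1},\dots,x_n)\in A\}$. The geometric influence of the $i$th coordinate on $A$ with respect to $\nu^{\otimes n}$ is $I_i^{\mathcal G}(A)=\mathbb{E}_{x\sim\nu^{\otimes n}}[\nu^+(A_i^x)]$. Here $\nu=\mu$. Monotone means increasing ($x\in A$, $y_j\ge x_j$ for all $j$ imply $y\in A$) or decreasing (the same with $y_j\le x_j$). ''$1_B$ is determined by at most $k$ coordinates'' means that there is a set $J\subseteq\{1,\dots,n\}$ with $|J|\le k$ such that $1_B(x)$ depends only on $(x_j)_{j\in J}$. $A\bigtriangleup B$ is the symmetric difference. *)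

(* Defs.v *)
From HB Require Import structures.
From mathcomp Require Import all_boot all_order all_algebra.
From mathcomp Require Import all_classical all_reals all_analysis.

Set Implicit Arguments.
Unset Strict Implicit.
Unset Printing Implicit Defensive.

Import Order.TTheory GRing.Theory Num.Theory.
Import numFieldNormedType.Exports.

Local Open Scope classical_set_scope.
Local Open Scope ring_scope.

Section product_probability.
Context d (T : measurableType d) (R : realType).

Definition cons_pair n (x : T * n.-tuple T) : n.+1.-tuple T :=
  [tuple of x.1 :: x.2].

Lemma measurable_cons_pair n :
  measurable_fun [set: T * n.-tuple T] (@cons_pair n).
Proof. exact: measurable_cons. Qed.

HB.instance Definition _ n := isMeasurableFun.Build _ _ _ _
  (@cons_pair n) (@measurable_cons_pair n).

Section product_probability_setT.
Variables (P : probability T R) (n : nat) (Q : probability (n.-tuple T) R).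

Lemma product_measure1_setT : (P \x Q)%E [set: T * n.-tuple T] = 1%E.
Proof.
rewrite -setXTT product_measure1E//.
transitivity ((P setT) * (Q setT))%E => //.
by rewrite 2!probability_setT mule1.
Qed.

HB.instance Definition _ :=
  Measure_isProbability.Build _ _ _ (P \x Q)%E product_measure1_setT.

End product_probability_setT.

Fixpoint product_prob (P : probability T R) n : probability (n.-tuple T) R :=
  if n is n'.+1
  then distribution (P \x product_prob P n')%E (@cons_pair n')
  else \d_([tuple] : 0.-tuple T).

Lemma product_prob_box (P : probability T R) n (A : 'I_n -> set T) :
  (forall i, measurable (A i)) ->
  (product_prob P n [set x | forall i, A i (tnth x i)] = \prod_(i < n) P (A i))%E.
Proof.
have mbox m (B : 'I_m -> set T) : (forall i, measurable (B i)) ->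
    measurable [set x : m.-tuple T | forall i, B i (tnth x i)].
  move=> mB; rewrite (_ : mkset _ =
    \bigcap_(i in [set: 'I_m]) ((@tnth m T) ^~ i @^-1` B i)).
    apply: fin_bigcap_measurable => // i _; rewrite -[X in measurable X]setTI.
    exact: measurable_tnth.
  by apply/seteqP; split => x /= Bx i => [_|]; exact: Bx.
elim: n A => [|n IHn] A mA /=.
  by rewrite big_ord0 diracE mem_set//= => -[].
rewrite big_ord_recl -IHn// /distribution /pushforward.
transitivity ((P \x product_prob P n)
  (A ord0 `*` [set x | forall i, A (lift ord0 i) (tnth x i)]))%E.
  congr (_ _); apply/seteqP; split => -[x y] /=.
    move=> Axy; split; first exact: (Axy ord0).
    by move=> i; have := Axy (lift ord0 i); rewrite tnthS.
  move=> [Ax Ay] i; case: (unliftP ord0 i) => [j|] ->; last exact: Ax.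
  by rewrite tnthS; exact: Ay.
apply: product_measure1E => //.
by apply: (mbox n (fun i => A (lift ord0 i))) => i; exact: mA.
Qed.
End product_probability.

(* normal_prob lives on measurableTypeR R, which is R with its Borel sigma-algebra;
   the sigma-algebra on tuples is the product one, i.e. the Borel one of R^n. *)
Notation tupleR R n := (n.-tuple (measurableTypeR R)).

Section geometric_influence.
Context {R : realType}.
Implicit Types (nu : probability (measurableTypeR R) R) (S : set R).

(* The Minkowski sum S + [- r, r]. *)
Definition thickening S (r : R) : set R :=
  [set y + z | y in S & z in `[- r, r]].

Definition lower_minkowski_content nu S : \bar R :=
  limf_einf (fun r : R =>
    ((nu (thickening S r) - nu S) / r%:E)%E) 0^'+.

Definition fiber n (A : set (tupleR R n)) (x : tupleR R n) (i : 'I_n) : set R :=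
  [set y : R | A [tuple if j == i then y else tnth x j | j < n]].

(* For A Borel the integrand is measurable for the completion of the product
   measure, but not obviously Borel. The library integral of a nonnegative
   function is the supremum of the integrals of the measurable simple functions
   below it, which for such an integrand is its integral for the completion. *)
Definition geometric_influence nu n (A : set (tupleR R n)) (i : 'I_n) :
    \bar R :=
  (\int[product_prob nu n]_x lower_minkowski_content nu (fiber A x i))%E.

End geometric_influence.

(* With a = 0 the two functions below are 0, since - log 0 = +oo; with a >= 1 the
   quotient is +oo, since sqrte vanishes on [-oo, 0] and 0^-1 = +oo. *)
Definition div_sqrt_log {R : realType} (a : \bar R) : \bar R :=
  (a / sqrte (- lne a))%E.

Definition mul_sqrt_log {R : realType} (a : \bar R) : \bar R :=
  (a * sqrte (- lne a))%E.

Lemma div_sqrt_log0 {R : realType} : div_sqrt_log (0 : \bar R)%E = 0%E.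
Proof. by rewrite /div_sqrt_log mul0e. Qed.

Lemma div_sqrt_log_EFin {R : realType} (a : R) : 0 < a < 1 ->
  div_sqrt_log a%:E = (a / Num.sqrt (- ln a))%:E.
Proof.
move=> /andP[a0 a1]; rewrite /div_sqrt_log lne_EFin//= inver gt_eqF//.
by rewrite sqrtr_gt0 oppr_gt0 ln_lt0// a0.
Qed.

Lemma div_sqrt_log_ge1 {R : realType} (a : \bar R) : (1 <= a)%E ->
  div_sqrt_log a = +oo%E.
Proof.
move=> a1; rewrite /div_sqrt_log (_ : sqrte _ = 0%E).
  by rewrite inve0 gt0_muley// (lt_le_trans _ a1).
move: a a1 => [a| |]//=; rewrite lee_fin => a1.
rewrite leNgt (lt_le_trans ltr01 a1)/= ler0_sqrtr// oppr_le0.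
exact: ln_ge0.
Qed.

Lemma mul_sqrt_log0 {R : realType} : mul_sqrt_log (0 : \bar R)%E = 0%E.
Proof. by rewrite /mul_sqrt_log mul0e. Qed.

Lemma mul_sqrt_log_EFin {R : realType} (a : R) : 0 < a ->
  mul_sqrt_log a%:E = (a * Num.sqrt (- ln a))%:E.
Proof. by move=> a0; rewrite /mul_sqrt_log lne_EFin. Qed.

Section sets_of_tuples.
Context {R : realType} {n : nat}.
Implicit Types (A B : set (tupleR R n)) (J : {set 'I_n}).

Definition increasing_set A := forall x y : tupleR R n,
  A x -> (forall j, (tnth x j : R) <= tnth y j) -> A y.

Definition decreasing_set A := forall x y : tupleR R n,
  A x -> (forall j, (tnth y j : R) <= tnth x j) -> A y.

Definition monotone_set A := increasing_set A \/ decreasing_set A.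

Definition determined_by J B := forall x y : tupleR R n,
  (forall j, j \in J -> tnth x j = tnth y j) -> B x <-> B y.

Definition determined_by_at_most (k : R) B :=
  exists J : {set 'I_n}, #|J|%:R <= k /\ determined_by J B.

End sets_of_tuples.

Notation std_gaussian R := (normal_prob (0 : R) (1 : R)).
Notation gaussian_pow R n := (product_prob (std_gaussian R) n).

(* Main.v *)
(* For a set S of the line let q = min(p, 1 - p), p being its Gaussian measure.
   The one-dimensional Gaussian isoperimetric inequality is used in the form
   sum_(1 <= k <= K) min(q, 2^-k) <= C sqrt(K) nu^+(S).  Hence the geometric
   influences control the numbers m_k(j) = E min(p_j, 1 - p_j, 2^-k), where p_j is
   the measure of the random fiber of A in direction j.  These numbers are
   Lipschitz in p_j, so that they survive the approximation of A by a union of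
   cells of the grid of 2^m Gaussian quantiles in each coordinate, that is, by a
   subset of a finite uniform product space.

   Writing each grid coordinate with m bits makes the log-Sobolev inequality of
   the bit-flip Dirichlet form available.  For a set all of whose fibers are
   thresholds, flipping the bits of coordinate j has energy at most 2 sum_k m_k(j).
   A monotone set has threshold fibers; any other set acquires them by two-point
   compressions, which keep its measure and, by concavity of q |-> min(q, 2^-k),
   do not increase m_k(j).

   By the argument of Falik and Samorodnitsky, log-Sobolev applied to a martingale
   difference d gives |d|_2^2 ln(1/lambda) <= energy(d) + |d|_1^2 / lambda.
   For (1) the coordinates are ordered by influence and lambda_j = 2^-K_j with
   K_j close to log2 (1/I_j).  For (2) lambda is constant, only the coordinates of
   low influence are averaged out, and the conditional expectation is rounded. *)
From HB Require Import structures.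
Require Import Defs.
From mathcomp Require Import all_boot all_order all_algebra perm.
From mathcomp Require Import all_classical all_reals all_analysis.
From mathcomp Require Import measurable_realfun.
From mathcomp Require Import ring lra zify.

Set Implicit Arguments.
Unset Strict Implicit.
Unset Printing Implicit Defensive.

Import Order.TTheory GRing.Theory Num.Theory.
Import numFieldNormedType.Exports.

Local Open Scope classical_set_scope.
Local Open Scope ring_scope.

(** * Finite products and the dyadic grid *)

(** The geometric influence is unstable under approximation in measure: a null set can make it
    infinite. Hence it enters only through the truncated quantities, whose scales are dictated by
    the bits. Among 2^m quantiles, the pairs that differ in the bit of weight 2^(m-k) and straddle a
    threshold number at most 2^m min(p, 1 - p, 2^-k). For q near 2^-L these bounds sum to order L q,
    while the Gaussian profile is only of order q sqrt(L); stopping the sum at level K keeps the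
    loss at sqrt(K). If 2^-K is close to an influence I, the levels above K add at most 2^-K, so the
    energy of a coordinate is of order I sqrt(log(1/I)). This is the summand of (2), and dividing it
    by the logarithmic gain K gives the summand of (1).

    Compression is harmless in (1), whose conclusion sees only the measure of A. In (2) A itself
    must be approximated, so its monotonicity has to survive discretization; there A is approximated
    from inside by whole cells. *)

Section entropy_inequalities.
Context {R : realType}.
Implicit Types (a b : R).

Lemma le_sqrt_sum_mul (I : Type) (s : seq I) (f g : I -> R) :
  \sum_(k <- s) f k * g k <=
  Num.sqrt (\sum_(k <- s) f k ^+ 2) * Num.sqrt (\sum_(k <- s) g k ^+ 2).
Proof.
set A := \sum_(k <- s) f k ^+ 2; set B := \sum_(k <- s) g k ^+ 2.
set D := \sum_(k <- s) f k * g k.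
have A0 : 0 <= A by apply: sumr_ge0 => k _; exact: sqr_ge0.
have B0 : 0 <= B by apply: sumr_ge0 => k _; exact: sqr_ge0.
have H t : 0 <= A - 2 * t * D + t ^+ 2 * B.
  have : 0 <= \sum_(k <- s) (f k - t * g k) ^+ 2.
    by apply: sumr_ge0 => k _; exact: sqr_ge0.
  rewrite (_ : \sum_(k <- s) _ = A - 2 * t * D + t ^+ 2 * B)//.
  rewrite /A /B /D !mulr_sumr -sumrB -big_split/=.
  by apply: eq_bigr => k _; ring.
suff DAB : D ^+ 2 <= A * B.
  rewrite -sqrtrM// (le_trans (ler_norm _))// -sqrtr_sqr ler_wsqrtr//.
have [B_eq0|B_neq0] := eqVneq B 0.
  have [->|D0] := eqVneq D 0; first by rewrite expr0n/= mulr_ge0.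
  (* With [B = 0] the polynomial is affine in [t], and this [t] would give it the value -1. *)
  have := H ((A + 1) / (2 * D)).
  rewrite B_eq0 mulr0 addr0 (_ : 2 * _ * D = A + 1); first by lra.
  by field.
have Bp : 0 < B by rewrite lt_def B_neq0.
have := H (D / B).
rewrite (_ : _ + _ = (A * B - D ^+ 2) / B); last by field.
by rewrite pmulr_lge0 ?invr_gt0// subr_ge0.
Qed.

(** Reverse triangle inequality for a weighted l2 norm. Both tensorizations of the log-Sobolev
    inequality rest on it: replacing a function by its root mean square does not increase
    differences. *)
Lemma minkowski_sqr (I : Type) (s : seq I) (f g : I -> R) (c : R) : 0 <= c ->
  (Num.sqrt ((\sum_(k <- s) f k ^+ 2) * c) -
   Num.sqrt ((\sum_(k <- s) g k ^+ 2) * c)) ^+ 2 <=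
  (\sum_(k <- s) (f k - g k) ^+ 2) * c.
Proof.
move=> c0.
have f0 : 0 <= \sum_(k <- s) f k ^+ 2 by apply: sumr_ge0 => k _; exact: sqr_ge0.
have g0 : 0 <= \sum_(k <- s) g k ^+ 2 by apply: sumr_ge0 => k _; exact: sqr_ge0.
rewrite !sqrtrM// -mulrBl exprMn sqr_sqrtr// ler_wpM2r//.
have := le_sqrt_sum_mul s f g.
rewrite (_ : \sum_(k <- s) (f k - g k) ^+ 2 = \sum_(k <- s) f k ^+ 2 +
  \sum_(k <- s) g k ^+ 2 - 2 * \sum_(k <- s) f k * g k); last first.
  rewrite mulr_sumr -big_split/= -sumrB; apply: eq_bigr => k _; ring.
rewrite sqrrB !sqr_sqrtr//.
set u := Num.sqrt _; set v := Num.sqrt _; lra.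
Qed.

Lemma ln_le_sub1 a : 0 < a -> ln a <= a - 1.
Proof.
by move=> a0; rewrite -{1}(subrK 1 a) addrC le_ln1Dx// ltrBrDr addNr.
Qed.

Definition xlnx a : R := a * ln a.

(** From [ln (c / |a|) <= c / |a| - 1], with equality at [|a| = c]. It bounds an entropy from below
    by means of [a ^+ 2] and [|a|] only, that is, by the L2 and L1 norms. *)
Lemma xlnx_sqr_ge (a c : R) : 0 < c ->
  a ^+ 2 * ln (c ^+ 2) + 2 * a ^+ 2 - 2 * c * `|a| <= xlnx (a ^+ 2).
Proof.
move=> c0; have [->|a0] := eqVneq a 0.
  by rewrite /xlnx expr0n normr0 !(mul0r, mulr0) !addr0 oppr0.
have na0 : 0 < `|a| by rewrite normr_gt0.
rewrite /xlnx -(real_normK (num_real a)) !lnXn//.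
have : ln (c / `|a|) <= c / `|a| - 1 by apply: ln_le_sub1; rewrite divr_gt0.
rewrite ln_div// => H.
have : `|a| ^+ 2 * (ln c - ln `|a|) <= `|a| ^+ 2 * (c / `|a| - 1).
  by rewrite ler_wpM2l ?sqr_ge0.
rewrite (_ : `|a| ^+ 2 * (c / `|a| - 1) = c * `|a| - `|a| ^+ 2); last first.
  by field; rewrite gt_eqF.
rewrite mulrBr.
rewrite (mulrnAr _ (ln c)) (mulrnAr _ (ln `|a|)).
set u := _ * ln c; set v := _ * ln `|a|.
rewrite -(mulr_natl u) -(mulr_natl v) -(mulrA 2).
by set t := c * _; set a2 := `|a| ^+ 2; lra.
Qed.

End entropy_inequalities.

(** * Averages and conditional expectations on a finite uniform product space *)

Section finite_product.
Context {R : realType} {T : finType} {n : nat}.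
Notation X := {ffun 'I_n -> T}.
Implicit Types (F G : X -> R) (x : X) (i j : 'I_n) (y z : T).

Definition upd x i y : X := [ffun j => if j == i then y else x j].

Lemma updE x i y : upd x i y i = y.
Proof. by rewrite ffunE eqxx. Qed.

Lemma upd_neq x i y j : j != i -> upd x i y j = x j.
Proof. by rewrite ffunE => /negbTE ->. Qed.

Lemma upd_upd x i y z : upd (upd x i y) i z = upd x i z.
Proof. by apply/ffunP => j; rewrite !ffunE; case: eqP. Qed.

Lemma upd_id x i : upd x i (x i) = x.
Proof. by apply/ffunP => j; rewrite !ffunE; case: eqP => // ->. Qed.

Lemma updC x i j y z : i != j -> upd (upd x i y) j z = upd (upd x j z) i y.
Proof.
move=> ij; apply/ffunP => k; rewrite !ffunE; case: (eqVneq k j) => // ->.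
by rewrite eq_sym (negbTE ij).
Qed.

Definition mean F : R := (\sum_x F x) / #|{: X}|%:R.
Definition avg i F x : R := (\sum_y F (upd x i y)) / #|T|%:R.

Lemma meanD F G : mean (fun x => F x + G x) = mean F + mean G.
Proof. by rewrite /mean big_split/= mulrDl. Qed.

Lemma meanZ c F : mean (fun x => c * F x) = c * mean F.
Proof. by rewrite /mean -mulr_sumr mulrA. Qed.

Lemma meanB F G : mean (fun x => F x - G x) = mean F - mean G.
Proof. by rewrite /mean sumrB mulrBl. Qed.

Lemma le_mean F G : (forall x, F x <= G x) -> mean F <= mean G.
Proof. by move=> FG; rewrite ler_wpM2r ?invr_ge0// ler_sum. Qed.

Lemma mean_ge0 F : (forall x, 0 <= F x) -> 0 <= mean F.
Proof. by move=> F0; rewrite mulr_ge0 ?invr_ge0// sumr_ge0. Qed.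

Lemma mean_sum (I : Type) (s : seq I) (H : I -> X -> R) :
  mean (fun x => \sum_(k <- s) H k x) = \sum_(k <- s) mean (H k).
Proof. by rewrite /mean exchange_big/= mulr_suml. Qed.

Lemma avgB i F G x : avg i (fun x => F x - G x) x = avg i F x - avg i G x.
Proof. by rewrite /avg sumrB mulrBl. Qed.

Lemma avg_ge0 i F x : (forall x, 0 <= F x) -> 0 <= avg i F x.
Proof. by move=> F0; rewrite mulr_ge0 ?invr_ge0// sumr_ge0. Qed.

Lemma avg_upd i F x y : avg i F (upd x i y) = avg i F x.
Proof. by congr (_ / _); apply: eq_bigr => z _; rewrite upd_upd. Qed.

Lemma avg_upd_neq i j F x y : i != j ->
  avg i F (upd x j y) = avg i (fun x => F (upd x j y)) x.
Proof.
move=> ij; congr (_ / _); apply: eq_bigr => z _.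
by rewrite (updC _ _ _ ij).
Qed.

Lemma avgC i j F x : avg i (avg j F) x = avg j (avg i F) x.
Proof.
have [->//|ij] := eqVneq i j.
rewrite /avg -!mulr_suml exchange_big/=; congr (_ / _ / _).
by apply: eq_bigr => y _; apply: eq_bigr => z _; rewrite (updC _ _ _ ij).
Qed.

Lemma normr_avg i F x : `|avg i F x| <= avg i (fun x => `|F x|) x.
Proof.
by rewrite normrM normfV normr_nat ler_wpM2r ?invr_ge0// ler_norm_sum.
Qed.

Lemma sum_upd i F : \sum_x \sum_y F (upd x i y) = \sum_x F x *+ #|T|.
Proof.
rewrite pair_big/= (reindex (fun p : X * T => (upd p.1 i p.2, p.1 i)))/=; last first.
  by exists (fun p : X * T => (upd p.1 i p.2, p.1 i)) => -[x y] _/=;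
    rewrite upd_upd updE upd_id.
under eq_bigr => p _ do rewrite upd_upd upd_id.
rewrite -(pair_big xpredT xpredT (fun x _ => F x))/=.
by apply: eq_bigr => x _; rewrite sumr_const cardT.
Qed.

Hypothesis T_gt0 : (0 < #|T|)%N.

Let T_neq0 : #|T|%:R != 0 :> R. Proof. by rewrite pnatr_eq0 -lt0n. Qed.

Lemma card_ffun_gt0 : (0 < #|{: X}|)%N.
Proof. by rewrite card_ffun expn_gt0 T_gt0. Qed.

Lemma mean_cst c : mean (fun=> c) = c.
Proof.
rewrite /mean sumr_const cardT -cardE -[c *+ _]mulr_natr mulfK//.
by rewrite pnatr_eq0 -lt0n card_ffun_gt0.
Qed.

Lemma avg_inv i F x : (forall y, F (upd x i y) = F x) -> avg i F x = F x.
Proof.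
move=> Fi; rewrite /avg; under eq_bigr do rewrite Fi.
by rewrite sumr_const cardT -cardE -[_ *+ _]mulr_natr mulfK.
Qed.

Lemma mean_avg i F : mean (avg i F) = mean F.
Proof.
rewrite /mean /avg -mulr_suml sum_upd sumrMnl -[_ *+ _]mulr_natr.
by rewrite mulfK.
Qed.

Lemma mean_avgM i F G : (forall x y, G (upd x i y) = G x) ->
  mean (fun x => F x * G x) = mean (fun x => avg i F x * G x).
Proof.
move=> Gi; rewrite -(mean_avg i); congr mean; apply/funext => x.
rewrite /avg [RHS]mulrAC [in RHS]mulr_suml; congr (_ / _); apply: eq_bigr => y _.
by rewrite Gi.
Qed.

(** Pythagoras for the orthogonal projection [avg i]. *)
Lemma mean_avg_sqr i F : mean (fun x => (F x - avg i F x) ^+ 2) =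
  mean (fun x => F x ^+ 2) - mean (fun x => avg i F x ^+ 2).
Proof.
transitivity (mean (fun x => F x ^+ 2 - (2 * (F x * avg i F x) - avg i F x ^+ 2))).
  by congr mean; apply/funext => x; ring.
rewrite !meanB meanZ (@mean_avgM i); last by move=> x y; exact: avg_upd.
by rewrite (_ : (fun x => avg i F x * avg i F x) = (fun x => avg i F x ^+ 2))//; ring.
Qed.

Lemma mean_normr_avg i F : mean (fun x => `|avg i F x|) <= mean (fun x => `|F x|).
Proof.
rewrite -(mean_avg i (fun x => `|F x|)); apply: le_mean => x.
exact: normr_avg.
Qed.

(** Conditional expectation given the coordinates outside [s]; the partial averages along [s] form
    the martingale. *)
Definition avgs (s : seq 'I_n) F : X -> R := foldl (fun G i => avg i G) F s.

Lemma avg_avgs j s F x : avg j (avgs s F) x = avgs s (avg j F) x.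
Proof.
elim: s F => //= i s IHs F; rewrite IHs; congr (avgs s _ x).
by apply/funext => z; rewrite avgC.
Qed.

Lemma avgs_upd s F x j y : j \in s -> avgs s F (upd x j y) = avgs s F x.
Proof.
elim: s F => //= i s IHs F; rewrite inE => /predU1P[->|/IHs//].
by rewrite -2!avg_avgs avg_upd.
Qed.

Lemma mean_avgs s F : mean (avgs s F) = mean F.
Proof. by elim: s F => //= i s IHs F; rewrite IHs mean_avg. Qed.

(** [x] is changed into [x'] one coordinate at a time: those in [J] already agree, and the others
    can be altered without affecting [G]. The induction is on a list of the coordinates that may
    still differ. *)
Lemma eq_coord (G : X -> R) (J : {set 'I_n}) x x' :
  (forall j, j \notin J -> forall x y, G (upd x j y) = G x) ->
  (forall j, j \in J -> x j = x' j) -> G x = G x'.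
Proof.
move=> GJ xx'.
suff H (s : seq 'I_n) : (forall j, j \notin s -> x j = x' j) -> G x = G x'.
  by apply: (H (enum 'I_n)) => j; rewrite mem_enum.
elim: s x xx' => [|i s IHs] x xx' xs.
  by congr G; apply/ffunP => j; exact: xs.
have [iJ|iJ] := boolP (i \in J).
  by apply: IHs => // j js; have [->|ji] := eqVneq j i;
    [exact: xx'|apply: xs; rewrite inE negb_or ji].
rewrite -(GJ _ iJ x (x' i)); apply: IHs => j; rewrite ffunE; case: eqP => [->//|/eqP ji].
  exact: xx'.
by move=> js; apply: xs; rewrite inE negb_or ji.
Qed.

Lemma avgs_full s F x : (forall i, i \in s) -> avgs s F x = mean F.
Proof.
move=> sT; rewrite -(mean_avgs s) -[LHS]mean_cst; congr mean; apply/funext => x'.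
apply: (@eq_coord _ finset.set0) => [j _ z y|j]; last by rewrite finset.in_set0.
by rewrite avgs_upd.
Qed.

(** * Dirichlet form, entropy and the variance bound *)

Section energy.
Context (P : seq (T * T)) (kappa : R) (kappa0 : 0 <= kappa).

(** Dirichlet form, in direction [i], of the graph on [T] with edges [P]. Edges and normalization
    stay abstract; the later entropy bounds know them only through the one-coordinate log-Sobolev
    hypothesis. *)
Definition energy i F : R := kappa *
  mean (fun x => \sum_(p <- P) (F (upd x i p.1) - F (upd x i p.2)) ^+ 2).

Lemma energyE i F : energy i F = kappa * \sum_(p <- P)
  mean (fun x => (F (upd x i p.1) - F (upd x i p.2)) ^+ 2).
Proof. by rewrite /energy mean_sum. Qed.

Lemma energy_ge0 i F : 0 <= energy i F.
Proof.
apply: mulr_ge0 => //; apply: mean_ge0 => x; apply: sumr_ge0 => p _.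
exact: sqr_ge0.
Qed.

Lemma energy_inv i F : (forall x y, F (upd x i y) = F x) -> energy i F = 0.
Proof.
move=> Fi; rewrite energyE big1 ?mulr0// => p _.
rewrite -[RHS]mean_cst; congr mean; apply/funext => x.
by rewrite !Fi subrr expr0n.
Qed.

Lemma energy_sub_avg_eq i F : energy i (fun x => F x - avg i F x) = energy i F.
Proof.
congr (_ * mean _); apply/funext => x; apply: eq_bigr => p _.
by rewrite !avg_upd; congr (_ ^+ 2); ring.
Qed.

(** Averaging along [i] commutes with taking differences along [j], so Pythagoras applies to the
    difference across each edge. *)
Lemma energy_sub_avg i j F : i != j ->
  energy j (fun x => F x - avg i F x) = energy j F - energy j (avg i F).
Proof.
move=> ij; rewrite !energyE -mulrBr -sumrB; congr (_ * _).
apply: eq_bigr => p _.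
rewrite [in X in _ = _ - X](_ : (fun x => _) =
   fun x => avg i (fun x => F (upd x j p.1) - F (upd x j p.2)) x ^+ 2); last first.
  by apply/funext => x; rewrite avgB !(avg_upd_neq _ _ _ ij).
rewrite -(mean_avg_sqr i (fun x => F (upd x j p.1) - F (upd x j p.2))).
congr mean; apply/funext => x.
by rewrite avgB !(avg_upd_neq _ _ _ ij); congr (_ ^+ 2); ring.
Qed.

Lemma energy_avg_le i j F : energy j (avg i F) <= energy j F.
Proof.
have [->|ij] := eqVneq i j.
  by rewrite energy_inv ?energy_ge0// => x y; exact: avg_upd.
by rewrite -subr_ge0 -energy_sub_avg// energy_ge0.
Qed.

Lemma energy_sub_avg_all i j F :
  energy j (fun x => F x - avg i F x) = energy j F - energy j (avg i F).
Proof.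
have [->|ij] := eqVneq i j; last exact: energy_sub_avg.
by rewrite energy_sub_avg_eq (energy_inv (avg_upd _ _)) subr0.
Qed.

(** Along [j != i] this is the reverse triangle inequality for functions of coordinate [i], averaged
    over the other coordinates. *)
Lemma energy_root_mean_square i j F :
  energy j (fun x => Num.sqrt (avg i (fun x => F x ^+ 2) x)) <= energy j F.
Proof.
have [->|ij] := eqVneq i j.
  by rewrite energy_inv ?energy_ge0// => x y; rewrite avg_upd.
rewrite !energyE ler_wpM2l// ler_sum// => p _.
rewrite -[leRHS](mean_avg i); apply: le_mean => x.
rewrite !(avg_upd_neq _ _ _ ij); apply: minkowski_sqr.
by rewrite invr_ge0.
Qed.

Hypothesis log_sobolev : forall g : T -> R,
  (\sum_y xlnx (g y ^+ 2)) / #|T|%:R - xlnx ((\sum_y g y ^+ 2) / #|T|%:R) <=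
  kappa * \sum_(p <- P) (g p.1 - g p.2) ^+ 2.

(** Chain rule of entropy: the entropy along the first coordinate [i] is bounded by the hypothesis,
    the rest is the entropy of [v ^+ 2], where [v] is the root mean square of [F] along [i].
    Induction applies to [v], whose energies do not exceed those of [F]. *)
Lemma log_sobolev_avgs (s : seq 'I_n) F :
  mean (fun x => xlnx (F x ^+ 2)) -
  mean (fun x => xlnx (avgs s (fun x => F x ^+ 2) x)) <=
  \sum_(j <- s) energy j F.
Proof.
elim: s F => [|i s IHs] F; first by rewrite big_nil/= subrr.
rewrite big_cons/=; set v := fun x => Num.sqrt (avg i (fun x => F x ^+ 2) x).
have v2 : (fun x => v x ^+ 2) = avg i (fun x => F x ^+ 2).
  apply/funext => x; rewrite /v sqr_sqrtr//.
  by apply: avg_ge0 => z; exact: sqr_ge0.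
have := IHs v; rewrite v2 => IHv.
have {}IHv := le_trans IHv (ler_sum _ (fun j _ => energy_root_mean_square i j F)).
have : mean (fun x => xlnx (F x ^+ 2)) - mean (fun x => xlnx (v x ^+ 2)) <= energy i F.
  rewrite -(mean_avg i (fun x => xlnx (F x ^+ 2))) -meanB /energy -meanZ.
  by apply: le_mean => x; rewrite [v x ^+ 2](congr1 (@^~ x) v2); exact: log_sobolev.
by lra.
Qed.

(** Functions with small L1 norm compared with their L2 norm have large entropy, hence large energy.
    Here [xlnx_sqr_ge] bounds the entropy from below and log-Sobolev bounds it from above. *)
Lemma variance_log_le F (w lam : R) : 0 < lam -> mean (fun x => `|F x|) <= w ->
  mean (fun x => F x ^+ 2) * - ln lam <= \sum_j energy j F + w ^+ 2 / lam.
Proof.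
move=> lam0 Fw; set V := mean _.
have w0 : 0 <= w by apply: le_trans Fw; exact: mean_ge0.
have E0 : 0 <= \sum_j energy j F by apply: sumr_ge0 => j _; exact: energy_ge0.
have V0 : 0 <= V by apply: mean_ge0 => x; exact: sqr_ge0.
have [->|V_neq0] := eqVneq V 0.
  by rewrite mul0r addr_ge0// divr_ge0 ?sqr_ge0// ltW.
have Vp : 0 < V by rewrite lt_def V_neq0.
(* With [c ^+ 2 = V / lam] the term [V * ln V] cancels against the entropy of the mean and
   [V * - ln lam] remains. *)
pose c := Num.sqrt (V / lam).
have c0 : 0 < c by rewrite sqrtr_gt0 divr_gt0.
have c2 : c ^+ 2 = V / lam by rewrite sqr_sqrtr// divr_ge0// ltW.
have := log_sobolev_avgs (enum 'I_n) F.
rewrite (_ : (fun x => xlnx (avgs _ _ x)) = fun=> xlnx V); last first.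
  by apply/funext => x; rewrite avgs_full// => i; rewrite mem_enum.
rewrite mean_cst big_enum/= => LS.
have : mean (fun x => F x ^+ 2 * ln (c ^+ 2) + 2 * F x ^+ 2 - 2 * c * `|F x|) <=
       mean (fun x => xlnx (F x ^+ 2)).
  by apply: le_mean => x; exact: xlnx_sqr_ge.
rewrite meanB meanD meanZ (meanZ (2 * c)) -/V.
rewrite (_ : (fun x => F x ^+ 2 * _) = fun x => ln (c ^+ 2) * F x ^+ 2); last first.
  by apply/funext => x; rewrite mulrC.
rewrite meanZ -/V c2 ln_div// => H.
have cw : 2 * c * mean (fun x => `|F x|) <= V + w ^+ 2 / lam.
  apply: (@le_trans _ _ (2 * c * w)); first by rewrite ler_wpM2l// mulr_ge0// ltW.
  rewrite -subr_ge0 (_ : _ - _ = lam * (c - w / lam) ^+ 2).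
    by rewrite mulr_ge0 ?sqr_ge0// ltW.
  have -> : V = c ^+ 2 * lam by rewrite c2 divfK// gt_eqF.
  by field; rewrite gt_eqF.
rewrite /xlnx in LS *; lra.
Qed.

(* The Falik-Samorodnitsky argument: [variance_log_le] is applied to each
   martingale difference of [F] along [s]. As the coordinates with the largest
   [- ln lam] are averaged first, the energy along [j] of the difference along
   [i] only matters when [- ln (lam j) <= - ln (lam i)]. *)
Lemma variance_le_weighted_energy (lam w : 'I_n -> R) (s : seq 'I_n) F :
  (forall i, 0 < lam i < 1) ->
  pairwise (fun i j => lam i <= lam j) s ->
  (forall j, j \notin s -> energy j F = 0 \/ forall i, i \in s -> lam i <= lam j) ->
  (forall i, i \in s -> mean (fun x => `|F x - avg i F x|) <= w i) ->
  mean (fun x => (F x - avgs s F x) ^+ 2) <=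
  \sum_j energy j F / - ln (lam j) + \sum_(i <- s) w i ^+ 2 / (lam i * - ln (lam i)).
Proof.
move=> lam01.
have ell0 i : 0 < - ln (lam i) by rewrite oppr_gt0 ln_lt0.
elim: s F => [|i s IHs] F /=.
  move=> _ _ _; rewrite big_nil addr0 [leLHS](_ : _ = 0).
    by apply: sumr_ge0 => j _; rewrite divr_ge0 ?energy_ge0// ltW.
  by rewrite -[RHS]mean_cst; congr mean; apply/funext => x; rewrite subrr expr0n.
move=> /andP[/allP si ps] Fs Fw.
pose d x := F x - avg i F x.
have Ed j : energy j d = energy j F - energy j (avg i F) by exact: energy_sub_avg_all.
have {}IHs := IHs (avg i F) ps.
(* The first martingale difference is orthogonal to the rest: Pythagoras for [avg i], applied to
   [F - avgs s (avg i F)], which [avg i] maps to [avg i F - avgs s (avg i F)]. *)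
have -> : mean (fun x => (F x - avgs s (avg i F) x) ^+ 2) =
    mean (fun x => d x ^+ 2) +
    mean (fun x => (avg i F x - avgs s (avg i F) x) ^+ 2).
  have := mean_avg_sqr i (fun x => F x - avgs s (avg i F) x).
  have Hi x : avg i (fun x => F x - avgs s (avg i F) x) x =
              avg i F x - avgs s (avg i F) x.
    by rewrite avgB avg_avgs; congr (_ - avgs s _ x);
      apply/funext => z; rewrite avg_inv// => y; exact: avg_upd.
  under [in X in _ = _ - X -> _]eq_fun do rewrite Hi.
  under [in X in X = _ -> _]eq_fun do rewrite Hi opprB addrA subrK.
  by move=> ->; rewrite subrK.
have lnlam j : lam i <= lam j -> - ln (lam j) <= - ln (lam i).
  by have /andP[? _] := lam01 i; have /andP[? _] := lam01 j; rewrite lerN2 ler_ln.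
have d2 : mean (fun x => d x ^+ 2) <=
    \sum_j energy j d / - ln (lam j) + w i ^+ 2 / (lam i * - ln (lam i)).
  have /andP[lami0 _] := lam01 i.
  have := variance_log_le lami0 (Fw i (mem_head _ _)).
  rewrite -/d -ler_pdivlMr// => /le_trans; apply.
  rewrite mulrDl -mulrA -invfM lerD2r mulr_suml ler_sum// => j _.
  have H : lam i <= lam j -> energy j d / - ln (lam i) <= energy j d / - ln (lam j).
    by move=> /lnlam ?; rewrite ler_wpM2l ?energy_ge0// lef_pV2 ?posrE.
  have [->|ji] := eqVneq j i; first by [].
  have [js|js] := boolP (j \in s); first exact/H/si.
  (* A coordinate outside the list has either been averaged already, so that no energy is left along
     it, or is never averaged and has the larger [lam]. *)
  have [|Ej|Ej] := Fs j; first by rewrite inE negb_or ji.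
    have -> : energy j d = 0 by apply/eqP; rewrite eq_le energy_ge0 andbT Ed Ej
      sub0r oppr_le0 energy_ge0.
    by rewrite !mul0r.
  exact/H/Ej/mem_head.
rewrite big_cons.
have {}IHs : mean (fun x => (avg i F x - avgs s (avg i F) x) ^+ 2) <=
    \sum_j energy j (avg i F) / - ln (lam j) +
    \sum_(k <- s) w k ^+ 2 / (lam k * - ln (lam k)).
  apply: IHs => [j js|k ks].
    have [->|ji] := eqVneq j i; first by left; apply: energy_inv => x y; exact: avg_upd.
    have [|Ej|Ej] := Fs j; first by rewrite inE negb_or ji.
      left; apply/eqP; rewrite eq_le energy_ge0 andbT -Ej; exact: energy_avg_le.
    by right => k ks; apply: Ej; rewrite inE ks orbT.
  apply: le_trans (Fw k _); last by rewrite inE ks orbT.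
  have := mean_normr_avg i (fun x => F x - avg k F x).
  by under [in X in X <= _ -> _]eq_fun do rewrite avgB avgC.
have -> : \sum_j energy j F / - ln (lam j) = \sum_j energy j d / - ln (lam j) +
    \sum_j energy j (avg i F) / - ln (lam j).
  by rewrite -big_split/=; apply: eq_bigr => j _; rewrite Ed mulrBl subrK.
by lra.
Qed.

End energy.
End finite_product.

(** * Two-point compressions of subsets of a grid *)

Section compression.
Context {N n : nat}.
Notation T := 'I_N.
Notation X := {ffun 'I_n -> T}.
Implicit Types (G : X -> bool) (x z : X) (i j : 'I_n) (a b y : T).

Definition fiber_count j G x : nat := \sum_y G (upd x j y).

Definition coord_increasing G :=
  forall j x a b, (a <= b)%N -> G (upd x j a) -> G (upd x j b).

Definition swap_coord i a b x : X := upd x i (tperm a b (x i)).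

Lemma swap_coordK i a b : involutive (swap_coord i a b).
Proof. by move=> x; rewrite /swap_coord updE upd_upd tpermK upd_id. Qed.

Lemma swap_coord_upd i a b x y :
  swap_coord i a b (upd x i y) = upd x i (tperm a b y).
Proof. by rewrite /swap_coord updE upd_upd. Qed.

Lemma swap_coord_upd_neq i a b j x y : j != i ->
  swap_coord i a b (upd x j y) = upd (swap_coord i a b x) j y.
Proof. by move=> ji; rewrite /swap_coord upd_neq 1?eq_sym// updC. Qed.

(** Of two points exchanged by the swap, a lone member of [G] is moved to the one with label [b];
    used with [a < b], so that sets are pushed upwards. *)
Definition compress i a b G x : bool :=
  if x i == a then G x && G (swap_coord i a b x) else
  if x i == b then G x || G (swap_coord i a b x) else G x.

Section compress.
Context (i : 'I_n) (a b : T) (ab : (a < b)%N).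
Notation sw := (swap_coord i a b).

Let a_neq_b : (a == b) = false.
Proof. by apply/negbTE; rewrite neq_ltn ab. Qed.

Let b_neq_a : (b == a) = false.
Proof. by rewrite eq_sym. Qed.

Lemma compress_pair G x : x i = a ->
  (compress i a b G x = G x && G (sw x)) *
  (compress i a b G (sw x) = G x || G (sw x)).
Proof.
move=> xa; rewrite /compress xa eqxx; split => //.
by rewrite {1 2}/swap_coord !updE xa tpermL b_neq_a eqxx swap_coordK orbC.
Qed.

Lemma compress_id G x : x i != a -> x i != b ->
  (compress i a b G x = G x) * (sw x = x).
Proof.
move=> xa xb; rewrite /compress (negbTE xa) (negbTE xb); split => //.
by rewrite /swap_coord tpermD ?upd_id// eq_sym.
Qed.

Lemma swap_coordl x : x i = b -> sw x i = a.
Proof. by move=> xb; rewrite /swap_coord updE xb tpermR. Qed.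

(** For a swap-invariant property the case [x i = b] reduces to [x i = a]. *)
Lemma compress_ind (Q : X -> Prop) :
  (forall x, Q x -> Q (sw x)) -> (forall x, x i = a -> Q x) ->
  (forall x, x i != a -> x i != b -> Q x) -> forall x, Q x.
Proof.
move=> Qsw Qa Qab x; have [/Qa//|xa] := eqVneq (x i) a.
have [xb|xb] := eqVneq (x i) b; last exact: Qab.
by rewrite -(swap_coordK i a b x); apply/Qsw/Qa; exact: swap_coordl.
Qed.

Lemma compress_add G x : (compress i a b G x + compress i a b G (sw x) =
  G x + G (sw x))%N.
Proof.
elim/compress_ind: x => x.
- by rewrite swap_coordK addnC => ->; rewrite addnC.
- by move=> xa; rewrite !(compress_pair G xa); case: (G x); case: (G (sw x)).
- by move=> xa xb; rewrite !compress_id// !(compress_id _ _ _).2//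
    !compress_id.
Qed.

Lemma sum_swap_coord (V : nmodType) (F : X -> V) :
  \sum_x F (sw x) = \sum_x F x.
Proof. by rewrite [RHS](reindex_inj (inv_inj (swap_coordK i a b))). Qed.

(** The sum is doubled and one copy reindexed by the swap, which reduces the claim to [compress_add]
    on each pair. The same device is used for the other sums below. *)
Lemma sum_compress G : (\sum_x compress i a b G x = \sum_x G x)%N.
Proof.
apply/eqP; rewrite -(eqn_pmul2l (ltn0Sn 1)) !mul2n -!addnn.
rewrite -{2}(sum_swap_coord (compress i a b G : X -> nat)).
rewrite -{2}(sum_swap_coord (G : X -> nat)).
by rewrite -!big_split/=; apply/eqP/eq_bigr => x _; exact: compress_add.
Qed.

Lemma fiber_count_compress G x :
  fiber_count i (compress i a b G) x = fiber_count i G x.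
Proof.
rewrite /fiber_count; apply/eqP; rewrite -(eqn_pmul2l (ltn0Sn 1)) !mul2n -!addnn.
have r (F : T -> nat) : (\sum_y F (tperm a b y) = \sum_y F y)%N.
  by rewrite [RHS](reindex_inj (inv_inj (tpermK a b))).
rewrite -{2}(r (fun y => compress i a b G (upd x i y) : nat)).
rewrite -{2}(r (fun y => G (upd x i y) : nat)).
rewrite -!big_split/=; apply/eqP/eq_bigr => y _.
by rewrite -!swap_coord_upd; exact: compress_add.
Qed.

(** Concavity as a two-point majorization inequality, free of subtraction on [nat]. *)
Definition concave_seq {R : realType} (h : nat -> R) := forall k l u v : nat,
  (k <= l <= v)%N -> (k <= u <= v)%N -> (k + v = l + u)%N ->
  h k + h v <= h l + h u.

(** Let U and V be the fibers in direction [j != i] over two swapped points. Compression replaces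
    them by their intersection and their union: the sizes keep their sum and move apart, so a
    concave [h] does not gain. *)
Lemma sum_concave_compress {R : realType} (h : nat -> R) j G : concave_seq h ->
  \sum_x h (fiber_count j (compress i a b G) x) <= \sum_x h (fiber_count j G x).
Proof.
move=> hc; have [->|ji] := eqVneq j i.
  by rewrite le_eqVlt; apply/orP; left; apply/eqP/eq_bigr => x _;
    rewrite fiber_count_compress.
rewrite -(ler_pM2l (_ : 0 < 2)); last by rewrite ltr0n.
rewrite !mulr_natl !mulr2n.
rewrite -{1}(sum_swap_coord (fun x => h (fiber_count j (compress i a b G) x))).
rewrite -{1}(sum_swap_coord (fun x => h (fiber_count j G x))).
rewrite -!big_split/=; apply: ler_sum => x _.
elim/compress_ind: x => x.
- by rewrite swap_coordK addrC => h1; rewrite (le_trans h1)// addrC.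
- move=> xa; rewrite addrC [leRHS]addrC /fiber_count.
  under eq_bigr => y _ do rewrite (compress_pair G _).1 ?upd_neq 1?eq_sym//
    swap_coord_upd_neq//.
  under [in X in _ + h X <= _]eq_bigr => y _ do
    rewrite -swap_coord_upd_neq// (compress_pair G _).2 ?upd_neq 1?eq_sym//
    swap_coord_upd_neq//.
  apply: hc.
  + by apply/andP; split; apply: leq_sum => y _; do 2 case: (G _).
  + by apply/andP; split; apply: leq_sum => y _; do 2 case: (G _).
  + by rewrite -!big_split/=; apply: eq_bigr => y _; do 2 case: (G _).
- move=> xa xb; rewrite (compress_id G xa xb).2.
  suff -> : fiber_count j (compress i a b G) x = fiber_count j G x by [].
  apply: eq_bigr => y _; congr nat_of_bool.
  have := @compress_id G (upd x j y).
  by rewrite upd_neq; [move=> /(_ xa xb)[]|rewrite eq_sym].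
Qed.

(** Termination measure: a compression that moves a point raises the sum of its labels, and the
    total is bounded. *)
Definition potential G : nat := \sum_x G x * \sum_l x l.

Lemma potential_compress G x : x i = a -> G x -> ~~ G (sw x) ->
  (potential G < potential (compress i a b G))%N.
Proof.
move=> xa Gx Gsx; rewrite -(ltn_pmul2l (ltn0Sn 1)) !mul2n -!addnn /potential.
rewrite -{2}(sum_swap_coord (fun x => G x * \sum_l x l : nat)).
rewrite -{2}(sum_swap_coord (fun x => compress i a b G x * \sum_l x l : nat)).
rewrite -!big_split/= (bigD1 x)//= [ltnRHS](bigD1 x)//=.
have swx z : z i = a -> (\sum_l z l < \sum_l sw z l)%N.
  move=> za; rewrite (bigD1 i)//= [ltnRHS](bigD1 i)//=.
  rewrite /swap_coord updE za tpermL.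
  under [in ltnRHS]eq_bigr => l li do rewrite upd_neq//.
  by rewrite ltn_add2r.
have le_pair z : (G z * \sum_l z l + G (sw z) * \sum_l sw z l <=
    compress i a b G z * \sum_l z l + compress i a b G (sw z) * \sum_l sw z l)%N.
  elim/compress_ind: z => z.
  - by rewrite swap_coordK addnC => h1; rewrite [leqRHS]addnC.
  - move=> za; rewrite !(compress_pair G za).
    have := ltnW (swx z za).
    by case: (G z) => /=; case: (G (sw z)) => //=; rewrite !mul0n !mul1n ?addn0.
  - by move=> za zb; rewrite (compress_id G za zb).2 (compress_id G za zb).1.
rewrite -addSn leq_add//; last by apply: leq_sum => z _; exact: le_pair.
rewrite !(compress_pair G xa) Gx (negbTE Gsx)/= !mul1n !mul0n addn0.
exact: swx.
Qed.

End compress.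

Lemma potential_le G : (potential G <= \sum_(x : X) \sum_l x l)%N.
Proof. by apply: leq_sum => x _; case: (G x); rewrite ?mul1n ?mul0n. Qed.

(** Any failure of monotonicity in one coordinate gives a compression that strictly increases the
    potential, so the process ends at a monotone set. The bound holds for all [h] at once since one
    [G'] has to serve every truncation level. *)
Lemma exists_monotone_rearrangement G : exists G', [/\
  (\sum_x G' x = \sum_x G x)%N,
  forall (R : realType) (h : nat -> R) j, concave_seq h ->
    \sum_x h (fiber_count j G' x) <= \sum_x h (fiber_count j G x) &
  coord_increasing G'].
Proof.
have [k] := ubnP (\sum_(x : X) \sum_l x l - potential G)%N.
elim: k G => // k IHk G Gk.
have [Gmon|] := pselect (coord_increasing G); first by exists G; split.
move=> /existsNP[i /existsNP[x /existsNP[a /existsNP[b]]]].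
move=> /not_implyP[ab /not_implyP[Ga /negP Gb]].
have {}ab : (a < b)%N.
  by rewrite ltn_neqAle ab andbT; apply: contraNneq Gb => /val_inj <-.
have pot : (potential G < potential (compress i a b G))%N.
  apply: (@potential_compress _ _ _ ab _ (upd x i a)); rewrite ?updE//.
  by rewrite swap_coord_upd tpermL.
have [|G' [G'card G'h G'mon]] := IHk (compress i a b G).
  by have := potential_le (compress i a b G); have := Gk; lia.
exists G'; split => //; first by rewrite G'card sum_compress.
by move=> R h j hc; rewrite (le_trans (G'h _ _ _ hc))// sum_concave_compress.
Qed.

End compression.

(** * The bit-flip graph: thresholds and log-Sobolev *)

Section dyadic_pairs.

(* The pairs of m-bit numbers that differ in exactly one bit. *)
Fixpoint dyadic_pairs m : seq (nat * nat) :=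
  if m is m'.+1 then
    dyadic_pairs m' ++ [seq (p.1 + 2 ^ m', p.2 + 2 ^ m')%N | p <- dyadic_pairs m']
    ++ [seq (y, y + 2 ^ m')%N | y <- iota 0 (2 ^ m')]
  else [::].

Lemma dyadic_pairs_lt m p : p \in dyadic_pairs m -> (p.1 < 2 ^ m)%N && (p.2 < 2 ^ m)%N.
Proof.
elim: m p => [|m IHm] p //=; rewrite !mem_cat expnS.
have lt1 a b : (a < b -> a < 2 * b)%N by lia.
have lt2 a b : (a < b -> a + b < 2 * b)%N by lia.
move=> /or3P[/IHm|/mapP[q /IHm]|/mapP[y]].
- by move=> /andP[/lt1 -> /lt1 ->].
- by move=> + -> /= => /andP[/lt2 -> /lt2 ->].
- by rewrite mem_iota => /andP[_] /[!add0n] ym -> /=; rewrite lt1//= lt2.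
Qed.

Lemma sum_pow2S (V : nmodType) m (F : nat -> V) : \sum_(0 <= y < 2 ^ m.+1) F y =
  \sum_(0 <= y < 2 ^ m) F y + \sum_(0 <= y < 2 ^ m) F (y + 2 ^ m)%N.
Proof.
rewrite (big_cat_nat (n := 2 ^ m))//=; last by rewrite leq_exp2l.
congr (_ + _); rewrite -{1}[(2 ^ m)%N]add0n big_addn; congr (\sum_(_ <= _ < _) _).
by rewrite expnS mul2n -addnn addnK.
Qed.

Lemma big_dyadic_pairsS (V : Type) (x0 : V) (op : Monoid.com_law x0) m
    (F : nat * nat -> V) :
  \big[op/x0]_(p <- dyadic_pairs m.+1) F p =
  op (op (\big[op/x0]_(p <- dyadic_pairs m) F p)
    (\big[op/x0]_(p <- dyadic_pairs m) F (p.1 + 2 ^ m, p.2 + 2 ^ m)%N))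
  (\big[op/x0]_(0 <= y < 2 ^ m) F (y, y + 2 ^ m)%N).
Proof. by rewrite /= !big_cat/= !big_map Monoid.mulmA /index_iota subn0. Qed.

(** Induction on the top bit. Among the pairs that agree in it, only those in the half containing
    the threshold can straddle it; the pairs that differ in it straddle at most as often as the
    distance from [t] to the nearer end. *)
Lemma threshold_pairs m t : (t <= 2 ^ m)%N ->
  (\sum_(p <- dyadic_pairs m) ((p.1 < t) (+) (p.2 < t)) <=
   \sum_(0 <= k < m) minn (minn t (2 ^ m - t)) (2 ^ k))%N.
Proof.
elim: m t => [|m IHm] t tm; first by rewrite big_nil.
rewrite big_dyadic_pairsS big_nat_recr//=.
have split_le a b c d : (a <= b -> c <= d -> a + c <= b + d)%N by lia.
have [t_le|t_gt] := leqP t (2 ^ m).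
  apply: split_le.
    rewrite [X in (_ + X)%N]big1_seq ?addn0; last by move=> p _ /=; lia.
    apply: (leq_trans (IHm _ t_le)); apply: leq_sum => k _; rewrite expnS; lia.
  rewrite (_ : minn _ _ = t); last by rewrite expnS; lia.
  rewrite (big_cat_nat (n := t))//= [X in (_ + X)%N]big1_seq ?addn0.
    rewrite (@leq_trans (\sum_(0 <= y < t) 1))//; last first.
      by rewrite sum_nat_const_nat muln1 subn0.
    by apply: leq_sum => y _; case: (_ (+) _).
  by move=> y; rewrite mem_index_iota => /andP[_] /andP[]; lia.
apply: split_le.
  rewrite [X in (X + _)%N]big1_seq ?add0n; last first.
    by move=> p /andP[_] /dyadic_pairs_lt /=; lia.
  have := IHm (t - 2 ^ m)%N; rewrite expnS in tm *.
  move=> /(_ ltac:(lia)) IH.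
  rewrite (eq_bigr (fun p : nat * nat =>
     ((p.1 < t - 2 ^ m) (+) (p.2 < t - 2 ^ m))%N : nat)); last by move=> p _ /=; lia.
  apply: (leq_trans IH); apply: leq_sum => k _; lia.
have tm2 : (t - 2 ^ m <= 2 ^ m)%N by rewrite expnS in tm; lia.
rewrite (_ : minn _ _ = 2 ^ m.+1 - t)%N; last by rewrite expnS; rewrite expnS in tm; lia.
rewrite (big_cat_nat (n := (t - 2 ^ m)%N))//= [X in (X + _)%N]big1_seq ?add0n.
  rewrite (@leq_trans (\sum_(t - 2 ^ m <= y < 2 ^ m) 1))//; last first.
    by rewrite sum_nat_const_nat muln1 expnS; lia.
  by apply: leq_sum => y _; case: (_ (+) _).
by move=> y; rewrite mem_index_iota; lia.
Qed.

Context {R : realType}.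

(** Entropy is at most variance over mean, here [(u ^+ 2 - v ^+ 2) ^+ 2 / (4 * s)], and
    [(u + v) ^+ 2 <= 4 * s]. *)
Lemma two_point_log_sobolev (u v : R) : 0 <= u -> 0 <= v ->
  (xlnx (u ^+ 2) + xlnx (v ^+ 2)) / 2 - xlnx ((u ^+ 2 + v ^+ 2) / 2) <= (u - v) ^+ 2.
Proof.
move=> u0 v0; set s := (u ^+ 2 + v ^+ 2) / 2.
have s0 : 0 <= s by rewrite divr_ge0// addr_ge0// sqr_ge0.
have [s_eq0|s_neq0] := eqVneq s 0.
  have u20 : u ^+ 2 = 0 by have := sqr_ge0 u; have := sqr_ge0 v; rewrite /s in s_eq0; lra.
  have v20 : v ^+ 2 = 0 by have := sqr_ge0 u; have := sqr_ge0 v; rewrite /s in s_eq0; lra.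
  by rewrite u20 v20 s_eq0 /xlnx !mul0r addr0 mul0r subr0 sqr_ge0.
have sp : 0 < s by rewrite lt_def s_neq0.
have H (a : R) : 0 <= a -> xlnx a <= a * ln s + a * (a / s - 1).
  rewrite le_eqVlt => /predU1P[<-|a0]; first by rewrite /xlnx !mul0r addr0.
  rewrite /xlnx -mulrDr ler_pM2l// -lerBlDl -ln_div//.
  by apply: ln_le_sub1; rewrite divr_gt0.
have Hu := H _ (sqr_ge0 u); have Hv := H _ (sqr_ge0 v).
have Es : u ^+ 2 + v ^+ 2 = 2 * s by rewrite /s mulrC divfK.
apply: (@le_trans _ _ ((u ^+ 2 * (u ^+ 2 / s - 1) + v ^+ 2 * (v ^+ 2 / s - 1)) / 2)).
  rewrite {3}/xlnx; have := congr1 ( *%R^~ (ln s)) Es.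
  by rewrite /= mulrDl; lra.
rewrite (_ : _ / 2 = (u - v) ^+ 2 * ((u + v) ^+ 2 / (4 * s))); last first.
  apply/(mulIf s_neq0); rewrite /s; field.
  by have := s_neq0; rewrite /s mulf_eq0 negb_or => /andP[].
apply: ler_piMr; first exact: sqr_ge0.
rewrite ler_pdivrMr ?mul1r; last by rewrite mulr_gt0// ltr0n.
rewrite -subr_ge0 (_ : _ - _ = (u - v) ^+ 2) ?sqr_ge0//.
by rewrite /s; field.
Qed.

(** Tensorization over the top bit: the two-point inequality is applied to the root mean squares of
    [g] on the two halves, whose difference [minkowski_sqr] bounds. Each bit has [2 ^ m / 2] pairs,
    so the factor [2 / 2 ^ m] averages over the pairs of a bit. *)
Lemma dyadic_log_sobolev m (g : nat -> R) :
  (\sum_(0 <= y < 2 ^ m) xlnx (g y ^+ 2)) / (2 ^ m)%:R -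
    xlnx ((\sum_(0 <= y < 2 ^ m) g y ^+ 2) / (2 ^ m)%:R) <=
  2 / (2 ^ m)%:R * \sum_(p <- dyadic_pairs m) (g p.1 - g p.2) ^+ 2.
Proof.
elim: m g => [|m IHm] g.
  by rewrite expn0 !big_nat1 big_nil mulr0 !divr1 subrr.
rewrite !sum_pow2S big_dyadic_pairsS/= expnS natrM !invfM.
set c : R := (2 ^ m)%:R^-1.
have c0 : 0 <= c by rewrite invr_ge0.
have := IHm g; have := IHm (fun y => g (y + 2 ^ m)%N); rewrite -/c.
set A0 := \sum_(0 <= y < 2 ^ m) g y ^+ 2.
set A1 := \sum_(0 <= y < 2 ^ m) g _ ^+ 2.
set S1 := \sum_(0 <= y < 2 ^ m) xlnx _; set S0 := \sum_(0 <= y < 2 ^ m) xlnx _.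
set P1 := \sum_(p <- _) _; set P0 := \sum_(p <- _) _; set D := \sum_(0 <= _ < _) _.
move=> H1 H0.
have A00 : 0 <= A0 * c by rewrite mulr_ge0//; apply: sumr_ge0 => ? _; exact: sqr_ge0.
have A10 : 0 <= A1 * c by rewrite mulr_ge0//; apply: sumr_ge0 => ? _; exact: sqr_ge0.
have := two_point_log_sobolev (sqrtr_ge0 (A0 * c)) (sqrtr_ge0 (A1 * c)).
have := minkowski_sqr (index_iota 0 (2 ^ m)) g (fun y => g (y + 2 ^ m)%N) c0.
rewrite -/A0 -/A1 -/D !sqr_sqrtr// => /[swap] /le_trans /[apply] H2.
have -> : (A0 + A1) * (2^-1 * c) = (A0 * c + A1 * c) / 2 by ring.
have -> : (S0 + S1) * (2^-1 * c) = (S0 * c + S1 * c) / 2 by ring.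
have -> : 2 * (2^-1 * c) * (P0 + P1 + D) = (2 * c * P0 + 2 * c * P1) / 2 + D * c by field.
by lra.
Qed.

End dyadic_pairs.

(** * Truncated fiber measures *)

Section dyadic_trunc.
Context {R : realType}.
Implicit Types (p : R) (k : nat).

Definition dyadic_trunc k p : R := Num.min (Num.min p (1 - p)) (2 ^- k).

Lemma dyadic_trunc_le k p :
  [/\ dyadic_trunc k p <= p, dyadic_trunc k p <= 1 - p & dyadic_trunc k p <= 2 ^- k].
Proof.
by split; rewrite /dyadic_trunc !ge_min lexx ?orbT.
Qed.

Lemma dyadic_truncP k p : [\/ dyadic_trunc k p = p,
  dyadic_trunc k p = 1 - p | dyadic_trunc k p = 2 ^- k].
Proof.
rewrite /dyadic_trunc /Num.min; case: ifP => _; last by constructor 3.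
by case: ifP => _; [constructor 1|constructor 2].
Qed.

Lemma dyadic_trunc_ge0 k p : 0 <= p <= 1 -> 0 <= dyadic_trunc k p.
Proof.
move=> /andP[p0 p1]; have : 0 <= 2 ^- k :> R by rewrite invr_ge0 exprn_ge0.
by case: (dyadic_truncP k p) => -> //; rewrite subr_ge0.
Qed.

(** A minimum of affine functions: on the right each minimum equals one of its three terms, on the
    left it is below all three. *)
Lemma dyadic_trunc_concave k p q r s : p <= q <= s -> p <= r <= s -> p + s = q + r ->
  dyadic_trunc k p + dyadic_trunc k s <= dyadic_trunc k q + dyadic_trunc k r.
Proof.
move=> /andP[pq qs] /andP[pr rs] pqrs.
have [p1 p2 p3] := dyadic_trunc_le k p; have [s1 s2 s3] := dyadic_trunc_le k s.
by case: (dyadic_truncP k q) => ->; case: (dyadic_truncP k r) => ->; lra.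
Qed.

Lemma dyadic_trunc_lipschitz k p q : dyadic_trunc k p <= dyadic_trunc k q + `|p - q|.
Proof.
have [p1 p2 p3] := dyadic_trunc_le k p; have := normr_ge0 (p - q).
have := ler_norm (p - q); have := ler_norm (q - p); rewrite (distrC q).
by case: (dyadic_truncP k q) => ->; lra.
Qed.

Lemma dyadic_trunc1_ge p : 0 <= p <= 1 -> p * (1 - p) <= dyadic_trunc 1 p.
Proof.
move=> /andP[p0 p1]; case: (dyadic_truncP 1 p) => ->.
- by rewrite -subr_ge0 (_ : _ - _ = p ^+ 2) ?sqr_ge0//; ring.
- by rewrite -subr_ge0 (_ : _ - _ = (1 - p) ^+ 2) ?sqr_ge0//; ring.
- have := sqr_ge0 (p - 2^-1); rewrite expr1.
  by rewrite (_ : (p - _) ^+ 2 = 4^-1 - p * (1 - p)); [lra|field].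
Qed.

Lemma sum_inv_pow2_le (K M : nat) : \sum_(K.+1 <= k < M) (2 : R) ^- k <= 2 ^- K.
Proof.
have [KM|MK] := ltnP K M; last first.
  by rewrite big_geq ?invr_ge0 ?exprn_ge0//; exact: leqW.
suff -> : \sum_(K.+1 <= k < M) (2 : R) ^- k = 2 ^- K - 2 ^- M.-1.
  by rewrite gerBl invr_ge0 exprn_ge0.
elim: M KM => // M IHM; rewrite ltnS leq_eqVlt => /predU1P[->|KM].
  by rewrite big_geq//= subrr.
rewrite big_nat_recr//= IHM//; case: M KM {IHM} => // M _ /=.
have -> : 2 ^- M = 2 * 2 ^- M.+1 :> R by rewrite exprS invfM mulrA divff// mul1r.
ring.
Qed.

(** The caps beyond level [K] form a geometric series. This replaces the depth of the grid by a
    level adapted to the influence. *)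
Lemma sum_dyadic_trunc_le K M p : 0 <= p <= 1 ->
  \sum_(1 <= k < M) dyadic_trunc k p <=
  \sum_(1 <= k < K.+1) dyadic_trunc k p + 2 ^- K.
Proof.
move=> p01.
have [KM|MK] := ltnP K.+1 M.
  rewrite (big_cat_nat (n := K.+1))//=; last exact: ltnW.
  rewrite lerD2l (le_trans _ (sum_inv_pow2_le K M))//.
  by apply: ler_sum => k _; have [] := dyadic_trunc_le k p.
have [M1|M1] := leqP M 1.
  rewrite big_geq// addr_ge0 ?invr_ge0 ?exprn_ge0//.
  by apply: sumr_ge0 => k _; exact: dyadic_trunc_ge0.
rewrite [in leRHS](big_cat_nat (n := M))//=; last exact: ltnW.
rewrite -addrA lerDl addr_ge0 ?invr_ge0 ?exprn_ge0//.
by apply: sumr_ge0 => k _; exact: dyadic_trunc_ge0.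
Qed.

End dyadic_trunc.

(** * Both inequalities on the finite grid *)

Section dyadic_grid.
Context {R : realType} (m n : nat).
(** The successor form makes ['I_N] inhabited, as [inord] requires. *)
Notation N := (2 ^ m).-1.+1.
Notation X := {ffun 'I_n -> 'I_N}.
Implicit Types (G : X -> bool) (x : X) (i j : 'I_n).

Lemma dyadic_size : N = (2 ^ m)%N.
Proof. by rewrite prednK// expn_gt0. Qed.

Let N_gt0 : (0 < #|'I_N|)%N. Proof. by rewrite card_ord. Qed.
Let NR_gt0 : 0 < N%:R :> R. Proof. by rewrite ltr0n. Qed.

Definition grid_pairs : seq ('I_N * 'I_N) :=
  [seq (inord p.1, inord p.2) | p <- dyadic_pairs m].

Lemma grid_log_sobolev (g : 'I_N -> R) :
  (\sum_y xlnx (g y ^+ 2)) / #|'I_N|%:R - xlnx ((\sum_y g y ^+ 2) / #|'I_N|%:R) <=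
  2 / N%:R * \sum_(p <- grid_pairs) (g p.1 - g p.2) ^+ 2.
Proof.
have LS M (f : nat -> R) : M = (2 ^ m)%N ->
    (\sum_(0 <= y < M) xlnx (f y ^+ 2)) / M%:R -
    xlnx ((\sum_(0 <= y < M) f y ^+ 2) / M%:R) <=
    2 / M%:R * \sum_(p <- dyadic_pairs m) (f p.1 - f p.2) ^+ 2.
  by move=> ->; exact: dyadic_log_sobolev.
have := LS N (fun y => g (inord y)) dyadic_size; rewrite !big_mkord.
rewrite card_ord big_map /=.
by under eq_bigr do rewrite inord_val; under [in X in _ - xlnx (X / _) <= _ -> _]eq_bigr
  do rewrite inord_val.
Qed.

Definition charfun G x : R := (G x)%:R.

Lemma avg_charfunE G j x : avg j (charfun G) x = (fiber_count j G x)%:R / N%:R.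
Proof. by rewrite /avg card_ord /fiber_count natr_sum. Qed.

Lemma avg_charfun01 G j x : 0 <= avg j (charfun G) x <= 1.
Proof.
rewrite avg_charfunE divr_ge0//= ler_pdivrMr// mul1r ler_nat.
rewrite (@leq_trans (\sum_(y < N) 1))//; last by rewrite sum_nat_const card_ord muln1.
by apply: leq_sum => y _; case: (G _).
Qed.

Lemma concave_seq_dyadic_trunc k :
  concave_seq (fun c => dyadic_trunc k (c%:R / N%:R : R)).
Proof.
move=> a b c d /andP[ab bd] /andP[ac cd] abcd; apply: dyadic_trunc_concave.
- by rewrite !ler_pM2r ?invr_gt0// !ler_nat ab.
- by rewrite !ler_pM2r ?invr_gt0// !ler_nat ac.
- by rewrite -!mulrDl -!natrD abcd.
Qed.

Lemma up_closed_threshold (S : pred 'I_N) :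
  (forall a b : 'I_N, (a <= b)%N -> S a -> S b) ->
  exists2 t, (t <= N)%N & forall y, S y = (t <= y)%N.
Proof.
move=> Sup; have [[y0 Sy0]|nS] := pselect (exists y, S y); last first.
  exists N => // y; rewrite leqNgt ltn_ord; apply/negbTE/negP => Sy; apply: nS.
  by exists y.
case: (arg_minnP (fun y : 'I_N => y : nat) Sy0) => t St tmin.
exists t; first exact/ltnW/ltn_ord.
move=> y; apply/idP/idP => [|ty]; [exact: tmin|exact: Sup St].
Qed.

Notation grid_energy := (energy grid_pairs (2 / N%:R : R)).

Let natr_minn (a b : nat) : (minn a b)%:R = Num.min a%:R b%:R :> R.
Proof.
by case: leqP => ab; [rewrite min_l// ler_nat|rewrite min_r// ler_nat ltnW].
Qed.

(** An up-closed fiber is a threshold, so the squared difference across a pair is 1 exactly when the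
    pair straddles it, and [threshold_pairs] counts these. *)
Lemma energy_charfun G j : coord_increasing G ->
  grid_energy j (charfun G) <=
  2 * \sum_(1 <= k < m.+1) mean (fun x => dyadic_trunc k (avg j (charfun G) x)).
Proof.
move=> Gup; rewrite -mean_sum -meanZ /energy -meanZ.
apply: le_mean => x; rewrite -mulrA ler_pM2l//.
have [t tN Gt] := @up_closed_threshold (fun y => G (upd x j y)) (Gup j x).
have count_eq : fiber_count j G x = (N - t)%N.
  rewrite /fiber_count; under eq_bigr do rewrite Gt.
  rewrite -(big_mkord xpredT (fun y => (t <= y)%N : nat)) (big_cat_nat (n := t))//=.
  rewrite big1_seq ?add0n => [|y]; last by rewrite mem_index_iota; lia.
  under eq_big_nat => y /andP[-> _] do [].
  by rewrite sum_nat_const_nat muln1.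
have tp M : M = (2 ^ m)%N -> (t <= M)%N ->
    (\sum_(p <- dyadic_pairs m) ((p.1 < t) (+) (p.2 < t)) <=
     \sum_(0 <= k < m) minn (minn t (M - t)) (2 ^ k))%N.
  by move=> ->; exact: threshold_pairs.
have {}tp := tp N dyadic_size tN.
rewrite mulrC ler_pdivrMr//.
rewrite (_ : \sum_(p <- grid_pairs) _ =
  (\sum_(p <- dyadic_pairs m) ((p.1 < t) (+) (p.2 < t)))%N%:R).
  rewrite -(ler_nat R) in tp; apply: (le_trans tp).
  (* Divided by [N], the bit of weight [2 ^ k] has cap [2 ^- (m - k)]; hence the reversal of the
     sum. *)
  rewrite natr_sum mulr_suml [leRHS]big_nat_rev/= big_add1/=.
  rewrite le_eqVlt; apply/orP; left; apply/eqP/eq_big_nat => k km.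
  rewrite avg_charfunE count_eq /dyadic_trunc.
  rewrite !natr_minn.
  rewrite !minr_pMl ?invr_ge0//; congr Num.min.
    rewrite minC; congr Num.min; rewrite natrB//; have := NR_gt0.
      by set M : R := N%:R => M0; field; rewrite gt_eqF.
    by set M : R := N%:R => M0; field; rewrite gt_eqF.
  have /andP[_ {}km] := km.
  rewrite (_ : 1 + m.+1 - k.+2 = m - k)%N; last by lia.
  rewrite dyadic_size !natrX -{2}(subnK (ltnW km)) exprD mulKf//.
rewrite natr_sum big_map; apply: eq_big_seq => p /dyadic_pairs_lt /andP[p1 p2].
rewrite /charfun /= !Gt !inordK ?dyadic_size//.
by do 2 case: leqP => _ /=; rewrite ?subrr ?subr0 ?sub0r ?sqrrN ?expr1n ?expr0n.
Qed.

(** On a fiber of measure [p] the mean of the left side is [2 * (p * (1 - p))]. *)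
Lemma mean_normr_sub_avg_charfun G j :
  mean (fun x => `|charfun G x - avg j (charfun G) x|) <=
  2 * mean (fun x => dyadic_trunc 1 (avg j (charfun G) x)).
Proof.
set p := avg j (charfun G).
have p01 x : 0 <= p x <= 1 by exact: avg_charfun01.
apply: (@le_trans _ _ (mean (fun x => charfun G x * (1 - 2 * p x) + p x))).
  apply: le_mean => x; have /andP[p0 p1] := p01 x.
  rewrite /charfun; case: (G x); rewrite ?mulr1n ?mulr0n.
    by rewrite mul1r ger0_norm ?subr_ge0//; lra.
  by rewrite mul0r sub0r add0r normrN ger0_norm.
rewrite meanD (@mean_avgM _ _ _ _ j (charfun G)) -/p => [|//|x y]; last first.
  by rewrite /p avg_upd.
rewrite -meanD -meanZ; apply: le_mean => x.
have := dyadic_trunc1_ge (p01 x).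
by rewrite (_ : p x * (1 - 2 * p x) + p x = 2 * (p x * (1 - p x))); [lra|ring].
Qed.

Lemma mean_charfun_sqr G (s : seq 'I_n) : (forall i, i \in s) ->
  mean (fun x => (charfun G x - avgs s (charfun G) x) ^+ 2) =
  mean (charfun G) * (1 - mean (charfun G)).
Proof.
move=> sT; set t := mean (charfun G); rewrite [LHS](_ : _ =
  mean (fun x => (1 - 2 * t) * charfun G x + t ^+ 2)).
  by rewrite meanD meanZ mean_cst// -/t; ring.
congr mean; apply/funext => x; rewrite avgs_full// -/t /charfun.
by case: (G x) => /=; ring.
Qed.

(** [lam j = 2 ^- K j] is both the parameter of the coordinate and the bound on its L1 norm, so the
    second sum of the variance bound costs [lam j / (K j * ln 2)]. The energy is at most
    [2 * (S + lam j)]; with [2^-1 <= ln 2] the total [2 * S + 3 * lam j] doubles, whence 4 and 6. *)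
Theorem grid_talagrand G (K : 'I_n -> nat) : (forall j, (0 < K j)%N) ->
  (forall j, 2 * mean (fun x => dyadic_trunc 1 (avg j (charfun G) x)) <= 2 ^- K j) ->
  mean (charfun G) * (1 - mean (charfun G)) <=
  \sum_j (6 * 2 ^- K j + 4 * \sum_(1 <= k < (K j).+1)
    mean (fun x => dyadic_trunc k (avg j (charfun G) x))) / (K j)%:R.
Proof.
move=> K0 GK.
have [H [HG Hh Hup]] := exists_monotone_rearrangement G.
have mH : mean (charfun H) = mean (charfun G).
  by congr (_ / _); rewrite /charfun -!natr_sum HG.
have Hk k j : mean (fun x => dyadic_trunc k (avg j (charfun H) x)) <=
              mean (fun x => dyadic_trunc k (avg j (charfun G) x)).
  rewrite ler_wpM2r ?invr_ge0//.
  under eq_bigr do rewrite avg_charfunE; under [leRHS]eq_bigr do rewrite avg_charfunE.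
  exact/(Hh _ (fun c => dyadic_trunc k (c%:R / N%:R)))/concave_seq_dyadic_trunc.
pose lam j : R := 2 ^- K j.
pose r i j := lam i <= lam j.
pose s := sort r (enum 'I_n).
have sT i : i \in s by rewrite mem_sort mem_enum.
have lam0 j : 0 < lam j by rewrite invr_gt0 exprn_gt0.
have lam01 j : 0 < lam j < 1.
  by rewrite lam0 invf_lt1 ?exprn_gt0// exprn_egt1 ?ltr1n// -lt0n K0.
have kappa0 : 0 <= 2 / N%:R :> R by rewrite divr_ge0.
rewrite -mH -(mean_charfun_sqr H sT).
have := @variance_le_weighted_energy R _ n N_gt0 grid_pairs _ kappa0 grid_log_sobolev
  lam lam s (charfun H) lam01.
have sp : pairwise r s.
  rewrite -sorted_pairwise.
    by apply: sort_sorted => i j; exact: le_total.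
  by move=> j i k; exact: le_trans.
move=> /(_ sp)/(_ _ _)/le_trans; apply => [j|i _|].
- by rewrite sT.
- by rewrite (le_trans (mean_normr_sub_avg_charfun _ _))// (le_trans _ (GK i))// ler_pM2l.
rewrite [\sum_(i <- s) _](perm_big (enum 'I_n))/= ?perm_sort//.
rewrite big_enum/= -big_split/=.
apply: ler_sum => j _.
have lnlam : - ln (lam j) = (K j)%:R * ln 2.
  by rewrite lnV ?posrE ?exprn_gt0// opprK lnXn// mulr_natl.
have ln2 : 2^-1 <= ln 2 :> R.
  have : ln (2^-1 : R) <= 2^-1 - 1 by apply: ln_le_sub1; rewrite invr_gt0.
  by rewrite lnV ?posrE//; lra.
have ln20 : 0 < ln 2 :> R by rewrite (lt_le_trans _ ln2)// invr_gt0.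
have Kj0 : 0 < (K j)%:R :> R by rewrite ltr0n.
have -> : lam j ^+ 2 / (lam j * - ln (lam j)) = lam j / - ln (lam j).
  by rewrite expr2 -mulf_div divff ?mul1r// gt_eqF.
rewrite -mulrDl lnlam.
have Ej : grid_energy j (charfun H) <= 2 * (\sum_(1 <= k < (K j).+1)
    mean (fun x => dyadic_trunc k (avg j (charfun G) x)) + lam j).
  rewrite (le_trans (energy_charfun _ Hup))// ler_pM2l//.
  apply: (@le_trans _ _ (\sum_(1 <= k < (K j).+1)
     mean (fun x => dyadic_trunc k (avg j (charfun H) x)) + lam j)).
    rewrite -!mean_sum -[lam j](@mean_cst R 'I_N n)// -meanD.
    by apply: le_mean => x; apply: sum_dyadic_trunc_le; exact: avg_charfun01.
  by rewrite lerD2r; apply: ler_sum => k _; exact: Hk.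
set S := \sum_(1 <= k < _) _ in Ej *.
have S0 : 0 <= S.
  apply: sumr_ge0 => k _; apply: mean_ge0 => x; apply: dyadic_trunc_ge0.
  exact: avg_charfun01.
rewrite ler_pdivrMr ?mulr_gt0// mulrA divfK ?gt_eqF//.
apply: (@le_trans _ _ (3 * lam j + 2 * S)); first by lra.
have -> : 3 * lam j + 2 * S = (6 * lam j + 4 * S) * 2^-1 by field.
by rewrite ler_wpM2l// addr_ge0// mulr_ge0// ltW.
Qed.

(** [J] collects the coordinates with L1 norm above [tau], at most [2 * W / tau] by Markov.
    Averaging out the others leaves a variance of at most [(2 * W + 2 * W) / ell], one term from the
    energy and one from the L1 norms; [ell] makes this [eps / 4]. *)
Theorem grid_friedgut G (W eps : R) : (0 < m)%N -> coord_increasing G ->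
  0 < W -> 0 < eps ->
  \sum_j \sum_(1 <= k < m.+1)
    mean (fun x => dyadic_trunc k (avg j (charfun G) x)) <= W ->
  exists (J : {set 'I_n}) (H : X -> bool), [/\
    #|J|%:R <= 2 * W * expR (16 * W / eps),
    forall x x', (forall j, j \in J -> x j = x' j) -> H x = H x' &
    mean (fun x => (G x != H x)%:R) <= eps].
Proof.
move=> m0 Gup W0 eps0 GW.
pose w j := mean (fun x => `|charfun G x - avg j (charfun G) x|).
pose ell : R := 16 * W / eps.
have ell0 : 0 < ell by rewrite !mulr_gt0// invr_gt0.
pose tau := expR (- ell).
have tau0 : 0 < tau by exact: expR_gt0.
have lntau : - ln tau = ell by rewrite expRK opprK.
have tau01 : 0 < tau < 1 by rewrite tau0 expR_lt1 oppr_lt0.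
have trunc0 k j : 0 <= mean (fun x => dyadic_trunc k (avg j (charfun G) x)).
  by apply: mean_ge0 => x; apply: dyadic_trunc_ge0; exact: avg_charfun01.
have w0 j : 0 <= w j by exact: mean_ge0.
have wW : \sum_j w j <= 2 * W.
  rewrite -ler_pdivrMl// mulr_sumr (le_trans _ GW)//; apply: ler_sum => j _.
  rewrite ler_pdivrMl// (le_trans (mean_normr_sub_avg_charfun _ _))// ler_pM2l//.
  by rewrite big_nat_recl// lerDl; apply: sumr_ge0.
pose J := [set j | tau < w j]%SET.
pose s := [seq j <- enum 'I_n | j \notin J].
have sJ j : (j \in s) = (j \notin J) by rewrite mem_filter mem_enum andbT.
pose g := avgs s (charfun G).
exists J, (fun x => 2^-1 <= g x); split.
- have -> : expR (16 * W / eps) = tau^-1 by rewrite /tau expRN invrK.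
  rewrite ler_pdivlMr//.
  apply: le_trans wW; rewrite -sumr_const mulr_suml.
  rewrite [leRHS](bigID (mem J))/= -[leLHS]addr0 lerD ?sumr_ge0//.
  by apply: ler_sum => j; rewrite finset.inE mul1r => /ltW.
- move=> x x' xx'; suff -> : g x = g x' by [].
  apply: (@eq_coord _ _ _ g J) => // j jJ z y.
  by rewrite /g avgs_upd// sJ.
have kappa0 : 0 <= 2 / N%:R :> R by rewrite divr_ge0.
have Gg : mean (fun x => (charfun G x - g x) ^+ 2) <= eps / 4.
  have := @variance_le_weighted_energy R _ n N_gt0 grid_pairs _ kappa0 grid_log_sobolev
    (fun=> tau) w s (charfun G) (fun=> tau01).
  have sp : pairwise (fun _ _ : 'I_n => tau <= tau) s.
    by elim: (s) => //= i s' ->; rewrite andbT lexx; apply/allP.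
  move=> /(_ sp)/(_ _ _)/le_trans; apply => [j _|//|].
    by right.
  rewrite lntau -mulr_suml.
  have -> : \sum_(i <- s) w i ^+ 2 / (tau * ell) = (\sum_(i <- s) w i ^+ 2 / tau) / ell.
    by rewrite mulr_suml; apply: eq_bigr => i _; rewrite invfM mulrA.
  rewrite -mulrDl ler_pdivrMr//.
  have -> : eps / 4 * ell = 2 * W + 2 * W by rewrite /ell; field; rewrite gt_eqF.
  apply: lerD.
    rewrite -ler_pdivrMl// mulr_sumr (le_trans _ GW)//; apply: ler_sum => j _.
    by rewrite ler_pdivrMl//; exact: energy_charfun.
  apply: le_trans wW.
  apply: (@le_trans _ _ (\sum_(i <- s) w i)).
    rewrite !big_seq; apply: ler_sum => j; rewrite sJ finset.inE -leNgt => wt.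
    by rewrite ler_pdivrMr// expr2 ler_wpM2l.
  rewrite big_filter big_enum_cond/= [leRHS](bigID (mem J))/= lerDr.
  exact: sumr_ge0.
(* Rounding [g] at one half errs only where [charfun G] and [g] differ by at least one half. *)
apply: (@le_trans _ _ (4 * mean (fun x => (charfun G x - g x) ^+ 2))); last by lra.
rewrite -meanZ; apply: le_mean => x; rewrite /charfun.
case: (G x); case: (leP 2^-1 (g x)) => /= gx.
- by rewrite mulr_ge0// sqr_ge0.
- rewrite (_ : 4 * _ = (2 * (1 - g x)) ^+ 2); last by ring.
  by rewrite -[leLHS](expr1n _ 2) ler_sqr ?nnegrE; lra.
- rewrite (_ : 4 * _ = (2 * g x) ^+ 2); last by ring.
  by rewrite -[leLHS](expr1n _ 2) ler_sqr ?nnegrE; lra.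
- by rewrite mulr_ge0// sqr_ge0.
Qed.

End dyadic_grid.

(** * Minkowski content of the Gaussian line *)

Section gaussian_line.
Context {R : realType}.
Notation nu := (std_gaussian R).
Implicit Types (S : set (measurableTypeR R)) (b r x : R).

Definition phi x : R := normal_pdf 0 1 x.

Lemma phiE x : phi x = normal_peak 1 * expR (- (x ^+ 2 / 2)).
Proof.
rewrite /phi normal_pdfE ?oner_neq0// /normal_fun subr0 expr1n.
by rewrite mulNr.
Qed.

Lemma peak_gt0 : 0 < normal_peak (1 : R).
Proof. by rewrite normal_peak_gt0// oner_neq0. Qed.

(** This amounts to [2 < pi]; equality is excluded by [cos 1 > 0 = cos (pi / 2)]. It is what keeps
    [peak2] below 1. *)
Lemma peak_lt_half : normal_peak (1 : R) < 2^-1.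
Proof.
have pi2_gt0 : 0 < pi *+ 2 :> R by rewrite -mulr_natl mulr_gt0// pi_gt0.
rewrite /normal_peak expr1n mul1r ltf_pV2 ?posrE ?sqrtr_gt0//.
have -> : 2 = Num.sqrt (2 ^+ 2) :> R by rewrite sqrtr_sqr ger0_norm.
rewrite ltr_sqrt//.
suff : 2 < pi :> R by rewrite expr2 mulr2n; lra.
have := @pihalf_ge1 R; rewrite le_eqVlt => /predU1P[pi2|]; last by lra.
by have := @cos1_gt0 R; rewrite pi2 cos_pihalf ltxx.
Qed.

Lemma phi_gt0 x : 0 < phi x.
Proof. by rewrite phiE mulr_gt0 ?expR_gt0// peak_gt0. Qed.

Lemma phi_le_peak x : phi x <= normal_peak 1.
Proof. exact: normal_pdf_ub. Qed.

Lemma phi_even x : phi (- x) = phi x.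
Proof. by rewrite !phiE sqrrN. Qed.

Lemma phi_le b x : `|x| <= b -> phi b <= phi x.
Proof.
move=> xb; rewrite !phiE ler_pM2l ?peak_gt0// ler_expR lerN2 ler_pM2r//.
by rewrite -(real_normK (num_real x)) lerXn2r ?nnegrE// (le_trans _ xb).
Qed.

Lemma continuous_phi : continuous phi.
Proof. by apply: continuous_normal_pdf; rewrite oner_neq0. Qed.

Lemma measurable_phi S : measurable_fun S (EFin \o (phi : measurableTypeR R -> R)).
Proof. by apply/measurable_EFinP/measurable_funTS; exact: measurable_normal_pdf. Qed.

Lemma nuE S : (nu S = \int[lebesgue_measure]_(x in S) (phi x)%:E)%E.
Proof. by []. Qed.

Lemma nu_le_length r x : 0 <= r -> (nu `[x, (x + r)%R] <= (normal_peak 1 * r)%:E)%E.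
Proof.
move=> r0; rewrite nuE.
apply: (@le_trans _ _ (\int[lebesgue_measure]_(y in `[x, (x + r)%R]) (normal_peak 1)%:E)%E).
  apply: ge0_le_integral => //= [y _||y _].
  - by rewrite lee_fin ltW// phi_gt0.
  - exact: measurable_phi.
  - by rewrite lee_fin phi_le_peak.
rewrite integral_cst//= lebesgue_measure_itv/= lte_fin.
case: ifPn => _; last by rewrite mule0 lee_fin mulr_ge0// ltW// peak_gt0.
by rewrite -EFinB -EFinM lee_fin addrC addKr.
Qed.

Lemma nu_ge_length b r x : 0 <= r -> - b <= x -> x + r <= b ->
  ((r * phi b)%:E <= nu `]x, (x + r)%R[)%E.
Proof.
move=> r0 bx xb; rewrite nuE.
apply: (@le_trans _ _ (\int[lebesgue_measure]_(y in `]x, (x + r)%R[) (phi b)%:E)%E); last first.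
  apply: ge0_le_integral => //= [y _||y].
  - by rewrite lee_fin ltW// phi_gt0.
  - exact: measurable_phi.
  - rewrite in_itv/= => /andP[xy yx]; rewrite lee_fin phi_le// ler_norml.
    by rewrite (le_trans bx (ltW xy)) (le_trans (ltW yx)).
rewrite integral_cst//= lebesgue_measure_itv/= lte_fin.
have [->|rn0] := eqVneq r 0; first by rewrite mul0r addr0 ltxx mule0.
by rewrite ltrDl lt_def rn0 r0 -EFinB -EFinM lee_fin addrC addKr mulrC.
Qed.

Lemma integral_id_phi b : 0 < b ->
  (\int[lebesgue_measure]_(x in `[b, +oo[) (x * phi x)%:E = (phi b)%:E)%E.
Proof.
move=> b0.
have dphi (x : R) : is_derive x 1 (fun x => - phi x) (x * phi x).
  rewrite (_ : (fun x => - phi x) = fun x => - normal_peak 1 * expR (- (x ^+ 2 / 2))); last first.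
    by apply/funext => y; rewrite phiE mulNr.
  apply: is_derive_eq.
  rewrite phiE !scaler1 /GRing.scale/=.
  by field.
rewrite (@ge0_continuous_FTC2y _ _ (fun x => - phi x) _ 0).
- by rewrite sub0e EFinN oppeK.
- by move=> x bx; rewrite mulr_ge0 ?(ltW (phi_gt0 _))// (le_trans (ltW b0)).
- apply: continuous_subspaceT => x; apply: cvgM; [exact: cvg_id|exact: continuous_phi].
- rewrite -oppr0; apply: cvgN.
  apply: (@squeeze_cvgr _ _ _ _ (cst 0) (fun x => normal_peak 1 * expR (- x))).
  + near=> x; rewrite (ltW (phi_gt0 _))/= phiE ler_pM2l ?peak_gt0// ler_expR lerN2.
    rewrite ler_pdivlMr// expr2 ler_pM2l; first by near: x; exact: nbhs_pinfty_ge.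
    by near: x; exact: nbhs_pinfty_gt.
  + exact: cvg_cst.
  + by rewrite -(mulr0 (normal_peak 1)); apply: cvgMr; exact: cvgr_expR.
- by move=> x _; have [] := dphi x.
- by apply: cvg_at_right_filter; apply: cvgN; exact: continuous_phi.
- by move=> x _; rewrite derive1E; have [_ ->] := dphi x.
Unshelve. all: by end_near. Qed.

(** Mills bound: on the tail [b * phi x <= x * phi x], and the right side has the antiderivative
    [- phi]. *)
Lemma nu_right_tail b : 0 < b -> (nu `[b, +oo[ <= (phi b / b)%:E)%E.
Proof.
move=> b0; rewrite -(lee_pmul2l (x := b%:E)) ?lte_fin// -EFinM mulrC divfK ?gt_eqF//.
rewrite -integral_id_phi// nuE -ge0_integralZl//=.
- apply: ge0_le_integral => //=.
  + by move=> x _; rewrite lee_fin mulr_ge0 ?(ltW b0)// (ltW (phi_gt0 _)).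
  + by apply/measurable_funeM; exact: measurable_phi.
  + apply/measurable_EFinP; apply: measurable_funM => //.
    by apply: measurable_funTS; exact: measurable_normal_pdf.
  + move=> x; rewrite in_itv/= andbT => bx.
    by rewrite -EFinM lee_fin ler_pM2r// phi_gt0.
- exact: measurable_phi.
- by move=> x _; rewrite lee_fin (ltW (phi_gt0 _)).
- by rewrite lee_fin ltW.
Qed.

Lemma nu_left_tail b : nu `]-oo, (- b)%R] = nu `[b, +oo[.
Proof.
rewrite !nuE ge0_integration_by_substitutionNy.
- by apply: eq_integral => x _; rewrite /= phi_even.
- by apply: continuous_subspaceT => x; exact: continuous_phi.
- by move=> x _; rewrite ltW// phi_gt0.
Qed.

Lemma nu_outside_le b : 0 < b -> (nu (~` `[(- b)%R, b]) <= (2 * (phi b / b))%:E)%E.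
Proof.
move=> b0; apply: (@le_trans _ _ (nu `]-oo, (- b)%R] + nu `[b, +oo[)%E).
  apply: le_trans (measureU2 _ _ _); [|exact: measurable_itv|exact: measurable_itv].
  apply: le_measure; rewrite ?inE; [exact: measurableC|exact: measurableU|].
  move=> x /=; rewrite !in_itv/= andbT => /negP; rewrite negb_and -!ltNge.
  by move=> /orP[/ltW|/ltW]; [left|right].
by rewrite nu_left_tail -mulr2n mulr2n mulrDl !mul1r EFinD leeD// nu_right_tail.
Qed.

(** Shifts by less than [r] give an open set and the two extreme shifts give translates of [S], so
    thickening preserves Borel sets. *)
Lemma thickeningE S r : 0 <= r -> thickening S r =
  \bigcup_(y in S) ball y r `|` [set y + r | y in S] `|` [set y - r | y in S].
Proof.
move=> r0; apply/seteqP; split => [x [y Sy [z]]|x].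
  rewrite /= in_itv/= => /andP[rz zr] <-.
  have [->|/eqP zr'] := pselect (z = r); first by left; right; exists y.
  have [->|/eqP zNr] := pselect (z = - r); first by right; exists y.
  left; left; exists y => //; rewrite /ball/= opprD addNKr normrN.
  by rewrite ltr_norml !lt_neqAle rz zr zr' eq_sym zNr.
move=> [[[y Sy]|[y Sy <-]]|[y Sy <-]].
- rewrite /ball/= distrC => xy; exists y => //; exists (x - y); last by rewrite addrC subrK.
  by rewrite /= in_itv/= -ler_norml ltW.
- by exists y => //; exists r => //; rewrite /= in_itv/= lexx andbT (le_trans _ r0)// oppr_le0.
- by exists y => //; exists (- r) => //; rewrite /= in_itv/= lexx/= (le_trans _ r0)// oppr_le0.
Qed.

Lemma measurable_shift S r : measurable S ->
  measurable ([set y + r | y in S] : set (measurableTypeR R)).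
Proof.
move=> mS; rewrite (_ : [set _ | _ in _] = (fun x : measurableTypeR R => x - r) @^-1` S).
  rewrite -[X in measurable X]setTI.
  suff : measurable_fun [set: measurableTypeR R] (fun x : measurableTypeR R => x - r) by exact.
  exact: measurable_funB.
apply/seteqP; split => [x [y Sy <-]|x Sx] /=; first by rewrite addrK.
by exists (x - r) => //; rewrite subrK.
Qed.

Lemma measurable_thickening S r : 0 <= r -> measurable S ->
  measurable (thickening S r : set (measurableTypeR R)).
Proof.
move=> r0 mS; rewrite thickeningE//; apply: measurableU; last exact: measurable_shift.
apply: measurableU; last exact: measurable_shift.
by apply: open_measurable; apply: bigcup_open => y _; exact: ball_open.
Qed.

Lemma sub_thickening S r : 0 <= r -> S `<=` thickening S r.
Proof.
move=> r0 x Sx; exists x => //; exists 0; last by rewrite addr0.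
by rewrite /= in_itv/= oppr_le0 r0.
Qed.

Lemma limf_einf_ge (T : choiceType) (X : filteredType T) (f : X -> \bar R)
    (F : set (set X)) (c : \bar R) :
  F [set x | (c <= f x)%E] -> (c <= limf_einf f F)%E.
Proof.
move=> Fc; rewrite limf_einfE; apply: ereal_sup_ge.
exists (ereal_inf (f @` [set x | (c <= f x)%E])); first by exists [set x | (c <= f x)%E].
by apply/ereal_infP => _ [x cfx <-].
Qed.

Lemma limf_einf_le (T : choiceType) (X : filteredType T) (f : X -> \bar R)
    (F : set (set X)) (c : \bar R) : ProperFilter F ->
  F [set x | (f x <= c)%E] -> (limf_einf f F <= c)%E.
Proof.
move=> PF Fc; rewrite limf_einfE; apply: ub_ereal_sup => _ [V FV <-].
have /filter_ex[x [Vx fxc]] : F (V `&` [set x | (f x <= c)%E]) by exact: filterI.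
by apply: le_trans fxc; apply: ereal_inf_lbound; exists x.
Qed.

Lemma le_diff_quotient (c r : R) (D : \bar R) : 0 < r ->
  ((c%:E <= D / r%:E) = ((r * c)%:E <= D))%E.
Proof.
move=> r0; rewrite inver gt_eqF//; case: D => [D| |].
- by rewrite -EFinM !lee_fin ler_pdivlMr// mulrC.
- by rewrite gt0_mulye ?lte_fin ?invr_gt0// !leey.
- by rewrite gt0_mulNye ?lte_fin ?invr_gt0// !leeNy_eq.
Qed.

Lemma diff_quotient_le (c r : R) (D : \bar R) : 0 < r ->
  ((D / r%:E <= c%:E) = (D <= (r * c)%:E))%E.
Proof.
move=> r0; rewrite inver gt_eqF//; case: D => [D| |].
- by rewrite -EFinM !lee_fin ler_pdivrMr// mulrC.
- by rewrite gt0_mulye ?lte_fin ?invr_gt0// !leye_eq.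
- by rewrite gt0_mulNye ?lte_fin ?invr_gt0// !leNye.
Qed.

Lemma content_ge0 S : measurable S -> (0 <= lower_minkowski_content nu S)%E.
Proof.
move=> mS; apply: limf_einf_ge; near=> r.
have r0 : 0 < r by near: r; exact: nbhs_right_gt.
rewrite /= le_diff_quotient// mulr0 sube_ge0.
  apply: le_measure; rewrite ?inE//; last exact/sub_thickening/ltW.
  by apply: measurable_thickening => //; exact: ltW.
by rewrite fin_num_measure.
Unshelve. all: by end_near. Qed.

(* The set has a boundary point in [[-b, b]], around which its thickening gains
   an interval of length [r]. *)
Lemma thickening_gap b (S : set R) : (exists2 s, S s & - b <= s <= b) ->
  (exists r z, [/\ 0 < r, - b <= z <= b & ~ thickening S r z]) ->
  exists2 r0, 0 < r0 & forall r, 0 < r < r0 -> exists u,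
    [/\ - b <= u, u + r <= b, `]u, u + r[ `<=` thickening S r &
        `]u, u + r[ `&` S = set0].
Proof.
move=> [s Ss /andP[bs sb]] [r0 [z [r00 /andP[bz zb] zS]]].
have far x : S x -> r0 < `|z - x|.
  move=> Sx; rewrite ltNge; apply/negP => zx; apply: zS; exists x => //.
  by exists (z - x); [rewrite /= in_itv/= -ler_norml|rewrite addrC subrK].
exists r0 => // r /andP[rp rr0].
have [sz|zs] := leP s z.
  (* []u, u + r[] misses [S] because it lies above the supremum and, as [u + r < u + r0 <= z], still
     below [z]; it lies in the thickening because [S] has points arbitrarily close to [u] from
     below. *)
  pose V := [set x | S x /\ x <= z]; pose u := sup V.
  have Vs : V s by [].
  have Vsup : has_sup V by split; [exists s|exists z => x []].
  have Vub x : V x -> x <= z - r0.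
    move=> [Sx xz]; have := far x Sx; rewrite ger0_norm ?subr_ge0//; lra.
  have uz : u <= z - r0 by apply: ge_sup; [exists s|move=> x; exact: Vub].
  have su : s <= u by apply: ub_le_sup => //; exact: Vsup.2.
  exists u; split.
  - by rewrite (le_trans bs).
  - lra.
  - move=> w /=; rewrite in_itv/= => /andP[uw wur].
    have [x [Sx xz] wx] : exists2 x, V x & u - (u + r - w) < x.
      by apply: sup_adherent => //; rewrite subr_gt0.
    have xu : x <= u by apply: ub_le_sup => //; exact: Vsup.2.
    exists x => //; exists (w - x); last by rewrite addrC subrK.
    by rewrite /= in_itv/=; lra.
  - rewrite -subset0 => w [/=]; rewrite in_itv/= => /andP[uw wur] Sw.
    have : w <= u by apply: ub_le_sup; [exact: Vsup.2|split=> //; lra].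
    by rewrite leNgt uw.
pose V := [set x | S x /\ z <= x]; pose v := inf V.
have Vs : V s by split => //; exact: ltW.
have Vinf : has_inf V by split; [exists s|exists z => x []].
have Vlb x : V x -> z + r0 <= x.
  move=> [Sx zx]; have := far x Sx; rewrite distrC ger0_norm ?subr_ge0//; lra.
have zv : z + r0 <= v by apply: lb_le_inf; [exists s|move=> x; exact: Vlb].
have vs : v <= s by apply: ge_inf => //; exact: Vinf.2.
exists (v - r); rewrite subrK; split.
- lra.
- by rewrite (le_trans vs).
- move=> w /=; rewrite in_itv/= => /andP[vrw wv].
  have [x [Sx zx] xw] : exists2 x, V x & x < v + (w - (v - r)).
    by apply: inf_adherent => //; rewrite subr_gt0.
  have vx : v <= x by apply: ge_inf => //; exact: Vinf.2.
  exists x => //; exists (w - x); last by rewrite addrC subrK.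
  by rewrite /= in_itv/=; lra.
- rewrite -subset0 => w [/=]; rewrite in_itv/= => /andP[vrw wv] Sw.
  have : v <= w by apply: ge_inf; [exact: Vinf.2|split=> //; lra].
  by rewrite leNgt wv.
Qed.

Lemma measure_inter_gt0 d (T : measurableType d) (mu : probability T R)
    (S S' : set T) : measurable S -> measurable S' ->
  (mu (~` S') < mu S)%E -> (0 < mu (S `&` S'))%E.
Proof.
move=> mS mS' S'S; rewrite lt0e measure_ge0 andbT; apply/eqP => SS'.
have : (mu S <= mu (~` S'))%E.
  rewrite -[S](setIT S) -(setUv S') setIUr.
  apply: (le_trans (measureU2 _ _ _)); [exact: measurableI|exact: measurableI (measurableC _)|].
  apply: (@le_trans _ _ (0 + mu (S `&` ~` S'))%E).
    by apply: leeD => //; rewrite le_eqVlt; apply/orP; left; apply/eqP; exact: SS'.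
  rewrite add0e; apply: le_measure; rewrite ?inE; last exact: subIsetr.
    exact: measurableI (measurableC _).
  exact: measurableC.
by rewrite leNgt S'S.
Qed.

(** The mass assumptions make [S] and its complement both meet [[-b, b]] in positive measure. If
    some thickening leaves a gap there, [thickening_gap] yields an interval of length [r] where the
    density is at least [phi b]. Otherwise every thickening covers [[-b, b]] and gains the fixed
    amount [g], more than [r * phi b] for small [r]. *)
Lemma content_ge_phi b S : measurable S -> 0 < b ->
  (nu (~` `[(- b)%R, b]) < nu S)%E -> (nu (~` `[(- b)%R, b]) < nu (~` S))%E ->
  ((phi b)%:E <= lower_minkowski_content nu S)%E.
Proof.
move=> mS b0 KS KSc.
have mK : measurable (`[(- b)%R, b] : set (measurableTypeR R)) by exact: measurable_itv.
have KS0 := measure_inter_gt0 mS mK KS.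
have KSc0 := measure_inter_gt0 (measurableC mS) mK KSc.
suff [r0 r00 H] : exists2 r0, 0 < r0 & forall r, 0 < r < r0 ->
    ((r * phi b)%:E <= nu (thickening S r) - nu S)%E.
  apply: limf_einf_ge; near=> r.
  have r_gt0 : 0 < r by near: r; exact: nbhs_right_gt.
  rewrite /= le_diff_quotient//; apply: H; rewrite r_gt0/=.
  by near: r; exact: nbhs_right_lt.
have [gap|/forallNP nogap] := pselect (exists r z, [/\ 0 < r, - b <= z <= b & ~ thickening S r z]).
  have [|r0 r00 H] := @thickening_gap b S _ gap.
    apply: contrapT => nS; move: KS0; rewrite (_ : _ `&` _ = set0) ?measure0 ?ltxx//.
    by rewrite -subset0 => x [Sx]; rewrite /= in_itv/= => xb; apply: nS; exists x.
  exists r0 => // r rr0; have [u [bu urb uS uS0]] := H r rr0.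
  have /andP[r_gt0 _] := rr0.
  rewrite leeBrDr ?fin_num_measure//; apply: (@le_trans _ _ (nu (`]u, (u + r)%R[ `|` S))%E).
    rewrite measureU//.
    by rewrite leeD2r// nu_ge_length// ltW.
  apply: le_measure; rewrite ?inE.
  - by apply: measurableU => //; exact: measurable_itv.
  - by apply: measurable_thickening => //; exact: ltW.
  - by rewrite subUset; split => //; exact/sub_thickening/ltW.
pose g := fine (nu (~` S `&` `[(- b)%R, b])).
have gE : nu (~` S `&` `[(- b)%R, b]) = g%:E.
  by rewrite fineK// fin_num_measure//; exact: measurableI (measurableC mS) mK.
have g0 : 0 < g by rewrite -lte_fin -gE.
exists (g / phi b); first by rewrite divr_gt0// phi_gt0.
move=> r /andP[r_gt0]; rewrite ltr_pdivlMr ?phi_gt0// => rg.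
rewrite leeBrDr ?fin_num_measure//.
apply: (@le_trans _ _ (nu ((~` S `&` `[(- b)%R, b]) `|` S))%E).
  rewrite measureU//; last by rewrite -subset0 => x [[]].
    apply: leeD => //; apply: (@le_trans _ _ g%:E); first by rewrite lee_fin ltW.
    by rewrite le_eqVlt; apply/orP; left; apply/eqP; exact/esym/gE.
  exact: measurableI (measurableC mS) mK.
apply: le_measure; rewrite ?inE.
- by apply: measurableU => //; exact: measurableI (measurableC mS) mK.
- by apply: measurable_thickening => //; exact: ltW.
- rewrite subUset; split; last exact/sub_thickening/ltW.
  move=> x [_]; rewrite /= in_itv/= => xb; apply: contrapT => xS.
  by have /forallNP/(_ x) := nogap r; apply.
Unshelve. all: by end_near. Qed.

(** The factor [expR (- 2)] is the loss that pushes the level [b] of [exists_level] far enough out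
    for its tail bound. *)
Definition content_const : R := normal_peak 1 * expR (- 2).

Lemma content_const_gt0 : 0 < content_const.
Proof. by rewrite mulr_gt0 ?expR_gt0// peak_gt0. Qed.

Lemma ln2_bounds : 2^-1 <= ln (2 : R) <= 1.
Proof.
have : ln (2 : R) <= 2 - 1 by exact: ln_le_sub1.
have : ln (2^-1 : R) <= 2^-1 - 1 by apply: ln_le_sub1; rewrite invr_gt0.
by rewrite lnV ?posrE//; lra.
Qed.

Lemma expR2_ge4 : 4 <= expR 2 :> R.
Proof.
have e1 : 2 <= expR 1 :> R by have := expR_ge1Dx (1 : R); lra.
have -> : 2 = 1 + 1 :> R by [].
by rewrite expRD; have := ler_pM _ _ e1 e1; lra.
Qed.

Lemma content_const_le : content_const <= 8^-1.
Proof.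
rewrite /content_const expRN.
have -> : 8^-1 = 2^-1 * 4^-1 :> R by field.
apply: ler_pM; rewrite ?(ltW peak_gt0) ?invr_ge0 ?expR_ge0 ?(ltW peak_lt_half)//.
by rewrite lef_pV2 ?posrE ?expR_gt0// expR2_ge4.
Qed.

(* The witness is chosen so that [phi b] has the exact order of the Gaussian
   isoperimetric profile at [2 ^- L]. *)
Lemma exists_level (L : nat) : exists2 b : R, 0 < b &
  phi b = content_const * Num.sqrt L.+1%:R * 2 ^- L /\
  2 * (phi b / b) <= 2 ^- L.+1.
Proof.
(* The square of the level. In [expR (- (B / 2))] the three terms yield [2 ^- L], [Num.sqrt L.+1%:R]
   and [expR (- 2)]; the tail bound uses [L.+1%:R / 4 <= B]. *)
pose B : R := 2 * ln 2 * L%:R - ln L.+1%:R + 4.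
have /andP[ln2l ln2u] := ln2_bounds.
have L0 : 0 <= L%:R :> R by [].
have L1 : 0 < L.+1%:R :> R by rewrite ltr0n.
have lnL : ln L.+1%:R <= L.+1%:R / 2 :> R.
  have : ln (L.+1%:R / 2 : R) <= L.+1%:R / 2 - 1 by apply: ln_le_sub1; rewrite divr_gt0.
  by rewrite ln_div ?posrE//; lra.
have HB : L.+1%:R / 4 <= B.
  have : L%:R <= 2 * ln 2 * L%:R :> R by rewrite -{1}[L%:R]mul1r ler_wpM2r//; lra.
  by rewrite /B; move: lnL; rewrite -natr1; lra.
have B0 : 0 < B by rewrite (lt_le_trans _ HB)// divr_gt0.
pose b := Num.sqrt B.
have b0 : 0 < b by rewrite sqrtr_gt0.
have phib : phi b = content_const * Num.sqrt L.+1%:R * 2 ^- L.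
  rewrite phiE sqr_sqrtr ?(ltW B0)// /content_const -!mulrA; congr (_ * _).
  have -> : - (B / 2) = - 2 + (ln L.+1%:R / 2 + - (ln 2 * L%:R)) by rewrite /B; field.
  rewrite !expRD; congr (_ * (_ * _)).
    have s0 : 0 < Num.sqrt L.+1%:R :> R by rewrite sqrtr_gt0.
    have -> : ln L.+1%:R = 2 * ln (Num.sqrt L.+1%:R) :> R.
      by rewrite -{1}(sqr_sqrtr (ltW L1)) lnXn// mulr_natl.
    by rewrite mulrAC divff// mul1r lnK.
  by rewrite expRN mulrC expRM_natl lnK// posrE.
exists b => //; split => //.
rewrite phib mulrA ler_pdivrMr// exprS invfM.
have -> : 2 * (content_const * Num.sqrt L.+1%:R / 2 ^+ L) =
  2 * content_const * Num.sqrt L.+1%:R * 2 ^- L by rewrite !mulrA.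
have -> : 2^-1 / 2 ^+ L * b = 2^-1 * b * 2 ^- L by rewrite mulrAC.
rewrite ler_pM2r ?invr_gt0 ?exprn_gt0//.
have cc := content_const_le.
apply: (@le_trans _ _ (2^-1 * (Num.sqrt L.+1%:R / 2))); last first.
  rewrite ler_pM2l ?invr_gt0//.
  have -> : Num.sqrt L.+1%:R / 2 = Num.sqrt (L.+1%:R / 4) :> R.
    rewrite sqrtrM ?(ltW L1)// sqrtrV//; congr (_ / _).
    have -> : 4 = 2 ^+ 2 :> R by rewrite expr2; lra.
    by rewrite sqrtr_sqr ger0_norm.
  by rewrite ler_wsqrtr.
have := sqrtr_ge0 (L.+1%:R : R); set l := Num.sqrt _ => l0.
have -> : 2 * content_const * l = l * (2 * content_const) by ring.
have -> : 2^-1 * (l / 2) = l * 4^-1 by field.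
by rewrite ler_wpM2l//; lra.
Qed.

Lemma exists_pow2_lt (q : R) : 0 < q -> exists M : nat, 2 ^- M < q.
Proof.
move=> q0; exists (Num.truncn q^-1).+1; rewrite invf_plt ?posrE ?exprn_gt0//.
apply: (lt_le_trans (truncnS_gt _)).
by rewrite -natrX ler_nat ltnW// ltn_expl.
Qed.

Lemma exists_dyadic (q : R) : 0 < q -> q <= 2^-1 ->
  exists2 L : nat, (0 < L)%N & 2 ^- L.+1 < q <= 2 ^- L.
Proof.
move=> q0 q2.
have [M HM] := exists_pow2_lt q0.
have := ex_minnP (ex_intro (fun M => 2 ^- M < q) M HM).
case; case=> [|[|L]] HL Lmin.
- by move: HL; rewrite expr0 invr1 ltNge (le_trans q2)// invf_le1//; lra.
- by move: HL; rewrite expr1 ltNge q2.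
exists L.+1 => //; rewrite HL/= leNgt; apply/negP => /Lmin.
by rewrite ltnn.
Qed.

(** Let [2 ^- L.+1 < q <= 2 ^- L]; the content is at least of order [Num.sqrt L.+1%:R * 2 ^- L]. For
    [L <= K] the sum is at most [L.+1%:R * 2 ^- L], and [L.+1 <= 4 * K]; for [K < L] it is at most
    [K%:R * 2 ^- L], and [K <= L.+1]. *)
Lemma dyadic_trunc_content S (K : nat) : measurable S -> (0 < K)%N ->
  ((\sum_(1 <= k < K.+1) dyadic_trunc k (fine (nu S)))%:E <=
   (2 / content_const * Num.sqrt K%:R)%:E * lower_minkowski_content nu S)%E.
Proof.
move=> mS K0; set p := fine (nu S).
have c0 := content_const_gt0.
have nuS : nu S = p%:E by rewrite fineK// fin_num_measure.
have nuSc : nu (~` S) = (1 - p)%:E.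
  by rewrite probability_setC// EFinB; congr (_ - _)%E; exact: nuS.
have p01 : 0 <= p <= 1.
  by rewrite -!lee_fin -nuS measure_ge0 probability_le1.
have C0 : 0 <= 2 / content_const * Num.sqrt K%:R.
  by rewrite mulr_ge0 ?sqrtr_ge0// divr_ge0// ltW.
pose q := Num.min p (1 - p).
have /andP[p0 p1] := p01.
have q0 : 0 <= q by rewrite le_min p0 subr_ge0.
have q2 : q <= 2^-1 by rewrite /q ge_min; case: (leP p 2^-1) => //= ?; lra.
have truncq k : dyadic_trunc k p <= q by rewrite /dyadic_trunc ge_min lexx.
move: q0; rewrite le_eqVlt => /predU1P[q_eq0|q_gt0].
  rewrite big1_seq ?mule_ge0 ?lee_fin ?content_ge0// => k _.
  apply/eqP; rewrite eq_le dyadic_trunc_ge0// andbT.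
  by rewrite q_eq0.
have [L L0 /andP[Lq qL]] := exists_dyadic q_gt0 q2.
have [b b0 [phib Tb]] := exists_level L.
have Tq : (nu (~` `[(- b)%R, b]) < q%:E)%E.
  by rewrite (le_lt_trans (nu_outside_le b0))// lte_fin (le_lt_trans Tb).
have phi_content : ((phi b)%:E <= lower_minkowski_content nu S)%E.
  apply: content_ge_phi => //; rewrite (lt_le_trans Tq)// ?nuSc ?nuS lee_fin /q ge_min lexx ?orbT//.
apply: (@le_trans _ _ ((2 / content_const * Num.sqrt K%:R)%:E * (phi b)%:E)%E); last first.
  by rewrite lee_wpmul2l ?lee_fin.
rewrite -EFinM lee_fin phib.
have s0 : 0 <= Num.sqrt K%:R :> R by exact: sqrtr_ge0.
set s := Num.sqrt K%:R in s0 *; set l := Num.sqrt L.+1%:R.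
have l0 : 0 <= l by exact: sqrtr_ge0.
have -> : 2 / content_const * s * (content_const * l * 2 ^- L) = 2 * s * l * 2 ^- L.
  transitivity ((content_const / content_const) * (2 * s * l * 2 ^- L)); first by ring.
  by rewrite divff ?mul1r// gt_eqF.
have sK : s ^+ 2 = K%:R by rewrite sqr_sqrtr.
have lL : l ^+ 2 = L.+1%:R by rewrite sqr_sqrtr.
have pow0 : 0 < 2 ^- L :> R by rewrite invr_gt0 exprn_gt0.
have [LK|KL] := leqP L K.
  apply: (@le_trans _ _ (L.+1%:R * 2 ^- L)).
    apply: (le_trans (sum_dyadic_trunc_le L K.+1 p01)).
    have -> : L.+1%:R = L%:R + 1 :> R by rewrite natr1.
    rewrite mulrDl mul1r lerD2r.
    rewrite -[leRHS](_ : \sum_(1 <= k < L.+1) 2 ^- L = _).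
      by apply: ler_sum => k _; rewrite (le_trans (truncq k)).
    by rewrite big_const_nat iter_addr_0 subSS subn0 mulr_natl.
  rewrite ler_pM2r// -lL expr2 ler_wpM2r//.
  rewrite -(@ler_pXn2r _ 2) ?nnegrE ?mulr_ge0// exprMn sK lL expr2.
  have : L.+1%:R <= (4 * K)%:R :> R.
    by rewrite ler_nat (leq_ltn_trans LK)// ltn_Pmull.
  by rewrite natrM; lra.
apply: (@le_trans _ _ (K%:R * 2 ^- L)).
  rewrite -[leRHS](_ : \sum_(1 <= k < K.+1) 2 ^- L = _).
    by apply: ler_sum => k _; rewrite (le_trans (truncq k)).
  by rewrite big_const_nat iter_addr_0 subSS subn0 mulr_natl.
rewrite ler_pM2r// -sK expr2 -mulrA mulrCA ler_wpM2l//.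
have sl : s <= l by rewrite ler_wsqrtr// ler_nat ltnW// ltnW.
by lra.
Qed.

(** All points gained lie within [r] of one of them, in an interval of length [2 * r]. For monotone
    fibers this puts the influences below 1, away from the values where [mul_sqrt_log] vanishes by
    convention. *)
Lemma content_le_of_diam S : measurable S ->
  (forall r, 0 < r -> forall u v, thickening S r u -> ~ S u -> thickening S r v -> ~ S v ->
     `|u - v| <= r) ->
  (lower_minkowski_content nu S <= (2 * normal_peak 1)%:E)%E.
Proof.
move=> mS diam; apply: limf_einf_le; near=> r.
have r0 : 0 < r by near: r; exact: nbhs_right_gt.
have mT : measurable (thickening S r : set (measurableTypeR R)).
  by apply: measurable_thickening => //; exact: ltW.
rewrite /= diff_quotient_le// leeBlDr ?fin_num_measure//.
apply: (@le_trans _ _ (nu (thickening S r `\` S) + nu S)%E).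
  rewrite -measureU//; [|exact: measurableD|by rewrite setDE -setIA setICl setI0].
  apply: le_measure; rewrite ?inE//; last first.
    by move=> x Tx; have [Sx|nSx] := pselect (S x); [right|left].
  by apply: measurableU => //; exact: measurableD.
apply: leeD => //.
have [[u [Tu Su]]|D0] := pselect (exists u, (thickening S r `\` S) u); last first.
  rewrite (_ : _ `\` _ = set0); last by rewrite -subset0 => x Dx; apply: D0; exists x.
  by rewrite measure0 lee_fin !mulr_ge0 ?(ltW r0)// (ltW peak_gt0).
apply: (@le_trans _ _ (nu `[(u - r)%R, (u - r + 2 * r)%R])%E).
  apply: le_measure; rewrite ?inE; [exact: measurableD|exact: measurable_itv|].
  move=> v [Tv Sv]; have := diam r r0 u v Tu Su Tv Sv.
  by rewrite /= in_itv/= ler_norml; lra.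
apply: (le_trans (nu_le_length _ _)); first by rewrite mulr_ge0// ltW.
by rewrite lee_fin; lra.
Unshelve. all: by end_near. Qed.

Lemma content_le_up S : measurable S -> (forall x y, x <= y -> S x -> S y) ->
  (lower_minkowski_content nu S <= (2 * normal_peak 1)%:E)%E.
Proof.
move=> mS Sup; apply: content_le_of_diam => // r r0.
suff H u v : thickening S r u -> ~ S v -> v <= u + r.
  move=> u v Tu Su Tv Sv; rewrite ler_norml.
  by have := H u v Tu Sv; have := H v u Tv Su; lra.
move=> [y Sy [z]]; rewrite /= in_itv/= => /andP[rz zr] <- Sv.
rewrite leNgt; apply/negP => vr; apply: Sv; apply: Sup Sy.
by lra.
Qed.

Lemma content_le_down S : measurable S -> (forall x y, y <= x -> S x -> S y) ->
  (lower_minkowski_content nu S <= (2 * normal_peak 1)%:E)%E.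
Proof.
move=> mS Sup; apply: content_le_of_diam => // r r0.
suff H u v : thickening S r u -> ~ S v -> u - r <= v.
  move=> u v Tu Su Tv Sv; rewrite ler_norml.
  by have := H u v Tu Sv; have := H v u Tv Su; lra.
move=> [y Sy [z]]; rewrite /= in_itv/= => /andP[rz zr] <- Sv.
rewrite leNgt; apply/negP => vr; apply: Sv; apply: Sup Sy.
by lra.
Qed.

End gaussian_line.

(** * Discretization of the Gaussian product *)

Section gaussian_quantiles.
Context {R : realType}.
Notation nu := (std_gaussian R).
Implicit Types (x y z a : R) (m : nat).

Definition Phi x : R := fine (nu `]-oo, x]).

Lemma PhiE x : nu `]-oo, x] = (Phi x)%:E.
Proof. by rewrite fineK// fin_num_measure//; exact: measurable_itv. Qed.

Lemma nu_set1 x : nu [set x] = 0%E.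
Proof.
apply/eqP; rewrite eq_le measure_ge0 andbT.
have := @nu_le_length R 0 x (lexx _); rewrite addr0 mulr0 => h; apply: le_trans h.
by rewrite le_eqVlt set_itv1 eqxx.
Qed.

Lemma nu_oc x y : x <= y -> nu `]x, y] = (Phi y - Phi x)%:E.
Proof.
move=> xy; rewrite EFinB -!PhiE.
have -> : [set` `]-oo, y]] = [set` `]-oo, x]] `|` [set` `]x, y]] :> set R.
  by apply/seteqP; split => z /=; rewrite !in_itv/=; [case: (leP z x)|];
    [left|right|move=> []]; lra.
have mi (i : interval R) : measurable ([set` i] : set (measurableTypeR R)).
  exact: measurable_itv.
rewrite measureU//; last first.
  by rewrite -subset0 => z [/=]; rewrite !in_itv/=; lra.
by rewrite addeAC subee ?add0e// fin_num_measure.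
Qed.

Lemma Phi_lipschitz x y : x <= y -> 0 <= Phi y - Phi x <= y - x.
Proof.
move=> xy; rewrite -!lee_fin -nu_oc// measure_ge0/=.
apply: (@le_trans _ _ (nu `[x, (x + (y - x))%R])%E).
  apply: le_measure; rewrite ?inE; [exact: measurable_itv|exact: measurable_itv|].
  by move=> z /=; rewrite !in_itv/=; lra.
apply: (le_trans (nu_le_length _ _)); first by rewrite subr_ge0.
rewrite lee_fin -[leRHS]mul1r ler_wpM2r ?subr_ge0// ltW// (lt_trans peak_lt_half)//.
by rewrite invf_lt1// ltr1n.
Qed.

Lemma Phi_lt x y : x < y -> Phi x < Phi y.
Proof.
move=> xy; rewrite -subr_gt0 -lte_fin -nu_oc ?ltW//.
pose b := `|x| + `|y|.
apply: (@lt_le_trans _ _ (nu `]x, (x + (y - x))%R[)%E).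
  apply: (@lt_le_trans _ _ ((y - x) * phi b)%:E).
    by rewrite lte_fin mulr_gt0 ?subr_gt0// phi_gt0.
  have := ler_norm x; have := ler_norm (- x); have := ler_norm y; have := ler_norm (- y).
  rewrite !normrN => ? ? ? ?; have := normr_ge0 x; have := normr_ge0 y => ? ?.
  by apply: nu_ge_length; rewrite /b; lra.
apply: le_measure; rewrite ?inE; [exact: measurable_itv|exact: measurable_itv|].
by move=> z /=; rewrite !in_itv/=; lra.
Qed.

Lemma le_Phi x y : x <= y -> Phi x <= Phi y.
Proof. by rewrite le_eqVlt => /predU1P[->//|/Phi_lt/ltW]. Qed.

Lemma Phi01 x : 0 <= Phi x < 1.
Proof.
rewrite -lee_fin -PhiE measure_ge0/=; apply: (lt_le_trans (@Phi_lt x (x + 1) _)).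
  by rewrite ltrDl.
by rewrite -lee_fin -PhiE probability_le1//; exact: measurable_itv.
Qed.

Lemma continuous_Phi : continuous Phi.
Proof.
move=> x; apply/cvgrPdist_le => e e0; near=> y.
have xy : `|x - y| <= e by near: y; exact: cvgr_dist_le.
apply: le_trans xy; have [yx|xy] := leP y x.
  by have := Phi_lipschitz yx; rewrite !ger0_norm ?subr_ge0//; [lra|exact: le_Phi].
rewrite distrC (distrC x).
by have := Phi_lipschitz (ltW xy); rewrite !ger0_norm ?subr_ge0 ?(ltW xy)//; [lra|exact/le_Phi/ltW].
Unshelve. all: by end_near. Qed.

Lemma Phi_surj a : 0 < a < 1 -> exists z, Phi z = a.
Proof.
move=> /andP[a0 a1].
pose e := Num.min a (1 - a).
have e0 : 0 < e by rewrite lt_min a0 subr_gt0.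
(* Both tails beyond [b] are then below [e], since [2 * (phi b / b) = phi b * e] and [phi b < 1];
   hence [Phi] takes values on both sides of [a]. *)
pose b : R := 2 / e.
have b0 : 0 < b by rewrite divr_gt0.
have be : 2 * (phi b / b) < e.
  rewrite (_ : 2 * _ = phi b * e); last by rewrite /b; field; rewrite gt_eqF.
  rewrite gtr_pMl//.
  apply: (le_lt_trans (phi_le_peak _)); rewrite (lt_trans peak_lt_half)//.
  by rewrite invf_lt1// ltr1n.
have tail : (nu `[b, +oo[ <= e%:E)%E.
  apply: (le_trans (nu_right_tail b0)); rewrite lee_fin.
  by have P0 : 0 < phi b / b; [rewrite divr_gt0 ?phi_gt0|lra].
have Pb : Phi (- b) <= a.
  apply: (@le_trans _ _ e); last by rewrite /e ge_min lexx.
  by rewrite -lee_fin -PhiE nu_left_tail.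
have Pb' : a <= Phi b.
  suff : 1 - Phi b <= e by rewrite /e le_min => /andP[_]; lra.
  rewrite -lee_fin EFinB -PhiE -probability_setC; last exact: measurable_itv.
  apply: le_trans tail; apply: le_measure; rewrite ?inE.
  - by apply: measurableC; exact: measurable_itv.
  - exact: measurable_itv.
  - by move=> z /=; rewrite !in_itv/= andbT => /negP; rewrite -ltNge => /ltW.
have bb : - b <= b by rewrite (le_trans _ (ltW b0))// oppr_le0 ltW.
have [||c _ ca] := @IVT R Phi (- b) b a bb; last by exists c.
  by apply: continuous_subspaceT => x; exact: continuous_Phi.
by rewrite ge_min Pb/= le_max Pb' orbT.
Qed.

(** [Phi] transports [nu] to the uniform law. The end values 0 and 1 are separate because [Phi_surj]
    covers the open interval only. *)
Lemma nu_Phi_lt a : 0 <= a <= 1 -> nu [set y | Phi y < a] = a%:E.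
Proof.
move=> /andP[]; rewrite le_eqVlt => /predU1P[<- _|a0].
  rewrite (_ : [set _ | _] = set0) ?measure0//.
  by rewrite -subset0 => y /=; have /andP[] := Phi01 y; lra.
rewrite le_eqVlt => /predU1P[->|a1].
  rewrite (_ : [set _ | _] = setT) ?probability_setT//.
  by apply/seteqP; split => y //= _; have /andP[] := Phi01 y.
have [|z za] := @Phi_surj a; first by rewrite a0.
have -> : [set y | Phi y < a] = [set` `]-oo, z[].
  apply/seteqP; split => y /=; rewrite in_itv/= -za; last exact: Phi_lt.
  by rewrite !ltNge; apply: contra; exact: le_Phi.
rewrite -za -PhiE.
have -> : [set` `]-oo, z]] = [set` `]-oo, z[] `|` [set z] :> set R.
  apply/seteqP; split => y /=; rewrite !in_itv/=; last by move=> [/ltW|->].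
  by rewrite le_eqVlt => /predU1P[|]; [right|left].
rewrite measureU; [|exact: measurable_itv|exact: measurable_set1|].
  rewrite [X in (_ + X)%E](_ : _ = 0%E) ?adde0//; exact: nu_set1.
by rewrite -subset0 => y [/= + yz]; rewrite yz in_itv/= ltxx.
Qed.

Lemma measurable_Phi_lt a :
  measurable ([set y | Phi y < a] : set (measurableTypeR R)).
Proof.
apply: open_measurable; rewrite (_ : [set _ | _] = Phi @^-1` [set x | x < a]).
  by apply: open_comp; [move=> x _; exact: continuous_Phi|exact: open_lt].
by [].
Qed.

(** Index of the dyadic quantile interval; [Phi y < 1] keeps it in range, so [inord] alters
    nothing. *)
Definition cell m y : 'I_(2 ^ m).-1.+1 := inord (Num.truncn ((2 ^+ m) * Phi y)).

Lemma pow2_gt0 m : 0 < 2 ^+ m :> R.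
Proof. by rewrite exprn_gt0. Qed.

Lemma pow2_Phi_ge0 m y : 0 <= 2 ^+ m * Phi y.
Proof. by rewrite mulr_ge0 ?(ltW (pow2_gt0 m))//; have /andP[] := Phi01 y. Qed.

Lemma val_cell m y : cell m y = Num.truncn (2 ^+ m * Phi y) :> nat.
Proof.
rewrite inordK// dyadic_size truncn_lt_nat ?pow2_Phi_ge0// natrX gtr_pMr ?pow2_gt0//.
by have /andP[] := Phi01 y.
Qed.

Lemma le_cell m x y : x <= y -> (cell m x <= cell m y)%N.
Proof.
move=> xy; rewrite !val_cell; apply: le_truncn.
by rewrite ler_pM2l ?pow2_gt0// le_Phi.
Qed.

Lemma cell_div m m' y : (m <= m')%N -> cell m y = (cell m' y %/ 2 ^ (m' - m))%N :> nat.
Proof.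
move=> mm'; rewrite !val_cell; apply/truncn_def.
have /andP[t1 t2] := truncn_itv (pow2_Phi_ge0 m' y).
set t := Num.truncn _ in t1 t2 *; set d := (2 ^ (m' - m))%N.
have d0 : (0 < d)%N by rewrite expn_gt0.
have E : 2 ^+ m' * Phi y = 2 ^+ m * Phi y * d%:R :> R.
  by rewrite natrX mulrAC -exprD subnKC.
have dR : 0 < d%:R :> R by rewrite ltr0n.
rewrite -(ler_pM2r dR) -E -(ltr_pM2r dR) -E -!natrM.
rewrite (le_trans _ t1) ?ler_nat ?leq_trunc_div//=.
by rewrite (lt_le_trans t2)// ler_nat ltn_ceil.
Qed.

Lemma cell_preimage m (k : 'I_(2 ^ m).-1.+1) : [set y | cell m y = k] =
  [set y | Phi y < k.+1%:R / 2 ^+ m] `\` [set y | Phi y < k%:R / 2 ^+ m].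
Proof.
apply/seteqP; split => y /=.
  move=> /(congr1 (@nat_of_ord _)); rewrite val_cell => /eqP.
  rewrite truncn_eq ?pow2_Phi_ge0// => /andP[k1 k2].
  rewrite ltr_pdivlMr ?pow2_gt0// mulrC; split => //.
  by apply/negP; rewrite -leNgt ler_pdivrMr ?pow2_gt0// mulrC.
rewrite ltr_pdivlMr ?pow2_gt0// mulrC => -[k2 /negP].
rewrite -leNgt ler_pdivrMr ?pow2_gt0// mulrC => k1.
by apply/val_inj => /=; rewrite val_cell; apply/truncn_def; rewrite k1.
Qed.

Lemma measurable_cell m (k : 'I_(2 ^ m).-1.+1) :
  measurable ([set y | cell m y = k] : set (measurableTypeR R)).
Proof. by rewrite cell_preimage; apply: measurableD; exact: measurable_Phi_lt. Qed.

Lemma nu_cell m (k : 'I_(2 ^ m).-1.+1) : nu [set y | cell m y = k] = (2 ^- m)%:E.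
Proof.
have k1 : k.+1%:R <= 2 ^+ m :> R.
  by rewrite -natrX ler_nat (leq_trans (ltn_ord k))// dyadic_size.
rewrite cell_preimage measureD; [|exact: measurable_Phi_lt|exact: measurable_Phi_lt|]; last first.
  by rewrite ltey_eq fin_num_measure//; exact: measurable_Phi_lt.
rewrite (_ : _ `&` _ = [set y | Phi y < k%:R / 2 ^+ m]); last first.
  apply/setIidr => y /= yk; rewrite (lt_le_trans yk)// ler_pM2r ?invr_gt0 ?pow2_gt0//.
  by rewrite ler_nat.
transitivity ((k.+1%:R / 2 ^+ m)%:E - (k%:R / 2 ^+ m)%:E : \bar R)%E.
  congr (_ - _)%E; apply: nu_Phi_lt.
    by rewrite divr_ge0 ?(ltW (pow2_gt0 m))//= ler_pdivrMr ?pow2_gt0// mul1r.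
  rewrite divr_ge0 ?(ltW (pow2_gt0 m))//= ler_pdivrMr ?pow2_gt0// mul1r (le_trans _ k1)//.
  by rewrite ler_nat.
by rewrite -EFinB -mulrBl -natrB// subSnn mul1r.
Qed.

Lemma cell_surj m (k : 'I_(2 ^ m).-1.+1) : exists y, cell m y = k.
Proof.
have [[y yk]|nk] := pselect (exists y, cell m y = k); first by exists y.
have := nu_cell k; rewrite (_ : [set _ | _] = set0); last first.
  by rewrite -subset0 => y yk; apply: nk; exists y.
rewrite measure0 => -[/esym/eqP]; by rewrite invr_eq0 expf_eq0 pnatr_eq0 andbF.
Qed.

End gaussian_quantiles.

(** Read off from the integral as a supremum over simple functions, so the functions may be
    arbitrary. The integrand of [geometric_influence] is not known to be Borel. *)
Lemma le_ge0_integral d (T : measurableType d) (R : realType)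
    (mu : {measure set T -> \bar R}) (f g : T -> \bar R) :
  (forall x, (0 <= f x)%E) -> (forall x, (f x <= g x)%E) ->
  (\int[mu]_x f x <= \int[mu]_x g x)%E.
Proof.
move=> f0 fg; have g0 x : (0 <= g x)%E by exact: le_trans (fg x).
rewrite !ge0_integralTE//; apply: le_ereal_sup => _ [h hf <-].
by exists h => // x; exact: le_trans (fg x).
Qed.

(** * Cells, random fibers and approximation by cells in the product *)

Section product_gaussian.
Context {R : realType} {n : nat}.
Notation nu := (std_gaussian R).
Notation mu := (gaussian_pow R n).
Notation T := (tupleR R n).
Implicit Types (A B C : set T) (i j : 'I_n) (m : nat).

Lemma measurable_box (S : 'I_n -> set (measurableTypeR R)) :
  (forall i, measurable (S i)) -> measurable [set x : T | forall i, S i (tnth x i)].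
Proof.
move=> mS; rewrite (_ : mkset _ =
  \bigcap_(i in [set: 'I_n]) ((@tnth n (measurableTypeR R)) ^~ i @^-1` S i)).
  apply: fin_bigcap_measurable => // i _; rewrite -[X in measurable X]setTI.
  exact: measurable_tnth.
by apply/seteqP; split => x /= Bx i => [_|]; exact: Bx.
Qed.

Definition grid m (x : T) : {ffun 'I_n -> 'I_(2 ^ m).-1.+1} :=
  [ffun i => cell m (tnth x i)].

Lemma grid_fiber m c : [set x | grid m x = c] =
  [set x : T | forall i, [set y | cell m y = c i] (tnth x i)].
Proof.
apply/seteqP; split => x /=; first by move=> <- i; rewrite ffunE.
by move=> xc; apply/ffunP => i; rewrite ffunE xc.
Qed.

Lemma measurable_grid_fiber m c : measurable [set x : T | grid m x = c].
Proof.
rewrite grid_fiber; apply: (@measurable_box (fun i => [set y | cell m y = c i])) => i.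
exact: measurable_cell.
Qed.

Lemma measurable_grid m (G : pred {ffun 'I_n -> 'I_(2 ^ m).-1.+1}) :
  measurable [set x : T | G (grid m x)].
Proof.
rewrite (_ : mkset _ = \bigcup_(c in [set c | G c]) [set x : T | grid m x = c]).
  by apply: fin_bigcup_measurable => // c _; exact: measurable_grid_fiber.
apply/seteqP; split => [x Gx|x [c /= Gc xc]]; last by rewrite /= xc.
by exists (grid m x).
Qed.

Lemma mu_grid_fiber m c : mu [set x | grid m x = c] = (2 ^- m ^+ n)%:E.
Proof.
rewrite grid_fiber (@product_prob_box _ _ _ nu n (fun i => [set y | cell m y = c i])).
  2: by move=> i; exact: measurable_cell.
transitivity (\prod_(i < n) (2 ^- m : R)%:E)%E.
  by apply: eq_bigr => i _; exact: nu_cell.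
by rewrite prodEFin prodr_const card_ord.
Qed.

Lemma integral_grid m (F : {ffun 'I_n -> 'I_(2 ^ m).-1.+1} -> R) : (forall c, 0 <= F c) ->
  (\int[mu]_x (F (grid m x))%:E = (mean F)%:E)%E.
Proof.
move=> F0.
under eq_integral => x _.
  rewrite (_ : (F (grid m x))%:E = \sum_c (F c * \1_[set x : T | grid m x = c] x)%:E)%E; last first.
    rewrite (bigD1 (grid m x))//= big1 ?adde0.
      by rewrite indicE mem_set// mulr1.
    by move=> c cx; rewrite indicE memNset ?mulr0// => /= /esym/eqP; rewrite (negbTE cx).
  over.
have mI c : measurable_fun [set: T] (fun x => (F c * \1_[set x : T | grid m x = c] x)%:E).
  apply/measurable_EFinP; apply: measurable_funM => //.
  by apply: measurable_indic; exact: measurable_grid_fiber.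
rewrite ge0_integral_sum//=; last first.
  by move=> c x _; rewrite lee_fin mulr_ge0.
rewrite /mean mulr_suml -sumEFin; apply: eq_bigr => c _.
under eq_integral do rewrite EFinM.
rewrite ge0_integralZl//=; last 2 first.
- by apply/measurable_EFinP; apply: measurable_indic; exact: measurable_grid_fiber.
- by rewrite lee_fin.
rewrite integral_indic//; last exact: measurable_grid_fiber.
rewrite setIT [X in (_ * X)%E](mu_grid_fiber c) -EFinM; congr (_ * _)%:E.
by rewrite card_ffun !card_ord dyadic_size !natrX exprVn.
Qed.

Lemma mu_grid m (G : pred {ffun 'I_n -> 'I_(2 ^ m).-1.+1}) :
  mu [set x | G (grid m x)] = (mean (charfun G : _ -> R))%:E.
Proof.
rewrite -integral_grid; last by move=> c; exact: ler0n.
rewrite -(setIT [set x | G (grid m x)]) -integral_indic//; last exact: measurable_grid.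
apply: eq_integral => x _; rewrite indicE /charfun; congr (_%:R%:E).
by case: (boolP (G _)) => Gx; [rewrite mem_set|rewrite memNset//; apply/negP].
Qed.

(** Makes the fiber a section of a measurable subset of [T * R], so that fiber measures are
    measurable and Fubini applies. *)
Definition resample i (p : T * measurableTypeR R) : T :=
  [tuple if j == i then p.2 else tnth p.1 j | j < n].

Lemma measurable_resample i : measurable_fun [set: T * measurableTypeR R] (resample i).
Proof.
apply/measurable_fun_tnthP => j.
have [->|ji] := eqVneq j i.
  rewrite (_ : _ \o _ = snd); first exact: measurable_snd.
  by apply/funext => p; rewrite /= tnth_mktuple eqxx.
rewrite (_ : _ \o _ = (@tnth n (measurableTypeR R) ^~ j) \o fst).
  by apply: measurableT_comp; [exact: measurable_tnth|exact: measurable_fst].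
by apply/funext => p; rewrite /= tnth_mktuple (negbTE ji).
Qed.

HB.instance Definition _ i := isMeasurableFun.Build _ _ _ _
  (resample i) (measurable_resample i).

Lemma fiberE A x i : fiber A x i = xsection (resample i @^-1` A) x.
Proof. by apply/seteqP; split => y; rewrite /xsection/= ?inE. Qed.

Lemma measurable_resample_preimage A i : measurable A ->
  measurable (resample i @^-1` A).
Proof. by move=> mA; rewrite -[X in measurable X]setTI; exact: measurable_resample. Qed.

Lemma measurable_fiber A x i : measurable A ->
  measurable (fiber A x i : set (measurableTypeR R)).
Proof.
by move=> mA; rewrite fiberE; apply: measurable_xsection; exact: measurable_resample_preimage.
Qed.

Lemma measurable_fun_nu_fiber A i : measurable A ->
  measurable_fun [set: T] (fun x => nu (fiber A x i)).
Proof.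
move=> mA; rewrite (_ : (fun x => _) = nu \o xsection (resample i @^-1` A)).
  by apply: measurable_fun_xsection; exact: measurable_resample_preimage.
by apply/funext => x; rewrite fiberE.
Qed.

Definition boxes : set (set T) :=
  [set U | exists2 S : 'I_n -> set (measurableTypeR R), (forall i, measurable (S i)) &
     U = [set x : T | forall i, S i (tnth x i)]].

Lemma measurable_boxes : measurable = <<s boxes >>.
Proof.
apply/seteqP; split.
  apply: smallest_sub; first exact: smallest_sigma_algebra.
  move=> U; rewrite -bigcup_seq => -[i /= _ [S mS <-]].
  apply: sub_sigma_algebra; exists (fun j => if j == i then S else setT).
    by move=> j; case: ifP.
  apply/seteqP; split => x /=.
    by move=> [_ Sx] j; case: eqP => // ->.
  by move=> /(_ i); rewrite eqxx.
apply: smallest_sub; first exact: sigma_algebra_measurable.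
by move=> _ [S mS ->]; exact: measurable_box.
Qed.

(** Resampling a coordinate preserves [mu]: on a box the factor [nu (S i)] comes from the new
    coordinate, and boxes form a generating pi-system. *)
Lemma mu_resample A i : measurable A -> (mu \x nu)%E (resample i @^-1` A) = mu A.
Proof.
move=> mA.
rewrite -[LHS]/(pushforward (mu \x nu)%E (resample i) A).
apply: (@measure_unique _ R T boxes (fun=> setT) measurable_boxes) => //.
- move=> _ _ [S mS ->] [S' mS' ->]; exists (fun j => S j `&` S' j).
    by move=> j; exact: measurableI.
  by apply/seteqP; split => x /= => [[Sx S'x] j|SS']; split => // j; have [] := SS' j.
- by move=> _; exists (fun=> setT) => //; apply/seteqP; split.
- by apply/seteqP; split => // x _; exists 0%N.
- move=> _ [S mS ->]; rewrite [RHS](product_prob_box nu mS) /= /pushforward.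
  pose S' j := if j == i then setT else S j.
  have mS' j : measurable (S' j) by rewrite /S'; case: ifP.
  rewrite (_ : _ @^-1` _ = [set x : T | forall j, S' j (tnth x j)] `*` S i).
    rewrite product_measure1E//; last exact: measurable_box.
    rewrite [X in (X * _)%E](product_prob_box nu mS').
    rewrite (bigD1 i)//= {1}/S' eqxx [X in (X * _ * _)%E]probability_setT mul1e muleC.
    rewrite [RHS](bigD1 i)//=; congr (_ * _)%E.
    by apply: eq_bigr => j /negbTE ji; rewrite /S' ji.
  apply/seteqP; split => -[x y] /=.
    move=> H; split=> [j|]; last by have := H i; rewrite tnth_mktuple eqxx.
    by have := H j; rewrite tnth_mktuple /S'; case: ifP.
  by move=> [H Sy] j; rewrite tnth_mktuple; have := H j; rewrite /S'; case: eqP => // ->.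
- by move=> _; rewrite /= /pushforward preimage_setT -setXTT product_measure1E//
    [X in (X * _)%E]probability_setT [X in (_ * X)%E]probability_setT mule1 ltry.
Qed.

Lemma integral_nu_fiber A i : measurable A ->
  (\int[mu]_x nu (fiber A x i) = mu A)%E.
Proof.
move=> mA; rewrite -(mu_resample i mA); apply: eq_integral => x _.
by rewrite fiberE.
Qed.

Definition fiber_prob A i (x : T) : R := fine (nu (fiber A x i)).

Lemma fiber_probE A x i : measurable A -> nu (fiber A x i) = (fiber_prob A i x)%:E.
Proof. by move=> mA; rewrite fineK// fin_num_measure//; exact: measurable_fiber. Qed.

Lemma fiber_prob01 A i x : measurable A -> 0 <= fiber_prob A i x <= 1.
Proof.
move=> mA; rewrite -!lee_fin -fiber_probE// measure_ge0/= probability_le1//.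
exact: measurable_fiber.
Qed.

Lemma measurable_fiber_prob A i : measurable A -> measurable_fun [set: T] (fiber_prob A i).
Proof.
move=> mA; apply/measurable_EFinP.
rewrite (_ : EFin \o _ = fun x => nu (fiber A x i)); first exact: measurable_fun_nu_fiber.
by apply/funext => x; rewrite fiber_probE.
Qed.

Lemma fiber_prob_setC A i x : measurable A -> fiber_prob (~` A) i x = 1 - fiber_prob A i x.
Proof.
move=> mA; apply/EFin_inj; rewrite EFinB -!fiber_probE//; last exact: measurableC.
rewrite (_ : fiber (~` A) x i = ~` fiber A x i)// probability_setC//.
exact: measurable_fiber.
Qed.

Lemma fiber_prob_dist A B i x : measurable A -> measurable B ->
  `|fiber_prob A i x - fiber_prob B i x| <= fiber_prob (A `+` B) i x.
Proof.
move=> mA mB.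
have mD (U V : set T) : measurable U -> measurable V -> measurable (U `+` V).
  by move=> mU mV; apply: measurableU; exact: measurableD.
suff H U V : measurable U -> measurable V ->
    fiber_prob U i x <= fiber_prob V i x + fiber_prob (U `+` V) i x.
  rewrite ler_norml; have := H _ _ mA mB; have := H _ _ mB mA.
  by rewrite (setYC B); lra.
move=> mU mV; rewrite -lee_fin EFinD -!fiber_probE//; last exact: mD.
apply: (le_trans _ (measureU2 _ _ _)); rewrite ?inE//; try exact: measurable_fiber.
  apply: le_measure; rewrite ?inE; [exact: measurable_fiber| |].
    by apply: measurableU; apply: measurable_fiber => //; exact: mD.
  move=> y Uy; have [Vy|nVy] := pselect (fiber V x i y); [by left|right].
  by left.
by apply: measurable_fiber; exact: mD.
Qed.

Definition dyadic_sum (K : nat) (p : R) : R := \sum_(1 <= k < K.+1) dyadic_trunc k p.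

Lemma dyadic_sum_ge0 K p : 0 <= p <= 1 -> 0 <= dyadic_sum K p.
Proof. by move=> p01; apply: sumr_ge0 => k _; exact: dyadic_trunc_ge0. Qed.

Lemma dyadic_sum_lipschitz K p q : dyadic_sum K p <= dyadic_sum K q + K%:R * `|p - q|.
Proof.
rewrite (_ : K%:R * _ = \sum_(1 <= k < K.+1) `|p - q|).
  by rewrite -big_split/=; apply: ler_sum => k _; exact: dyadic_trunc_lipschitz.
by rewrite big_const_nat iter_addr_0 subSS subn0 mulr_natl.
Qed.

Lemma dyadic_sumC K p : dyadic_sum K (1 - p) = dyadic_sum K p.
Proof.
apply: eq_bigr => k _; rewrite /dyadic_trunc; congr Num.min.
by rewrite minC; congr Num.min; ring.
Qed.

Lemma measurable_dyadic_sum K : measurable_fun [set: R] (dyadic_sum K).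
Proof.
apply: measurable_sum => k; rewrite /dyadic_trunc.
apply: measurable_minr => //; apply: measurable_minr => //.
exact: measurable_funB.
Qed.

Lemma measurable_dyadic_sum_fiber K A i : measurable A ->
  measurable_fun [set: T] (fun x => (dyadic_sum K (fiber_prob A i x))%:E).
Proof.
move=> mA; apply/measurable_EFinP.
apply: (measurableT_comp (measurable_dyadic_sum K)).
exact: measurable_fiber_prob.
Qed.

(** The stability that influences lack: fiber measures of [A] and [B] differ by at most the fiber
    measure of the symmetric difference, whose mean is its full measure. *)
Lemma integral_dyadic_sum_dist K A B i : measurable A -> measurable B ->
  (\int[mu]_x (dyadic_sum K (fiber_prob A i x))%:E <=
   \int[mu]_x (dyadic_sum K (fiber_prob B i x))%:E + K%:R%:E * mu (A `+` B))%E.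
Proof.
move=> mA mB.
have mAB : measurable (A `+` B) by apply: measurableU; exact: measurableD.
have ds0 U x : measurable U -> (0 <= (dyadic_sum K (fiber_prob U i x))%:E)%E.
  by move=> mU; rewrite lee_fin dyadic_sum_ge0// fiber_prob01.
rewrite -(integral_nu_fiber i mAB) -ge0_integralZl//; last exact: measurable_fun_nu_fiber.
rewrite -ge0_integralD//; first last.
- by apply: measurable_funeM; exact: measurable_fun_nu_fiber.
- by move=> x _; rewrite mule_ge0// lee_fin.
- exact: measurable_dyadic_sum_fiber.
- by move=> x _; exact: ds0.
apply: le_ge0_integral => x; first exact: ds0.
rewrite fiber_probE// -EFinM -EFinD lee_fin.
apply: (le_trans (dyadic_sum_lipschitz K _ (fiber_prob B i x))).
by rewrite lerD2l ler_wpM2l// fiber_prob_dist.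
Qed.

Lemma integral_dyadic_sum_influence K A i : measurable A -> (0 < K)%N ->
  (\int[mu]_x (dyadic_sum K (fiber_prob A i x))%:E <=
   (2 / @content_const R * Num.sqrt K%:R)%:E * geometric_influence nu A i)%E.
Proof.
move=> mA K0; set c := _ * Num.sqrt _.
have c0 : 0 < c.
  by rewrite mulr_gt0 ?sqrtr_gt0 ?ltr0n// divr_gt0// content_const_gt0.
have ds0 x : 0 <= dyadic_sum K (fiber_prob A i x).
  by rewrite dyadic_sum_ge0// fiber_prob01.
(* The constant is moved to the measurable integrand, so that the content enters only through
   monotonicity of the integral. *)
rewrite (_ : (\int[mu]_x _)%E =
    (c%:E * \int[mu]_x (c^-1%:E * (dyadic_sum K (fiber_prob A i x))%:E))%E).
  rewrite lee_pmul2l ?fin_numE// ?lte_fin//; apply: le_ge0_integral => x.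
    by rewrite -EFinM lee_fin mulr_ge0// invr_ge0 ltW.
  rewrite lee_pdivrMl//.
  by apply: dyadic_trunc_content => //; exact: measurable_fiber.
rewrite ge0_integralZl//; first last.
- by rewrite lee_fin invr_ge0 ltW.
- by move=> x _; rewrite lee_fin.
- exact: measurable_dyadic_sum_fiber.
by rewrite muleA -EFinM divff ?gt_eqF// mul1e.
Qed.

Lemma nu_bigsetU_cell m (P : pred 'I_(2 ^ m).-1.+1) :
  nu (\big[setU/set0]_(k | P k) ([set y | cell m y = k] : set (measurableTypeR R))) =
  (\sum_(k | P k) (2 ^- m)%:E)%E.
Proof.
elim: (index_enum _) (index_enum_uniq 'I_(2 ^ m).-1.+1) => [_|k s IHs /= /andP[ks us]].
  by rewrite !big_nil measure0.
rewrite !big_cons; case: ifP => Pk; last exact: IHs.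
rewrite measureU; first by congr (_ + _)%E; [exact: nu_cell|exact: IHs].
- exact: measurable_cell.
- by apply: bigsetU_measurable => k' _; exact: measurable_cell.
- rewrite -subset0 => y [/= yk]; rewrite -bigcup_seq_cond => -[k' /= /andP[k's _]].
  by rewrite yk => kk'; move: ks; rewrite kk' k's.
Qed.

Lemma fiber_prob_grid m (G : pred {ffun 'I_n -> 'I_(2 ^ m).-1.+1}) i x :
  fiber_prob [set x | G (grid m x)] i x = avg i (charfun G) (grid m x).
Proof.
rewrite avg_charfunE; apply/EFin_inj; rewrite -fiber_probE; last exact: measurable_grid.
have E y : grid m [tuple if j == i then y else tnth x j | j < n] =
           upd (grid m x) i (cell m y).
  by apply/ffunP => j; rewrite !ffunE tnth_mktuple; case: eqP => // _; rewrite ffunE.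
rewrite (_ : fiber _ x i = \big[setU/set0]_(k | G (upd (grid m x) i k))
    ([set y | cell m y = k] : set (measurableTypeR R))); last first.
  rewrite -bigcup_seq_cond; apply/seteqP; split => y.
    rewrite /fiber/= E => Gy; exists (cell m y) => //=.
    by rewrite mem_index_enum.
  by move=> [k /= /andP[_ Gk] yk]; rewrite /fiber/= E yk.
rewrite nu_bigsetU_cell sumEFin /fiber_count natr_sum big_mkcond/= mulr_suml; congr EFin.
have e : (2 ^ m).-1.+1%:R = 2 ^+ m :> R by rewrite dyadic_size natrX.
apply: eq_bigr => k _; rewrite e.
by case: (G _); rewrite ?mul1r ?mul0r.
Qed.

Lemma integral_dyadic_sum_grid m (G : pred {ffun 'I_n -> 'I_(2 ^ m).-1.+1}) K i :
  (\int[mu]_x (dyadic_sum K (fiber_prob [set x | G (grid m x)] i x))%:E =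
   (\sum_(1 <= k < K.+1) mean (fun c => dyadic_trunc k (avg i (charfun G) c)))%:E)%E.
Proof.
rewrite -mean_sum -integral_grid.
  by apply: eq_integral => x _; rewrite fiber_prob_grid.
by move=> c; rewrite dyadic_sum_ge0// avg_charfun01.
Qed.

Lemma measurable_setY A B : measurable A -> measurable B -> measurable (A `+` B).
Proof. by move=> mA mB; apply: measurableU; exact: measurableD. Qed.

Lemma mu_setY_triangle A B C : measurable A -> measurable B -> measurable C ->
  (mu (A `+` C) <= mu (A `+` B) + mu (B `+` C))%E.
Proof.
move=> mA mB mC; apply: (le_trans _ (measureU2 _ _ _)); try exact: measurable_setY.
apply: le_measure; rewrite ?inE; [exact: measurable_setY|
  by apply: measurableU; exact: measurable_setY|].
move=> x [[Ax Cx]|[Cx Ax]]; have [Bx|Bx] := pselect (B x).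
- by right; left.
- by left; left.
- by left; right.
- by right; right.
Qed.

Lemma mu_setY_setU A B C D : measurable A -> measurable B -> measurable C -> measurable D ->
  (mu ((A `|` B) `+` (C `|` D)) <= mu (A `+` C) + mu (B `+` D))%E.
Proof.
move=> mA mB mC mD; apply: (le_trans _ (measureU2 _ _ _)); try exact: measurable_setY.
apply: le_measure; rewrite ?inE.
- by apply: measurable_setY; exact: measurableU.
- by apply: measurableU; exact: measurable_setY.
move=> x [[[Ax|Bx] /not_orP[Cx Dx]]|[[Cx|Dx] /not_orP[Ax Bx]]].
- by left; left.
- by right; left.
- by left; right.
- by right; right.
Qed.

Lemma setY_setC A B : ~` A `+` ~` B = A `+` B.
Proof.
apply/seteqP; split => x [[Ax Bx]|[Bx Ax]].
- by right; split => //; exact: contrapT.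
- by left; split => //; exact: contrapT.
- by right; split => //; exact.
- by left; split => //; exact.
Qed.

Lemma mean_coord m i (k : 'I_(2 ^ m).-1.+1) :
  mean (charfun (fun c : {ffun 'I_n -> 'I_(2 ^ m).-1.+1} => c i == k) : _ -> R) = 2 ^- m.
Proof.
have N0 : (0 < #|'I_(2 ^ m).-1.+1|)%N by rewrite card_ord.
rewrite -(mean_avg N0 i) -[RHS](@mean_cst R 'I_(2 ^ m).-1.+1 n)//.
congr mean; apply/funext => c; rewrite avg_charfunE /fiber_count.
have e : (2 ^ m).-1.+1%:R = 2 ^+ m :> R by rewrite dyadic_size natrX.
rewrite e; under eq_bigr do rewrite updE.
by rewrite (bigD1 k)//= eqxx big1 ?mul1r// => y /negbTE ->.
Qed.

Lemma grid_refine m m' (G : pred {ffun 'I_n -> 'I_(2 ^ m).-1.+1}) : (m <= m')%N ->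
  exists G' : pred {ffun 'I_n -> 'I_(2 ^ m').-1.+1},
    [set x : T | G (grid m x)] = [set x : T | G' (grid m' x)].
Proof.
move=> mm'; exists (fun c : {ffun 'I_n -> 'I_(2 ^ m').-1.+1} =>
  G [ffun i => inord (c i %/ 2 ^ (m' - m))]).
suff H x : grid m x = [ffun i => inord (grid m' x i %/ 2 ^ (m' - m))].
  by apply/seteqP; split => x /=; rewrite -H.
by apply/ffunP => i; rewrite !ffunE -cell_div// inord_val.
Qed.

Definition grid_approx A := forall e : R, 0 < e ->
  exists m (G : pred {ffun 'I_n -> 'I_(2 ^ m).-1.+1}),
    (mu (A `+` [set x | G (grid m x)]) <= e%:E)%E.

Lemma grid_approxC A : grid_approx A -> grid_approx (~` A).
Proof.
move=> aA e e0; have [m [G AG]] := aA e e0; exists m, (fun c => ~~ G c).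
rewrite (_ : [set x | ~~ _] = ~` [set x | G (grid m x)]) ?setY_setC//.
by apply/seteqP; split => x /= /negP.
Qed.

Lemma grid_approxU A B : measurable A -> measurable B ->
  grid_approx A -> grid_approx B -> grid_approx (A `|` B).
Proof.
move=> mA mB aA aB e e0; have e20 : 0 < e / 2 by rewrite divr_gt0.
have [m [G AG]] := aA _ e20; have [m' [G' BG']] := aB _ e20.
have [H GH] := grid_refine G (leq_maxl m m').
have [H' GH'] := grid_refine G' (leq_maxr m m').
exists (maxn m m'), (fun c => H c || H' c).
rewrite (_ : [set x | _ || _] = [set x | G (grid m x)] `|` [set x | G' (grid m' x)]); last first.
  by rewrite GH GH'; apply/seteqP; split => x /= /orP.
apply: (le_trans (mu_setY_setU _ _ _ _)) => //; try exact: measurable_grid.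
rewrite (_ : e = e / 2 + e / 2); last by field.
by rewrite EFinD leeD.
Qed.

(** Continuity from below reduces the union to a finite one, with half of the error left for
    approximating that. *)
Lemma grid_approx_bigcup (F : (set T)^nat) : (forall k, measurable (F k)) ->
  (forall k, grid_approx (F k)) -> grid_approx (\bigcup_k F k).
Proof.
move=> mF aF e e0; have e20 : 0 < e / 2 by rewrite divr_gt0.
pose V k := \big[setU/set0]_(j < k.+1) F j.
have mV k : measurable (V k) by apply: bigsetU_measurable.
have aV k : grid_approx (V k).
  rewrite /V; elim: k => [|k IHk]; first by rewrite big_ord_recl big_ord0 setU0.
  by rewrite big_ord_recr/=; apply: grid_approxU => //; exact: bigsetU_measurable.
have UV : \bigcup_k F k = \bigcup_k V k.
  apply/seteqP; split => [x [k _ Fx]|x [k _]]; last first.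
    by rewrite /V -bigcup_mkord => -[j _ Fx]; exists j.
  by exists k => //; rewrite /V -bigcup_mkord; exists k => /=.
have mU : measurable (\bigcup_k V k) by exact: bigcup_measurable.
have Vnd : {homo V : k l / (k <= l)%N >-> (k <= l)%O}.
  move=> k l kl; rewrite subsetEset => x; rewrite /V -!bigcup_mkord => -[j /= jk Fx].
  by exists j => //=; rewrite (leq_trans jk).
have muU : mu (\bigcup_k V k) \is a fin_num by rewrite fin_num_measure.
have : (mu \o V) k @[k --> \oo] --> (fine (mu (\bigcup_k V k)))%:E.
  by rewrite fineK//; exact: nondecreasing_cvg_mu.
move=> /fine_cvgP[_ /cvgrPdist_le/(_ _ e20)[k _ /(_ k (leqnn _))]] /=.
move=> Vk.
have [m [G VG]] := aV k _ e20; exists m, G.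
apply: (le_trans (mu_setY_triangle _ (mV k) _)) => //; [by rewrite UV|exact: measurable_grid|].
rewrite (_ : e = e / 2 + e / 2); last by field.
rewrite EFinD leeD//.
have VU : V k `<=` \bigcup_k V k by move=> x Vx; exists k.
rewrite UV (_ : _ `+` _ = \bigcup_k V k `\` V k); last first.
  by apply/seteqP; split => x; [move=> [|[/VU]]|left].
rewrite measureD//; last by rewrite ltey_eq muU.
rewrite setIidr//.
have : mu (\bigcup_k V k) = (fine (mu (\bigcup_k V k)))%:E by rewrite fineK.
have : mu (V k) = (fine (mu (V k)))%:E by rewrite fineK// fin_num_measure.
move=> h1 h2; rewrite [X in (X - _)%E]h2 [X in (_ - X)%E]h1 -EFinB lee_fin.
by apply: le_trans Vk; exact: ler_norm.
Qed.

(** The good sets form a sigma-algebra containing the rays: []z, +oo[] is approximated by the cells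
    above that of [z], with an error inside this single cell, of measure [2 ^- m]. *)
Lemma grid_approx_coord i (S : set (measurableTypeR R)) : measurable S ->
  grid_approx [set x | S (tnth x i)].
Proof.
pose D := [set S : set (measurableTypeR R) | measurable S /\ grid_approx [set x | S (tnth x i)]].
have mp (S' : set (measurableTypeR R)) : measurable S' -> measurable [set x : T | S' (tnth x i)].
  by move=> mS'; rewrite -[X in measurable X]setTI; exact: measurable_tnth.
suff DS : @measurable _ (measurableTypeR R) `<=` D by move=> /DS[].
have -> : @measurable _ (measurableTypeR R) = <<s @RGenOInfty.G R >>.
  exact: RGenOInfty.measurableE.
apply: smallest_sub; last first.
  move=> _ [z ->]; split; first exact: measurable_itv.
  move=> e /exists_pow2_lt[m me]; exists m.
  exists (fun c : {ffun 'I_n -> 'I_(2 ^ m).-1.+1} => (cell m z < c i)%N).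
  apply: (@le_trans _ _ (mu [set x | (fun c : {ffun _ -> _} => c i == cell m z) (grid m x)])).
    apply: le_measure; rewrite ?inE.
    - by apply: measurable_setY; [apply: (mp `]z, +oo[%classic); exact: measurable_itv|
        exact: (measurable_grid (fun c : {ffun _ -> _} => (cell m z < c i)%N))].
    - exact: (measurable_grid (fun c : {ffun _ -> _} => c i == cell m z)).
    move=> x [[/=]|[/=]]; rewrite in_itv/= andbT ffunE.
      move=> /ltW/(le_cell m) + /negP; rewrite -leqNgt => zx xz.
      by apply/eqP/val_inj/eqP; rewrite eqn_leq xz zx.
    move=> zx /negP; rewrite -leNgt => /(le_cell m).
    by rewrite leqNgt zx.
  by rewrite (mu_grid (fun c : {ffun _ -> _} => c i == cell m z)) mean_coord lee_fin ltW.
split.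
- split; first exact: measurable0.
  move=> e e0; exists 0%N, (fun=> false).
  rewrite (_ : _ `+` _ = set0) ?measure0 ?lee_fin ?(ltW e0)//.
  by apply/seteqP; split => x // [[]|[]].
- move=> S' [mS' aS']; rewrite setTD; split; first exact: measurableC.
  exact: grid_approxC.
- move=> F DF; split; first by apply: bigcup_measurable => k _; have [] := DF k.
  rewrite (_ : [set x | _] = \bigcup_k [set x | F k (tnth x i)])//.
  apply: grid_approx_bigcup => k; have [mFk aFk] := DF k => //.
  exact: mp.
Qed.

Lemma measurable_grid_approx A : measurable A -> grid_approx A.
Proof.
suff DA : @measurable _ T `<=` [set A | measurable A /\ grid_approx A] by move=> /DA[].
apply: smallest_sub.
- split.
  + split; first exact: measurable0.
    move=> e e0; exists 0%N, (fun=> false).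
    rewrite (_ : _ `+` _ = set0) ?measure0 ?lee_fin ?(ltW e0)//.
    by apply/seteqP; split => x // [[]|[]].
  + move=> B [mB aB]; rewrite setTD; split; first exact: measurableC.
    exact: grid_approxC.
  + move=> F DF; split; first by apply: bigcup_measurable => k _; have [] := DF k.
    by apply: grid_approx_bigcup => k; have [] := DF k.
- move=> U; rewrite -bigcup_seq => -[i /= _ [S mS <-]]; rewrite setTI.
  split; last exact: grid_approx_coord.
  by rewrite -[X in measurable X]setTI; exact: measurable_tnth.
Qed.

(** * Inner approximation of increasing sets *)

Section monotone_grid.
Context (A : set T) (mA : measurable A) (Aup : increasing_set A) (m : nat).
Notation X := {ffun 'I_n -> 'I_(2 ^ m).-1.+1}.

(** [grid_approx] promises no monotonicity, whereas the cells contained in an increasing set form an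
    increasing set. *)
Definition inner_grid (c : X) : bool := `[< forall x, grid m x = c -> A x >].
Definition outer_grid (c : X) : bool := `[< exists2 x, grid m x = c & A x >].

Lemma cell_lt_le y z : (cell m y < cell m z)%N -> (y : R) <= z.
Proof.
by move=> yz; rewrite leNgt; apply/negP => /ltW/(le_cell m); rewrite leqNgt yz.
Qed.

Lemma inner_grid_increasing : coord_increasing inner_grid.
Proof.
move=> j c a b; rewrite leq_eqVlt => /predU1P[/val_inj->//|ab] /asboolP Ga.
apply/asboolP => x xb; have [y0 y0a] := @cell_surj R m a.
pose x' : T := [tuple if i == j then y0 else tnth x i | i < n].
have xE i : cell m (tnth x i) = upd c j b i by rewrite -xb ffunE.
apply: (Aup (x := x')) => [|i].
  apply: Ga; apply/ffunP => i; rewrite ffunE tnth_mktuple.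
  have [->|ij] := eqVneq i j; first by rewrite updE.
  by rewrite xE !upd_neq.
rewrite tnth_mktuple; case: (eqVneq i j) => // ->; apply: cell_lt_le.
by rewrite y0a xE updE.
Qed.

Lemma outer_inner_grid c : outer_grid c -> (forall i, (c i).+1 < (2 ^ m).-1.+1)%N ->
  inner_grid [ffun i => ordS (c i)].
Proof.
move=> /asboolP[x xc Ax] cN; apply/asboolP => x' x'c.
apply: (Aup Ax) => i; apply: cell_lt_le.
have -> : cell m (tnth x i) = c i by rewrite -xc ffunE.
have -> : cell m (tnth x' i) = ordS (c i).
  by have := congr1 (fun f : X => f i) x'c; rewrite !ffunE.
by rewrite /= modn_small.
Qed.

(** Every point of the cell shifted by one in all coordinates dominates the original cell, so a cell
    meeting [A] shifts into one inside [A]. The cyclic [ordS] makes the shift a bijection; it wraps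
    around only where some coordinate is maximal, a set of measure at most [n%:R * 2 ^- m]. *)
Lemma mean_outer_grid : mean (charfun outer_grid : _ -> R) <=
  mean (charfun inner_grid : _ -> R) + n%:R * 2 ^- m.
Proof.
have -> : n%:R * 2 ^- m = \sum_(i < n) mean (charfun (fun c : X => c i == ord_max) : _ -> R).
  under eq_bigr do rewrite mean_coord.
  by rewrite sumr_const card_ord mulr_natl.
rewrite -mean_sum.
pose sh (c : X) : X := [ffun i => ordS (c i)].
have shI : injective sh.
  move=> c c' /ffunP cc'; apply/ffunP => i; have := cc' i; rewrite !ffunE.
  exact: ordS_inj.
have -> : mean (charfun inner_grid : _ -> R) = mean (fun c => charfun inner_grid (sh c) : R).
  by congr (_ / _); rewrite (reindex_inj shI).
rewrite -meanD; apply: le_mean => c.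
have S0 : 0 <= \sum_(i < n) charfun (fun c : X => c i == ord_max) c :> R.
  by apply: sumr_ge0 => i _; exact: ler0n.
case: (boolP (outer_grid c)) => oc; rewrite /charfun ?oc; last first.
  by rewrite (negbTE oc) addr_ge0.
have [[i ci]|nc] := pselect (exists i, c i = ord_max).
  rewrite (bigD1 i)//= ci eqxx/= addrCA lerDl addr_ge0//; apply: sumr_ge0 => j _.
  exact: ler0n.
rewrite (@outer_inner_grid c)//= ?lerDl// => i; rewrite ltn_neqAle ltn_ord andbT.
by apply/eqP => -[ci]; apply: nc; exists i; exact/val_inj.
Qed.

Lemma mu_inner_grid : (mu (A `+` [set x | inner_grid (grid m x)]) <= (n%:R * 2 ^- m)%:E)%E.
Proof.
have IA : [set x | inner_grid (grid m x)] `<=` A by move=> x /asboolP; exact.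
apply: (@le_trans _ _ (mu [set x | (fun c => outer_grid c && ~~ inner_grid c) (grid m x)])).
  apply: le_measure; rewrite ?inE.
  - by apply: measurable_setY => //; exact: measurable_grid.
  - exact: (measurable_grid (fun c => outer_grid c && ~~ inner_grid c)).
  move=> x [[Ax /negP Ix]|[/IA//]] /=; rewrite Ix andbT.
  by apply/asboolP; exists x.
rewrite (mu_grid (fun c => outer_grid c && ~~ inner_grid c)) lee_fin.
have -> : mean (charfun (fun c => outer_grid c && ~~ inner_grid c) : _ -> R) =
    mean (charfun outer_grid : _ -> R) - mean (charfun inner_grid : _ -> R).
  rewrite -meanB; congr mean; apply/funext => c; rewrite /charfun.
  case: (boolP (inner_grid c)) => Ic; rewrite ?andbT ?andbF; last by rewrite subr0.
  suff -> : outer_grid c by rewrite subrr.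
  have [y yc] : exists y : 'I_n -> R, forall i, cell m (y i) = c i.
    by have [y yc] := choice (fun i => @cell_surj R m (c i)); exists y.
  have gc : grid m [tuple y i | i < n] = c.
    by apply/ffunP => i; rewrite ffunE tnth_mktuple.
  by apply/asboolP; exists [tuple y i | i < n] => //; move/asboolP: Ic; exact.
by rewrite lerBlDl mean_outer_grid.
Qed.

End monotone_grid.

End product_gaussian.

(** * Gaussian influences *)

Section gaussian_influences.
Context {R : realType}.
Notation nu := (std_gaussian R).
Implicit Types (a e : R) (k m n K : nat).

Definition content_bound : R := 2 / content_const.

Lemma content_bound_ge16 : 16 <= content_bound.
Proof.
rewrite /content_bound ler_pdivlMr ?content_const_gt0//.
by have := @content_const_le R; lra.
Qed.

Lemma content_bound_gt0 : 0 < content_bound.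
Proof. by rewrite (lt_le_trans _ content_bound_ge16). Qed.

Notation C := content_bound.

(** 52 is 48 + 4: [2 ^- K < 8 * C * a] turns [6 * 2 ^- K] into at most [48 * C * a], to which
    [4 * C * a] is added. The root comes from [- ln a <= (2 + ln (4 * C)) * K]. *)
Definition talagrand_const : R := 52 * C * Num.sqrt (2 + ln (4 * C)).

Lemma ln4C_ge0 : 0 <= ln (4 * C).
Proof. by apply: ln_ge0; have := content_bound_ge16; lra. Qed.

Lemma talagrand_const_gt0 : 0 < talagrand_const.
Proof.
have C_gt0 := content_bound_gt0.
have C52 : 0 < 52 * C by rewrite mulr_gt0.
rewrite /talagrand_const mulr_gt0// sqrtr_gt0.
by have := ln4C_ge0; lra.
Qed.

(** Below it [4 * C * a <= 2^-1], so that this number has a dyadic order [K >= 1]. *)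
Definition small_influence : R := (8 * C)^-1.

Lemma small_influence_bounds : 0 < small_influence < 1.
Proof.
have C16 := content_bound_ge16; have C_gt0 := content_bound_gt0.
rewrite invr_gt0 mulr_gt0//= invf_lt1; first by lra.
by rewrite mulr_gt0.
Qed.

(** [K] is the dyadic order of [4 * C * a], hence comparable to [- ln a]. The slack [e] serves
    [a = 0], where [K] is merely taken large. *)
Lemma talagrand_level a e : 0 <= a < small_influence -> 0 < e ->
  exists K, [/\ (0 < K)%N, 4 * C * a <= 2 ^- K &
    6 * 2 ^- K / K%:R + 4 * C * a / Num.sqrt K%:R <=
    talagrand_const * (a / Num.sqrt (- ln a)) + e].
Proof.
have C16 := content_bound_ge16; have C_gt0 := content_bound_gt0.
move=> /andP[]; rewrite le_eqVlt => /predU1P[<- _ e0|a0 asmall e0].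
  have [|K Ke] := @exists_pow2_lt R (e / 6); first by rewrite divr_gt0.
  exists K.+1; split => //; first by rewrite mulr0 invr_ge0 exprn_ge0.
  rewrite !mulr0 !mul0r mulr0 addr0 add0r ler_pdivrMr ?ltr0n//.
  have KK : 2 ^- K.+1 <= 2 ^- K :> R.
    by rewrite lef_pV2 ?posrE ?exprn_gt0// ler_eXn2l ?ltr1n.
  have K1 : 1 <= K.+1%:R :> R by rewrite ler1n.
  apply: (@le_trans _ _ (e * 1)); first by lra.
  by rewrite ler_pM2l.
have C4_gt0 : 0 < 4 * C by rewrite mulr_gt0.
have q0 : 0 < 4 * C * a by rewrite mulr_gt0// mulr_gt0.
have q2 : 4 * C * a <= 2^-1.
  move: asmall; rewrite /small_influence -[X in a < X]mul1r ltr_pdivlMr; last by rewrite mulr_gt0.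
  by move=> h; lra.
have [K K0 /andP[Kq qK]] := exists_dyadic q0 q2.
exists K; split => //.
have KR : 1 <= K%:R :> R by rewrite ler1n.
have sK0 : 0 < Num.sqrt K%:R :> R by rewrite sqrtr_gt0 ltr0n.
have sKK : Num.sqrt K%:R <= K%:R :> R.
  rewrite -[leRHS]sqr_sqrtr// expr2 ler_peMl ?(ltW sK0)//.
  by rewrite -[leLHS]sqrtr1 ler_wsqrtr.
have a1 : a < 1 by have /andP[_] := small_influence_bounds; exact: lt_trans.
have lna0 : 0 < - ln a by rewrite oppr_gt0 ln_lt0// a0.
have sln : 0 < Num.sqrt (- ln a) by rewrite sqrtr_gt0.
have lnaK : - ln a <= (2 + ln (4 * C)) * K%:R.
  have lnq : ln (2 ^- K.+1) <= ln (4 * C * a).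
    by rewrite ler_ln ?posrE ?invr_gt0 ?exprn_gt0// ltW.
  move: lnq; rewrite lnV ?posrE ?exprn_gt0// lnXn// lnM ?posrE// => lnq.
  have /andP[_ ln2] := @ln2_bounds R.
  have lnK : ln 2 *+ K.+1 <= K.+1%:R :> R by rewrite -[ln 2 *+ _]mulr_natl ler_piMr.
  have lnCK : ln (4 * C) <= ln (4 * C) * K%:R by rewrite ler_peMr// ln4C_ge0.
  have K1E : K.+1%:R = K%:R + 1 :> R by rewrite natr1.
  by move: lnK; rewrite K1E; lra.
have ssK : Num.sqrt (- ln a) <= Num.sqrt (2 + ln (4 * C)) * Num.sqrt K%:R.
  rewrite -sqrtrM; first by rewrite ler_wsqrtr.
  by have := ln4C_ge0; lra.
have powK : 2 ^- K < 8 * C * a.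
  have : 2 ^- K = 2 * 2 ^- K.+1 :> R by rewrite exprS invfM mulrA divff// mul1r.
  by move=> ->; lra.
apply: (@le_trans _ _ (52 * C * a / Num.sqrt K%:R)).
  have : 6 * 2 ^- K / K%:R <= 48 * C * a / Num.sqrt K%:R.
    apply: ler_pM; rewrite ?mulr_ge0 ?invr_ge0 ?exprn_ge0//; first by lra.
    by rewrite lef_pV2 ?posrE// ltr0n.
  move=> h; rewrite (_ : 52 * C * a / _ =
    48 * C * a / Num.sqrt K%:R + 4 * C * a / Num.sqrt K%:R); [lra|ring].
rewrite -[leLHS]addr0 lerD ?(ltW e0)// /talagrand_const.
set k := Num.sqrt K%:R in sK0 ssK *; set l := Num.sqrt (- ln a) in sln ssK *.
set w := Num.sqrt _ in ssK *; rewrite ler_pdivrMr//.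
have -> : 52 * C * w * (a / l) * k = 52 * C * a * (w * k / l) by ring.
have C52a : 0 <= 52 * C * a by lra.
by rewrite ler_peMr// ler_pdivlMr// mul1r.
Qed.

Lemma div_sqrt_log_ge0 (x : \bar R) : (0 <= x)%E -> (0 <= div_sqrt_log x)%E.
Proof. by move=> x0; rewrite /div_sqrt_log mule_ge0// inve_ge0 sqrte_ge0. Qed.

Lemma div_sqrt_log_mono a (x : \bar R) : 0 < a < 1 -> (a%:E <= x)%E ->
  ((a / Num.sqrt (- ln a))%:E <= div_sqrt_log x)%E.
Proof.
move=> /andP[a0 a1] ax; have [x1|x1] := leP 1%E x.
  by rewrite div_sqrt_log_ge1// leey.
case: x ax x1 => [x| |]//; rewrite lee_fin lte_fin => ax x1.
have x0 : 0 < x by rewrite (lt_le_trans a0).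
have lnx : 0 < - ln x by rewrite oppr_gt0 ln_lt0// x0.
rewrite div_sqrt_log_EFin ?x0// lee_fin ler_pM ?(ltW a0) ?invr_ge0 ?sqrtr_ge0//.
rewrite lef_pV2 ?posrE ?sqrtr_gt0 ?oppr_gt0 ?ln_lt0 ?a0 ?x0//.
by rewrite ler_wsqrtr// lerN2 ler_ln.
Qed.

Definition peak2 : R := 2 * normal_peak 1.

Lemma peak2_bounds : 0 < peak2 < 1.
Proof.
rewrite /peak2; have := @peak_gt0 R; have := @peak_lt_half R.
by move=> *; apply/andP; split; lra.
Qed.

(** In [C + 1] the 1 pays for the tail [2 ^- K <= a]. Under the root, 4 serves [a <= 2^-1], where
    [K = L.+1 <= 4 * - ln a]; the inverse serves larger [a <= peak2], where [K = 1]. *)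
Definition friedgut_const : R := (C + 1) * Num.sqrt (4 + (- ln peak2)^-1).

Lemma ln_peak2_gt0 : 0 < - ln peak2.
Proof. by rewrite oppr_gt0 ln_lt0// peak2_bounds. Qed.

Lemma friedgut_const_gt0 : 0 < friedgut_const.
Proof.
have C_gt0 := content_bound_gt0.
have C1 : 0 < C + 1 by rewrite ltr_wpDl// ltW.
rewrite /friedgut_const mulr_gt0// sqrtr_gt0.
have : 0 < (- ln peak2)^-1 by rewrite invr_gt0 ln_peak2_gt0.
by lra.
Qed.

Lemma friedgut_level a : 0 < a <= peak2 -> exists K, [/\ (0 < K)%N, 2 ^- K <= a &
  C * Num.sqrt K%:R * a + 2 ^- K <= friedgut_const * (a * Num.sqrt (- ln a))].
Proof.
move=> /andP[a0 ap].
have /andP[p0 p1] := peak2_bounds.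
have lp := ln_peak2_gt0; have C_gt0 := content_bound_gt0.
have a1 : a < 1 by exact: le_lt_trans p1.
have lna0 : 0 < - ln a by rewrite oppr_gt0 ln_lt0// a0.
set beta := 4 + (- ln peak2)^-1.
have ip : 0 < (- ln peak2)^-1 by rewrite invr_gt0.
have beta0 : 0 < beta by rewrite /beta; lra.
suff [K [K0 Ka Kln]] : exists K, [/\ (0 < K)%N, 2 ^- K <= a & K%:R <= beta * - ln a].
  exists K; split => //.
  have K1 : 1 <= Num.sqrt K%:R :> R.
    by rewrite -[leLHS]sqrtr1 ler_wsqrtr// ler1n.
  have sK : Num.sqrt K%:R <= Num.sqrt beta * Num.sqrt (- ln a).
    by rewrite -sqrtrM ?(ltW beta0)// ler_wsqrtr.
  rewrite /friedgut_const -/beta.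
  set k := Num.sqrt K%:R in K1 sK *; set l := Num.sqrt (- ln a) in sK *.
  set w := Num.sqrt beta in sK *.
  have -> : (C + 1) * w * (a * l) = (C + 1) * a * (w * l) by ring.
  have Ca : 0 < (C + 1) * a by rewrite mulr_gt0// ltr_wpDl// ltW.
  apply: (@le_trans _ _ ((C + 1) * a * k)); last by rewrite ler_pM2l.
  have ak : a <= a * k by rewrite ler_peMr// ltW.
  rewrite (_ : (C + 1) * a * k = C * k * a + a * k); last by ring.
  by rewrite lerD2l (le_trans Ka).
have [a2|a2] := leP a 2^-1; last first.
  exists 1%N; split => //; first by rewrite expr1 ltW.
  have lpa : - ln peak2 <= - ln a by rewrite lerN2 ler_ln.
  apply: (@le_trans _ _ ((- ln peak2)^-1 * - ln a)).
    by rewrite mulrC ler_pdivlMr// mul1r.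
  by rewrite ler_wpM2r ?(ltW lna0)// /beta; lra.
have [L L0 /andP[La aL]] := exists_dyadic a0 a2.
exists L.+1; split => //; first exact: ltW.
have lnaL : ln a <= - (ln 2 * L%:R).
  have : ln a <= ln (2 ^- L) by rewrite ler_ln ?posrE ?invr_gt0 ?exprn_gt0.
  by rewrite lnV ?posrE ?exprn_gt0// lnXn// -[ln 2 *+ _]mulr_natr.
have /andP[ln2 _] := @ln2_bounds R.
have L1 : 1 <= L%:R :> R by rewrite ler1n.
have LE : L.+1%:R = L%:R + 1 :> R by rewrite natr1.
have lL : 2^-1 * L%:R <= ln 2 * L%:R :> R by rewrite ler_wpM2r.
apply: (@le_trans _ _ (4 * - ln a)); first by rewrite LE; lra.
by rewrite ler_wpM2r ?(ltW lna0)// /beta; lra.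
Qed.

Lemma exists_fine_level (c e : R) : 0 <= c -> 0 < e ->
  exists m, (0 < m)%N /\ c * m%:R * 2 ^- m <= e.
Proof.
move=> c0 e0.
have ce : 0 < e / (2 * c + 1) by rewrite divr_gt0//; lra.
have [k ke] := exists_pow2_lt ce.
have ke1 : 2 ^- k.+1 < e / (2 * c + 1).
  apply: le_lt_trans ke; rewrite lef_pV2 ?posrE ?exprn_gt0//.
  by rewrite ler_eXn2l ?ltr1n.
set l := k.+1 in ke1 *.
(* One factor [2 ^- l] absorbs [l], the other gives the smallness. *)
exists (2 * l)%N; split => //.
have p0 : 0 < 2 ^- l :> R by rewrite invr_gt0 exprn_gt0.
have lp : l%:R * 2 ^- l <= 1 :> R.
  rewrite ler_pdivrMr ?exprn_gt0// mul1r -natrX ler_nat.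
  exact/ltnW/ltn_expl.
have -> : c * (2 * l)%:R * 2 ^- (2 * l) = 2 * c * 2 ^- l * (l%:R * 2 ^- l).
  by rewrite natrM mul2n -addnn exprD invfM; ring.
apply: (@le_trans _ _ (2 * c * 2 ^- l * 1)).
  by rewrite ler_wpM2l// mulr_ge0 ?(ltW p0)// mulr_ge0.
rewrite mulr1; move: ke1; rewrite ltr_pdivlMr; last by lra.
by lra.
Qed.

Section fixed_dimension.
Context {n : nat}.
Notation mu := (gaussian_pow R n).
Notation T := (tupleR R n).
Implicit Types (A B : set T).

Lemma geometric_influence_ge0 A i : measurable A -> (0 <= geometric_influence nu A i)%E.
Proof.
move=> mA; apply: integral_ge0 => x _; apply: content_ge0.
exact: measurable_fiber.
Qed.

Lemma mu_dist A B (t v : R) : measurable A -> measurable B ->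
  mu A = t%:E -> mu B = v%:E -> (`|t - v|%:E <= mu (A `+` B))%E.
Proof.
move=> mA mB At Bv.
have mAB := measurable_setY mA mB.
have H U V u w : measurable U -> measurable V -> measurable (U `+` V) ->
    mu U = u%:E -> mu V = w%:E -> ((u - w)%:E <= mu (U `+` V))%E.
  move=> mU mV mUV Uu Vw; rewrite EFinB leeBlDr// -Uu -Vw.
  apply: (le_trans _ (measureU2 _ _ _)) => //.
  apply: le_measure; rewrite ?inE//; first exact: measurableU.
  by move=> x Ux; have [Vx|Vx] := pselect (V x); [right|left; left].
have [vt|tv] := leP v t.
  by rewrite ger0_norm ?subr_ge0//; exact: H.
by rewrite ltr0_norm ?subr_lt0// opprB setYC; apply: H => //; rewrite setYC.
Qed.

Theorem gaussian_talagrand A (t : R) : measurable A -> mu A = t%:E ->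
  (forall j, geometric_influence nu A j < small_influence%:E)%E ->
  ((talagrand_const^-1 * (t * (1 - t)))%:E <=
   \sum_(j < n) div_sqrt_log (geometric_influence nu A j))%E.
Proof.
move=> mA At small.
pose a j := fine (geometric_influence nu A j).
have aE j : geometric_influence nu A j = (a j)%:E.
  rewrite fineK// ge0_fin_numE ?geometric_influence_ge0//.
  by rewrite (lt_trans (small j))// ltry.
have a_small j : 0 <= a j < small_influence.
  by rewrite -lee_fin -lte_fin -aE small geometric_influence_ge0.
pose psi a := a / Num.sqrt (- ln a).
have psiE j : div_sqrt_log (geometric_influence nu A j) = (psi (a j))%:E.
  rewrite aE; have := a_small j; rewrite le_eqVlt => /andP[/predU1P[<- _|a0 aS]].
    by rewrite div_sqrt_log0 /psi mul0r.
  rewrite div_sqrt_log_EFin// a0 (lt_trans aS)//.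
  by have /andP[] := small_influence_bounds.
under eq_bigr do rewrite psiE.
rewrite sumEFin lee_fin ler_pdivrMl ?talagrand_const_gt0//.
apply/ler_addgt0Pr => e e0.
(* The errors are [d + 4 * eta] per coordinate and one more [eta]; as [eta <= d], they add up to at
   most [e]. *)
pose d := e / (5 * n%:R + 1).
have d0 : 0 < d by rewrite divr_gt0// ltr_wpDl// mulr_ge0.
have [K HK] := choice (fun j => talagrand_level (a_small j) d0).
have K0 j : (0 < K j)%N by have [] := HK j.
pose L := \max_j K j.
(* The second bound gives [2 * eta <= 2 ^- K j / 2], which with [2 * C * a j <= 2 ^- K j / 2] meets
   the L1 condition of [grid_talagrand]. *)
pose eta := Num.min d (2 ^- L / 4).
have eta0 : 0 < eta by rewrite lt_min d0 divr_gt0// invr_gt0 exprn_gt0.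
have etad : eta <= d by rewrite ge_min lexx.
have etaK j : eta <= 2 ^- K j / 4.
  rewrite /eta ge_min ler_pM2r ?invr_gt0// lef_pV2 ?posrE ?exprn_gt0//.
  by rewrite ler_eXn2l ?ltr1n// leq_bigmax orbT.
have [m [G AG]] := measurable_grid_approx mA eta0.
have mG : measurable [set x : T | G (grid m x)] by exact: measurable_grid.
pose S j k := \sum_(1 <= l < k.+1) mean (fun c => dyadic_trunc l (avg j (charfun G) c)) : R.
have SE j k : (0 < k)%N -> S j k <= C * Num.sqrt k%:R * a j + k%:R * eta.
  move=> k0; rewrite -lee_fin -integral_dyadic_sum_grid.
  apply: (le_trans (integral_dyadic_sum_dist k j mG mA)).
  rewrite EFinD leeD//.
    apply: (le_trans (integral_dyadic_sum_influence j mA k0)).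
    by rewrite aE -EFinM.
  by rewrite EFinM lee_wpmul2l ?lee_fin// setYC.
have mG01 : 0 <= mean (charfun G : _ -> R) <= 1.
  by rewrite -!lee_fin -mu_grid measure_ge0 probability_le1.
have tv := mu_dist mA mG At (mu_grid G).
set v := mean _ in mG01 tv.
have tv_eta : `|t - v| <= eta by rewrite -lee_fin (le_trans tv).
have t01 : 0 <= t <= 1.
  by rewrite -!lee_fin -At measure_ge0 probability_le1.
have vt : t * (1 - t) <= v * (1 - v) + eta.
  have -> : t * (1 - t) = v * (1 - v) + (t - v) * (1 - t - v) by ring.
  rewrite lerD2l (le_trans (ler_norm _))// normrM (le_trans _ tv_eta)//.
  by rewrite ler_piMr// ler_norml; lra.
have tal : v * (1 - v) <=
    \sum_j (6 * 2 ^- K j + 4 * S j (K j)) / (K j)%:R.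
  apply: grid_talagrand => // j.
  have := SE j 1%N isT; rewrite /S big_nat1 sqrtr1 mulr1 mul1r.
  by have [_ + _] := HK j; have := etaK j; lra.
apply: (le_trans vt).
apply: (@le_trans _ _ (\sum_j (talagrand_const * psi (a j) + d + 4 * eta) + eta)).
  rewrite lerD2r (le_trans tal)//; apply: ler_sum => j _.
  have [_ _ HKj] := HK j; have Kj0 : 0 < (K j)%:R :> R by rewrite ltr0n.
  apply: (@le_trans _ _ (6 * 2 ^- K j / (K j)%:R + 4 * C * a j / Num.sqrt (K j)%:R + 4 * eta)).
    rewrite mulrDl -addrA lerD2l.
    have sK0 : 0 < Num.sqrt (K j)%:R :> R by rewrite sqrtr_gt0.
    rewrite ler_pdivrMr//.
    have -> : (4 * C * a j / Num.sqrt (K j)%:R + 4 * eta) * (K j)%:R =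
       4 * (C * Num.sqrt (K j)%:R * a j + (K j)%:R * eta).
      have := sqr_sqrtr (ltW Kj0); set s := Num.sqrt _ in sK0 * => <-.
      by field; rewrite gt_eqF.
    by rewrite ler_pM2l// SE.
  by rewrite lerD2r.
rewrite !big_split/= -mulr_sumr !sumr_const card_ord.
rewrite -(mulr_natl d) -(mulr_natl (4 * eta)) -!addrA lerD2l.
have -> : e = n%:R * d + (n%:R * (4 * d) + d).
  by rewrite /d; field; rewrite gt_eqF// ltr_wpDl// mulr_ge0.
rewrite lerD2l lerD// ler_wpM2l//; lra.
Qed.

(** The bound is assumed for every [M] because the depth of the grid is chosen only afterwards, in
    terms of [n] and [eps]. *)
Lemma increasing_friedgut A (W0 eps : R) : measurable A -> increasing_set A ->
  0 <= W0 -> 0 < eps < 1 ->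
  (forall M, (\sum_(j < n) \int[mu]_x (dyadic_sum M (fiber_prob A j x))%:E <= W0%:E)%E) ->
  exists B, [/\ measurable B, determined_by_at_most (expR (34 * W0 / eps)) B &
    (mu (A `+` B) <= eps%:E)%E].
Proof.
move=> mA Aup W00 /andP[eps0 eps1] AW.
(* 34 is 32 + 2: 32 from the exponent [16 * W / (eps / 2)], 2 from absorbing the prefactor. Then
   [34 * d / eps = 1] offsets the [- 1] in [y <= expR (y - 1)]. *)
pose d := eps / 34.
have d0 : 0 < d by rewrite divr_gt0.
have n0 : 0 <= n%:R * n%:R + n%:R :> R by rewrite addr_ge0// mulr_ge0.
have [m [m0 mle]] := exists_fine_level n0 d0.
pose p : R := 2 ^- m.
have p0 : 0 < p by rewrite invr_gt0 exprn_gt0.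
have m1 : 1 <= m%:R :> R by rewrite ler1n.
have err1 : n%:R * (m%:R * (n%:R * p)) <= d.
  apply: le_trans mle; rewrite -/p.
  have -> : (n%:R * n%:R + n%:R) * m%:R * p =
     n%:R * (m%:R * (n%:R * p)) + n%:R * m%:R * p by ring.
  by rewrite lerDl !mulr_ge0// ltW.
have err2 : n%:R * p <= eps / 2.
  apply: (@le_trans _ _ d); last by rewrite /d; lra.
  apply: le_trans mle; rewrite -/p ler_wpM2r ?(ltW p0)//.
  have nm : n%:R <= n%:R * m%:R :> R by rewrite ler_peMr.
  rewrite mulrDl (le_trans nm)// lerDr !mulr_ge0//.
pose G := @inner_grid R n A m.
have mG : measurable [set x : T | G (grid m x)] by exact: measurable_grid.
have AG : (mu (A `+` [set x | G (grid m x)]) <= (n%:R * p)%:E)%E.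
  exact: mu_inner_grid.
have eps20 : 0 < eps / 2 by rewrite divr_gt0.
have W_gt0 : 0 < W0 + d by rewrite ltr_wpDl.
have GW : \sum_j \sum_(1 <= k < m.+1)
    mean (fun c => dyadic_trunc k (avg j (charfun G) c)) <= W0 + d.
  rewrite -lee_fin -sumEFin.
  apply: (@le_trans _ _ (\sum_(j < n) (\int[mu]_x (dyadic_sum m (fiber_prob A j x))%:E +
      (m%:R * (n%:R * p))%:E))%E).
    apply: lee_sum => j _; rewrite -integral_dyadic_sum_grid.
    apply: (le_trans (integral_dyadic_sum_dist m j mG mA)).
    by rewrite leeD2l// EFinM lee_wpmul2l ?lee_fin// setYC.
  rewrite big_split/= EFinD leeD//.
  rewrite sumEFin sumr_const card_ord lee_fin -[X in X <= _]mulr_natl.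
  exact: err1.
have [J [H [JW Hdet GH]]] := grid_friedgut m0 (@inner_grid_increasing _ _ _ Aup m) W_gt0 eps20 GW.
exists [set x | H (grid m x)]; split; first exact: measurable_grid.
- exists J; split.
    apply: (le_trans JW).
    (* Dividing the prefactor by [eps < 1] only enlarges it, and its exponential then has an
       exponent of the required form. *)
    pose y := 2 * (W0 + d) / eps.
    have Wy : 2 * (W0 + d) <= y.
      by rewrite /y ler_pdivlMr// ler_piMr ?(ltW eps1)// mulr_ge0// ltW.
    have yexp : y <= expR (y - 1).
      by have := expR_ge1Dx (y - 1); rewrite addrC subrK.
    have -> : expR (34 * W0 / eps) = expR (y - 1) * expR (16 * (W0 + d) / (eps / 2)).
      rewrite -expRD; congr expR; rewrite /y /d; field.
      by rewrite gt_eqF.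
    by rewrite ler_wpM2r ?expR_ge0// (le_trans Wy).
  move=> x y xy; rewrite /= (Hdet (grid m x) (grid m y))// => j jJ.
  by rewrite !ffunE xy.
apply: (le_trans (mu_setY_triangle mA mG _)); first exact: measurable_grid.
rewrite (_ : eps = eps / 2 + eps / 2); last by field.
rewrite EFinD leeD//; first by rewrite (le_trans AG)// lee_fin.
rewrite (_ : _ `+` _ = [set x | (fun c => G c != H c) (grid m x)]); last first.
  apply/seteqP; split => x /=.
    by move=> [[-> /negP/negbTE ->]|[-> /negP/negbTE ->]].
  by case: (G _); case: (H _) => // _; [left|right].
by rewrite (mu_grid (fun c => G c != H c)) lee_fin.
Qed.

Lemma dyadic_sum_le_level K M (p : R) : 0 <= p <= 1 ->
  dyadic_sum M p <= dyadic_sum K p + 2 ^- K.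
Proof. exact: sum_dyadic_trunc_le. Qed.

Lemma geometric_influence_le_peak2 A j : measurable A -> monotone_set A ->
  (geometric_influence nu A j <= peak2%:E)%E.
Proof.
move=> mA Amon.
apply: (@le_trans _ _ (\int[mu]_x (cst peak2%:E x))%E).
  apply: le_ge0_integral => x; first by apply: content_ge0; exact: measurable_fiber.
  case: Amon => Amon.
    apply: content_le_up => [|y z yz Ay]; first exact: measurable_fiber.
    by apply: (Amon _ _ Ay) => i; rewrite !tnth_mktuple; case: ifP.
  apply: content_le_down => [|y z yz Ay]; first exact: measurable_fiber.
  by apply: (Amon _ _ Ay) => i; rewrite !tnth_mktuple; case: ifP.
by rewrite integral_cst// [X in (_ * X)%E]probability_setT mule1.
Qed.

Theorem gaussian_friedgut A (s eps : R) : measurable A -> monotone_set A ->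
  (\sum_(j < n) mul_sqrt_log (geometric_influence nu A j) = s%:E)%E -> 0 < eps ->
  exists B, [/\ measurable B,
    determined_by_at_most (expR (34 * friedgut_const * s / eps)) B &
    (mu (A `+` B) <= eps%:E)%E].
Proof.
move=> mA Amon As eps0.
pose a j := fine (geometric_influence nu A j).
have aE j : geometric_influence nu A j = (a j)%:E.
  rewrite fineK// ge0_fin_numE ?geometric_influence_ge0//.
  by rewrite (le_lt_trans (geometric_influence_le_peak2 j mA Amon))// ltry.
have a_bounds j : 0 <= a j <= peak2.
  by rewrite -!lee_fin -aE geometric_influence_ge0//= geometric_influence_le_peak2.
pose psi a := a * Num.sqrt (- ln a).
have psiE j : mul_sqrt_log (geometric_influence nu A j) = (psi (a j))%:E.
  rewrite aE; have := a_bounds j; rewrite le_eqVlt => /andP[/predU1P[<- _|a0 aS]].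
    by rewrite mul_sqrt_log0 /psi mul0r.
  by rewrite mul_sqrt_log_EFin.
have sE : s = \sum_j psi (a j).
  by apply/EFin_inj; rewrite -As -sumEFin; apply: eq_bigr => j _.
have psi0 j : 0 <= psi (a j) by rewrite mulr_ge0 ?sqrtr_ge0//; have /andP[] := a_bounds j.
have s0 : 0 <= s by rewrite sE sumr_ge0.
(* For [eps >= 1] the empty set will do, determined by no coordinate. *)
have [eps1|eps1] := leP 1 eps.
  exists set0; split => //.
    exists finset.set0; rewrite finset.cards0; split => //; exact: expR_ge0.
  apply: (@le_trans _ _ 1%E); last by rewrite lee_fin.
  by apply: probability_le1; exact: measurable_setY.
have AW M : (\sum_(j < n) \int[mu]_x (dyadic_sum M (fiber_prob A j x))%:E <=
    (friedgut_const * s)%:E)%E.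
  rewrite sE mulr_sumr -sumEFin; apply: lee_sum => j _.
  have ds0 K x : 0 <= dyadic_sum K (fiber_prob A j x).
    by rewrite dyadic_sum_ge0// fiber_prob01.
  have := a_bounds j; rewrite le_eqVlt => /andP[/predU1P[a0 _|a0 ap]].
    (* [M] may be 0, while the bound by the influence asks for a positive level; a zero influence
       then annihilates every level. *)
    apply: (@le_trans _ _ (\int[mu]_x (dyadic_sum M.+1 (fiber_prob A j x))%:E)%E).
      apply: le_ge0_integral => x; rewrite lee_fin//.
      by rewrite /dyadic_sum [leRHS]big_nat_recr//= lerDl dyadic_trunc_ge0// fiber_prob01//.
    apply: (le_trans (integral_dyadic_sum_influence j mA (ltn0Sn M))).
    by rewrite aE -a0 mule0 /psi mul0r mulr0.
  have [|K [K0 Ka Kpsi]] := @friedgut_level (a j); first by rewrite a0.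
  apply: (@le_trans _ _ (\int[mu]_x ((dyadic_sum K (fiber_prob A j x))%:E + (2 ^- K)%:E))%E).
    apply: le_ge0_integral => x; first by rewrite lee_fin.
    by rewrite -EFinD lee_fin dyadic_sum_le_level// fiber_prob01.
  rewrite ge0_integralD//; last 2 first.
  - by move=> x _; rewrite lee_fin.
  - exact: measurable_dyadic_sum_fiber.
  rewrite integral_cst// [X in (_ + _ * X)%E]probability_setT mule1.
  apply: (@le_trans _ _ ((C * Num.sqrt K%:R * a j)%:E + (2 ^- K)%:E)%E).
    rewrite leeD2r// (le_trans (integral_dyadic_sum_influence j mA K0))//.
    by rewrite aE -EFinM.
  by rewrite -EFinD lee_fin.
have W0 : 0 <= friedgut_const * s by rewrite mulr_ge0// ltW// friedgut_const_gt0.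
have eps01 : 0 < eps < 1 by rewrite eps0.
rewrite -(mulrA 34); case: Amon => Amon.
  exact: increasing_friedgut.
(* A decreasing set is handled through its complement, since [dyadic_sum] is symmetric under
   [p |-> 1 - p]. *)
have mAC : measurable (~` A) by exact: measurableC.
have ACup : increasing_set (~` A).
  by move=> x y Ax xy Ay; apply: Ax; exact: Amon Ay xy.
have [|B [mB [J [JW Jdet]] AB]] := @increasing_friedgut (~` A) _ _ mAC ACup W0 eps01.
  move=> M; apply: le_trans (AW M); apply: lee_sum => j _.
  rewrite le_eqVlt; apply/orP; left; apply/eqP; apply: eq_integral => x _.
  by rewrite fiber_prob_setC// dyadic_sumC.
exists (~` B); split; first exact: measurableC.
- exists J; split => // x y /Jdet [xy yx].
  by split; apply: contra_not; [exact: yx|exact: xy].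
- by rewrite -setY_setC setCK.
Qed.

End fixed_dimension.
End gaussian_influences.

Theorem theorem1p5 (R : realType) :
  exists c1 c2 : R, 0 < c1 /\ 0 < c2 /\
  forall (n : nat) (A : set (tupleR R n)), measurable A ->
    (forall t : R, gaussian_pow R n A = t%:E ->
      ((c1 * (t * (1 - t)))%:E <=
       \sum_(i < n) div_sqrt_log (geometric_influence (std_gaussian R) A i))%E)
    /\
    (forall s : R, monotone_set A ->
      (\sum_(i < n) mul_sqrt_log (geometric_influence (std_gaussian R) A i))%E
        = s%:E ->
      forall eps : R, 0 < eps ->
      exists B : set (tupleR R n),
        [/\ measurable B,
            determined_by_at_most (expR (c2 * s / eps)) B &
            (gaussian_pow R n (A `+` B) <= eps%:E)%E]).
Proof.
have si := @small_influence_bounds R; have /andP[si0 si1] := si.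
pose d : R := small_influence / Num.sqrt (- ln small_influence).
have d0 : 0 < d by rewrite divr_gt0// sqrtr_gt0 oppr_gt0 ln_lt0.
have T0 := @talagrand_const_gt0 R.
exists (Num.min d talagrand_const^-1), (34 * friedgut_const); split.
  by rewrite lt_min d0 invr_gt0.
split; first by rewrite mulr_gt0// friedgut_const_gt0.
move=> n A mA; split=> [t At|s Amon As eps eps0]; last exact: gaussian_friedgut.
have t01 : 0 <= t <= 1 by rewrite -!lee_fin -At measure_ge0 probability_le1.
have tt0 : 0 <= t * (1 - t) by rewrite mulr_ge0; lra.
(* One influence above the threshold contributes at least [d] on its own, while
   [t * (1 - t) <= 1]. *)
have [[j sj]|small] :=
    pselect (exists j, (small_influence%:E <= geometric_influence (std_gaussian R) A j)%E).
  apply: (@le_trans _ _ d%:E).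
    rewrite lee_fin; apply: (@le_trans _ _ (d * (t * (1 - t)))).
      by rewrite ler_wpM2r// ge_min lexx.
    rewrite ler_piMr ?(ltW d0)//; have := sqr_ge0 t; rewrite expr2.
    by lra.
  apply: (le_trans (div_sqrt_log_mono si sj)).
  rewrite (bigD1 j)//= leeDl// sume_ge0// => i _.
  exact/div_sqrt_log_ge0/geometric_influence_ge0.
apply: (@le_trans _ _ (talagrand_const^-1 * (t * (1 - t)))%:E).
  by rewrite lee_fin ler_wpM2r// ge_min lexx orbT.
apply: gaussian_talagrand => // j; rewrite ltNge; apply/negP => sj.
by apply: small; exists j.
Qed.
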